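(* Let $A$ be a $0$-definable set in $\mathbb U$ and let $\mathbb U'=(\mathbb U,S,\dots)$ be a $1$-analysable cover over $A$ with independent fibres. Then there are $0$-definable families of finitely faithful connected groupoids, $\mathcal G\to A$ in $\mathbb U$ and $\mathcal G'\to A$ in $(\mathbb U')^{\mathrm{eq}}$, such that for each $a\in A$: $\mathcal G'_a$ is a one-object extension of $\mathcal G_a$ whose additional object is $S_a$, and $\operatorname{Aut}_{\mathcal G'_a}(S_a)$ together with its action on $S_a$ is isomorphic to $\operatorname{Aut}(S_a/\mathbb U)$ with its action on $S_a$.
   Context: $T$ is a complete multi-sorted theory with elimination of imaginaries in language $L$, $\mathbb U$ a monster model; ''definable'' means with parameters. A cover of $\mathbb U$ is a saturated expansion in which $\mathbb U$ is stably embedded (subsets of products of sorts of $\mathbb U$ definable in the expansion are definable in $\mathbb U$). A $1$-analysable cover over $A$ is a cover $\mathbb U'=(\mathbb U,S,\dots)$ by a single new sort $S$, in a language $L'$ finitely generated over $L$ (some $L'_\circ\subseteq L'$ with $L'_\circ\setminus L$ finite has every $L'$-formula equivalent to an $L'_\circ$-formula), with a $0$-definable surjection $S\to A$ each of whose fibres $S_a$ is internal to $\mathbb U$ (in definable bijection, with parameters, with a definable set of $\mathbb U$). $\operatorname{Aut}(S_a/\mathbb U):=\{\sigma|_{S_a}:\sigma\in\operatorname{Aut}(\mathbb U'/\mathbb U)\}$ where $\operatorname{Aut}(\mathbb U'/\mathbb U)$ is the group of automorphisms fixing $\mathbb U$ pointwise; independent fibres means $\sigma\mapsto(\sigma|_{S_a})_{a\in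 A}$ is an isomorphism $\operatorname{Aut}(\mathbb U'/\mathbb U)\to\prod_{a}\operatorname{Aut}(S_a/\mathbb U)$. A definable groupoid $(O_i,f_m)_{i\in I,m\in M}$: definable $I$, $M\to I\times I$ surjective ($M(i,j)$ fibres), $\pi:O\to I$ surjective ($O_i=\pi^{-1}(i)$), $f\subseteq M\times O\times O$ with $f_m$ the graph of a bijection $O_i\to O_j$ for $m\in M(i,j)$, distinct $m$ distinct bijections, closed under composition and inverses; connected if all $M(i,j)\ne\emptyset$; finitely faithful if each object has a finite tuple with trivial pointwise stabiliser in its automorphism group $\{f_m:m\in M(i,i)\}$. A $0$-definable family of connected groupoids over $A$, $\mathcal G\to A$: $0$-definable $I$ with surjection $I\to A$, $M$ with surjection $M\to I\times_A I$, $O$ with surjection $O\to I$, and $f\subseteq M\times_{I\times_A I}(O\times_A O)$ such that for each $a\in A$ the fibres form an $a$-definable connected groupoid $\mathcal G_a$. A one-object extension of $\mathcal G_a$ with new object $X$ is a connected groupoid whose objects are those of $\mathcal G_a$ plus $X$ and which contains $\mathcal G_a$ as the full subcategory on its objects.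
   Formalization: A cover is required, besides stable embeddedness with parameters, to induce no new 0-definable sets on U; without this the claim fails, e.g. for a torsor of an elliptic curve whose transcendental j-invariant is named only in the cover. *)

(* Defs.v *)
From Stdlib Require Import List RelationClasses.
From Corelib Require Export ssrfun.
Export ListNotations.

Set Implicit Arguments.
Unset Strict Implicit.
Unset Printing Implicit Defensive.

(** * Many-sorted first-order logic *)

Record lang := Lang {
  sort : Type;
  fsym : Type;
  farity : fsym -> list sort;
  fres : fsym -> sort;
  rsym : Type;
  rarity : rsym -> list sort
}.

(* De Bruijn variables: [var G s] is a position of sort [s] in the context [G]. *)
Inductive var (S : Type) : list S -> S -> Type :=
| var0 (s : S) (G : list S) : var (s :: G) s
| varS (s t : S) (G : list S) : var G s -> var (t :: G) s.

(* [env M G] is the product of the sorts listed in [G]. *)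
Fixpoint env (S : Type) (M : S -> Type) (G : list S) : Type :=
  match G with
  | [] => unit
  | s :: G' => (M s * env M G')%type
  end.

Fixpoint lookup (S : Type) (M : S -> Type) (G : list S) (s : S) (v : var G s) :
    env M G -> M s :=
  match v with
  | var0 _ _ => fun e => fst e
  | varS _ v' => fun e => lookup v' (snd e)
  end.

Fixpoint env_app (S : Type) (M : S -> Type) (G D : list S) :
    env M G -> env M D -> env M (G ++ D) :=
  match G with
  | [] => fun _ y => y
  | s :: G' => fun x y => (fst x, env_app (snd x) y)
  end.

Fixpoint env_map (S : Type) (M M' : S -> Type) (h : forall s, M s -> M' s)
    (G : list S) : env M G -> env M' G :=
  match G with
  | [] => fun _ => tt
  | s :: G' => fun x => (h s (fst x), env_map h (snd x))
  end.

Fixpoint env_all (S : Type) (M : S -> Type) (B : {s : S & M s} -> Prop)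
    (G : list S) : env M G -> Prop :=
  match G with
  | [] => fun _ => True
  | s :: G' => fun x => B (existT _ s (fst x)) /\ env_all B (snd x)
  end.

Fixpoint lift (S S' : Type) (j : S -> S') (M : S' -> Type) (G : list S) :
    env (fun s => M (j s)) G -> env M (map j G) :=
  match G with
  | [] => fun _ => tt
  | s :: G' => fun x => (fst x, lift (snd x))
  end.

Fixpoint unlift (S S' : Type) (j : S -> S') (M : S' -> Type) (G : list S) :
    env M (map j G) -> env (fun s => M (j s)) G :=
  match G with
  | [] => fun _ => tt
  | s :: G' => fun x => (fst x, unlift (snd x))
  end.

Inductive term (L : lang) (G : list (sort L)) : sort L -> Type :=
| Var (s : sort L) : var G s -> term G s
| App (f : fsym L) : terms G (farity f) -> term G (fres f)
with terms (L : lang) (G : list (sort L)) : list (sort L) -> Type :=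
| tnil : terms G []
| tcons (s : sort L) (D : list (sort L)) :
    term G s -> terms G D -> terms G (s :: D).

(* The remaining connectives and the existential quantifier are definable,
   since the semantics is read classically. *)
Inductive formula (L : lang) : list (sort L) -> Type :=
| Bot (G : list (sort L)) : formula G
| Eq (G : list (sort L)) (s : sort L) : term G s -> term G s -> formula G
| Rel (G : list (sort L)) (r : rsym L) : terms G (rarity r) -> formula G
| Imp (G : list (sort L)) : formula G -> formula G -> formula G
| All (G : list (sort L)) (s : sort L) : formula (s :: G) -> formula G.

Record structure (L : lang) := Structure {
  car :> sort L -> Type;
  car_inhabited : forall s, inhabited (car s);
  fint : forall f : fsym L, env car (farity f) -> car (fres f);
  rint : forall r : rsym L, env car (rarity r) -> Prop
}.

Fixpoint teval (L : lang) (M : structure L) (G : list (sort L)) (e : env M G)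
    (s : sort L) (t : term G s) : M s :=
  match t with
  | Var v => lookup v e
  | App ts => fint (tseval e ts)
  end
with tseval (L : lang) (M : structure L) (G : list (sort L)) (e : env M G)
    (D : list (sort L)) (ts : terms G D) : env M D :=
  match ts with
  | tnil _ => tt
  | tcons t ts' => (teval e t, tseval e ts')
  end.

Fixpoint sat (L : lang) (M : structure L) (G : list (sort L)) (phi : formula G) :
    env M G -> Prop :=
  match phi with
  | Bot _ => fun _ => False
  | Eq t u => fun e => teval e t = teval e u
  | Rel ts => fun e => rint (tseval e ts)
  | Imp phi psi => fun e => sat phi e -> sat psi e
  | All phi => fun e => forall x, sat phi (x, e)
  end.

Fixpoint term_in (L : lang) (F : fsym L -> Prop) (G : list (sort L))
    (s : sort L) (t : term G s) : Prop :=
  match t with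
  | Var _ => True
  | @App _ _ f ts => F f /\ terms_in F ts
  end
with terms_in (L : lang) (F : fsym L -> Prop) (G : list (sort L))
    (D : list (sort L)) (ts : terms G D) : Prop :=
  match ts with
  | tnil _ => True
  | tcons t ts' => term_in F t /\ terms_in F ts'
  end.

(* [phi] is a formula of the sublanguage with symbols [F] and [R]. *)
Fixpoint formula_in (L : lang) (F : fsym L -> Prop) (R : rsym L -> Prop)
    (G : list (sort L)) (phi : formula G) : Prop :=
  match phi with
  | Bot _ => True
  | Eq t u => term_in F t /\ term_in F u
  | @Rel _ _ r ts => R r /\ terms_in F ts
  | Imp phi psi => formula_in F R phi /\ formula_in F R psi
  | All phi => formula_in F R phi
  end.

(** * Theories *)

Definition theory (L : lang) := formula (L := L) [] -> Prop.

Definition models (L : lang) (T : theory L) (M : structure L) : Prop :=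
  forall phi, T phi -> sat (M := M) phi tt.

Definition entails (L : lang) (T : theory L) (phi : formula (L := L) []) : Prop :=
  forall M : structure L, models T M -> sat (M := M) phi tt.

Definition complete (L : lang) (T : theory L) : Prop :=
  (exists M : structure L, models T M) /\
  forall phi, entails T phi \/ entails T (Imp phi (Bot _)).

Definition rel_of (L : lang) (M : structure L) (G D : list (sort L))
    (phi : formula (G ++ D)) (x : env M G) (y : env M D) : Prop :=
  sat phi (env_app x y).

Definition elim_imaginaries (L : lang) (T : theory L) : Prop :=
  forall (G : list (sort L)) (phi : formula (G ++ G)),
    (forall M : structure L, models T M -> Equivalence (rel_of (M := M) phi)) ->
    exists (D : list (sort L)) (psi : formula (G ++ D)),
      forall M : structure L, models T M ->
        exists f : env M G -> env M D,
          (forall x y, rel_of (M := M) psi x y <-> f x = y) /\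
          (forall x x', rel_of (M := M) phi x x' <-> f x = f x').

(** * Definable sets *)

Definition definable (L : lang) (M : structure L) (G : list (sort L))
    (P : env M G -> Prop) : Prop :=
  exists (D : list (sort L)) (phi : formula (G ++ D)) (b : env M D),
    forall x, P x <-> sat phi (env_app x b).

Definition zero_definable (L : lang) (M : structure L) (G : list (sort L))
    (P : env M G -> Prop) : Prop :=
  exists phi : formula G, forall x, P x <-> sat phi x.

(* The set of tuples [c t]; when [c t] lists the coordinates of [u] and of [h u],
   this is the graph of [h]. *)
Definition image (X Y : Type) (c : X -> Y) (z : Y) : Prop := exists t, z = c t.

Record zset (L : lang) (M : structure L) := ZSet {
  zctx : list (sort L);
  zmem : env M zctx -> Prop;
  zmem_def : zero_definable zmem
}.

Definition zelt (L : lang) (M : structure L) (X : zset M) : Type :=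
  {x : env M (zctx X) | zmem x}.
Coercion zelt : zset >-> Sortclass.

Definition zval (L : lang) (M : structure L) (X : zset M) (x : X) :
  env M (zctx X) := proj1_sig x.

(** * Saturation *)

(* Classically, no injection of [Y] into [X] means [|X| < |Y|]. *)
Definition card_lt (X Y : Type) : Prop := ~ exists f : Y -> X, injective f.

Definition points (L : lang) (M : structure L) : Type := {s : sort L & M s}.

(* Formulas with parameters in one free variable of sort [s]. *)
Definition pformula (L : lang) (M : structure L) (s : sort L) : Type :=
  {D : list (sort L) & (formula (s :: D) * env M D)%type}.

Definition psat (L : lang) (M : structure L) (s : sort L)
    (q : pformula M s) (x : M s) : Prop :=
  sat (M := M) (fst (projT2 q)) (x, snd (projT2 q)).

Definition pover (L : lang) (M : structure L) (s : sort L)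
    (B : points M -> Prop) (q : pformula M s) : Prop :=
  env_all B (snd (projT2 q)).

Definition saturated (L : lang) (M : structure L) : Prop :=
  forall B : points M -> Prop, card_lt {x | B x} (points M) ->
  forall (s : sort L) (p : pformula M s -> Prop),
    (forall q, p q -> pover B q) ->
    (forall l : list (pformula M s), (forall q, In q l -> p q) ->
       exists x, forall q, In q l -> psat q x) ->
    exists x, forall q, p q -> psat q x.

Definition monster (L : lang) (M : structure L) : Prop :=
  saturated M /\ card_lt {G : list (sort L) & formula G} (points M).

(** * Expansions *)

(* Symbols added to [L], together with a type [K] of new sorts.  The new symbols
   may involve old and new sorts alike. *)
Record lang_ext (L : lang) (K : Type) := LangExt {
  nfsym : Type;
  nfarity : nfsym -> list (sort L + K);
  nfres : nfsym -> sort L + K;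
  nrsym : Type;
  nrarity : nrsym -> list (sort L + K)
}.

Definition extend (L : lang) (K : Type) (N : lang_ext L K) : lang := {|
  sort := (sort L + K)%type;
  fsym := (fsym L + nfsym N)%type;
  farity f := match f with inl f => map inl (farity f) | inr g => nfarity g end;
  fres f := match f with inl f => inl (fres f) | inr g => nfres g end;
  rsym := (rsym L + nrsym N)%type;
  rarity r := match r with inl r => map inl (rarity r) | inr q => nrarity q end
|}.

Definition ext_car (L : lang) (K : Type) (U : structure L) (C : K -> Type)
    (s : sort L + K) : Type :=
  match s with inl s => U s | inr k => C k end.

Record expansion (L : lang) (K : Type) (U : structure L) (N : lang_ext L K) :=
  Expansion {
    ncar : K -> Type;
    ncar_inhabited : forall k, inhabited (ncar k);
    nfint : forall g : nfsym N,
      env (ext_car U ncar) (nfarity g) -> ext_car U ncar (nfres g);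
    nrint : forall q : nrsym N, env (ext_car U ncar) (nrarity q) -> Prop
  }.

Section Expand.
Variables (L : lang) (K : Type) (U : structure L) (N : lang_ext L K).
Variable X : expansion U N.

Definition expand_inhabited (s : sort (extend N)) :
    inhabited (ext_car U (ncar X) s) :=
  match s with
  | inl s => car_inhabited U s
  | inr k => ncar_inhabited X k
  end.

Definition expand_fint (f : fsym (extend N)) :
    env (ext_car U (ncar X)) (farity f) -> ext_car U (ncar X) (fres f) :=
  match f with
  | inl f => fun v => fint (unlift (j := inl) (M := ext_car U (ncar X)) v)
  | inr g => fun v => nfint v
  end.

Definition expand_rint (r : rsym (extend N)) :
    env (ext_car U (ncar X)) (rarity r) -> Prop :=
  match r with
  | inl r => fun v => rint (unlift (j := inl) (M := ext_car U (ncar X)) v)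
  | inr q => fun v => nrint v
  end.

Definition expand : structure (extend N) :=
  Structure expand_inhabited expand_fint expand_rint.

Definition to_exp (G : list (sort L)) (x : env U G) : env expand (map inl G) :=
  lift (j := inl) (M := expand) x.

Definition of_exp (G : list (sort L)) (x : env expand (map inl G)) : env U G :=
  unlift (j := inl) (M := expand) x.

End Expand.

(** * The structure [M^eq] *)

Section Eq.
Variables (L : lang) (M : structure L).

Record eqsort := EqSort {
  ectx : list (sort L);
  erel : formula (ectx ++ ectx);
  erel_equiv : Equivalence (rel_of (M := M) erel)
}.

Definition eq_ext : lang_ext L eqsort := {|
  nfsym := eqsort;
  nfarity E := map inl (ectx E);
  nfres E := inr E;
  nrsym := Empty_set;
  nrarity q := match q with end
|}.

Definition eclass (E : eqsort) : Type :=
  {c : env M (ectx E) -> Prop | exists x, c = rel_of (erel E) x}.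

Definition eproj (E : eqsort) (x : env M (ectx E)) : eclass E :=
  exist _ (rel_of (erel E) x) (ex_intro _ x eq_refl).

Definition env_inhabited (G : list (sort L)) : inhabited (env M G) :=
  list_rect (fun G => inhabited (env M G)) (inhabits tt)
    (fun s _ IH => match car_inhabited M s, IH with
                   | inhabits x, inhabits e => inhabits (x, e)
                   end) G.

Definition eclass_inhabited (E : eqsort) : inhabited (eclass E) :=
  match env_inhabited (ectx E) with inhabits x => inhabits (eproj x) end.

Definition eq_expansion : expansion M eq_ext :=
  @Expansion L eqsort M eq_ext eclass eclass_inhabited
    (fun (E : eqsort) v => eproj (unlift (j := inl) (M := ext_car M eclass) v))
    (fun q _ => match q with end).

Definition eq_structure : structure (extend eq_ext) := expand eq_expansion.

End Eq.

(** * Covers *)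

Section Cover.
Variables (L : lang) (K : Type) (U : structure L) (N : lang_ext L K).
Variable X : expansion U N.

Definition stably_embedded : Prop :=
  forall (G : list (sort L)) (P : env U G -> Prop),
    definable (M := expand X) (fun z => P (of_exp z)) -> definable P.

Definition no_new_zero_definable : Prop :=
  forall (G : list (sort L)) (P : env U G -> Prop),
    zero_definable (M := expand X) (fun z => P (of_exp z)) -> zero_definable P.

(* Stable embeddedness is understood at the level of parameter-free definability
   as well: the expansion induces no new 0-definable structure on [U].
   Without this, naming an element of [U] by a constant would yield a cover. *)
Definition cover : Prop :=
  saturated (expand X) /\ stably_embedded /\ no_new_zero_definable.

Definition finitely_generated : Prop :=
  exists (F : fsym (extend N) -> Prop) (R : rsym (extend N) -> Prop),
    (exists l, forall g, F (inr g) -> In g l) /\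
    (exists l, forall q, R (inr q) -> In q l) /\
    forall (G : list (sort (extend N))) (phi : formula G),
      exists psi : formula G, formula_in F R psi /\
        forall x : env (expand X) G, sat phi x <-> sat psi x.

(* Internality of a set [P] of elements of a new sort. *)
Definition internal (k : K) (P : ncar X k -> Prop) : Prop :=
  exists (D : list (sort L)) (Q : env U D -> Prop) (h : {x | P x} -> {y | Q y}),
    definable Q /\ bijective h /\
    definable (M := expand X) (G := inr k :: map inl D)
      (image (fun t => (proj1_sig t, to_exp X (proj1_sig (h t))))).

End Cover.

Definition is_automorphism (L : lang) (M : structure L)
    (sigma : forall s, M s -> M s) : Prop :=
  (forall s, bijective (sigma s)) /\
  (forall (f : fsym L) (v : env M (farity f)),
     sigma _ (fint v) = fint (env_map sigma v)) /\
  (forall (r : rsym L) (v : env M (rarity r)),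
     rint v <-> rint (env_map sigma v)).

Section Analysable.
Variables (L : lang) (U : structure L) (N : lang_ext L unit).
Variables (X : expansion U N) (A : zset U).

(* The new sort [S], and the map [S -> A]. *)
Definition newsort : Type := ncar X tt.

Variable p : newsort -> A.

Definition fibre (a : A) : Type := {x : newsort | p x = a}.

Definition one_analysable_cover : Prop :=
  cover X /\ finitely_generated X /\
  zero_definable (M := expand X) (G := inr tt :: map inl (zctx A))
    (image (fun x => (x, to_exp X (zval (p x))))) /\
  (forall a, exists x, p x = a) /\
  (forall a, internal (k := tt) (fun x => p x = a)).

Definition aut_over (sigma : forall s, expand X s -> expand X s) : Prop :=
  is_automorphism sigma /\ forall (s : sort L) (x : U s), sigma (inl s) x = x.

Definition restricts (sigma : forall s, expand X s -> expand X s) (a : A)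
    (g : fibre a -> fibre a) : Prop :=
  forall x : fibre a, proj1_sig (g x) = sigma (inr tt) (proj1_sig x).

Definition aut_fibre (a : A) : Type :=
  {g : fibre a -> fibre a | exists sigma, aut_over sigma /\ restricts sigma g}.

(* The restriction map into the product of the [aut_fibre a] is automatically a
   homomorphism; it is an isomorphism when it is surjective and injective. *)
Definition independent_fibres : Prop :=
  (forall g : (forall a, aut_fibre a), exists sigma,
     aut_over sigma /\ forall a, restricts sigma (proj1_sig (g a))) /\
  (forall (g : forall a, aut_fibre a) sigma tau,
     aut_over sigma -> (forall a, restricts sigma (proj1_sig (g a))) ->
     aut_over tau -> (forall a, restricts tau (proj1_sig (g a))) ->
     forall s x, sigma s x = tau s x).

End Analysable.

(** * Families of definable groupoids *)

(* A 0-definable family of connected groupoids over [A].  The base is a type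
   with coordinates [cA] in [M], so that the same [A] can be used for [U] and for
   an expansion of [U].  Morphisms lie over the fibre product of [Ob] with itself
   over [A], hence the axioms below hold for the family iff they hold for each
   fibre separately. *)
Record groupoid_family (L : lang) (M : structure L) (A : Type)
    (GA : list (sort L)) (cA : A -> env M GA) := GroupoidFamily {
  Ob : zset M;
  Mor : zset M;
  Pt : zset M;
  base : Ob -> A;
  src : Mor -> Ob;
  tgt : Mor -> Ob;
  over : Pt -> Ob;
  act : Mor -> Pt -> Pt -> Prop;

  base_def : zero_definable
    (image (fun i => env_app (zval i) (cA (base i))));
  ends_def : zero_definable
    (image (fun m => env_app (zval m) (env_app (zval (src m)) (zval (tgt m)))));
  over_def : zero_definable
    (image (fun x => env_app (zval x) (zval (over x))));
  act_def : zero_definable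
    (fun z => exists m x y,
       act m x y /\ z = env_app (zval m) (env_app (zval x) (zval y)));

  base_surj : forall a, exists i, base i = a;
  ends_base : forall m, base (src m) = base (tgt m);
  ends_surj : forall i j, base i = base j -> exists m, src m = i /\ tgt m = j;
  over_surj : forall i, exists x, over x = i;

  act_over : forall m x y, act m x y -> over x = src m /\ over y = tgt m;
  act_fun : forall m x, over x = src m -> exists! y, act m x y;
  act_bij : forall m y, over y = tgt m -> exists! x, act m x y;
  act_ext : forall m n, src m = src n -> tgt m = tgt n ->
    (forall x y, act m x y <-> act n x y) -> m = n;
  mor_comp : forall m n, tgt m = src n ->
    exists r, src r = src m /\ tgt r = tgt n /\
      forall x z, act r x z <-> exists y, act m x y /\ act n y z;
  mor_inv : forall m,
    exists n, src n = tgt m /\ tgt n = src m /\ forall x y, act n y x <-> act m x y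
}.

Section Groupoids.
Variables (L : lang) (M : structure L) (A : Type).
Variables (GA : list (sort L)) (cA : A -> env M GA) (F : groupoid_family cA).

Definition finitely_faithful : Prop :=
  forall i : Ob F, exists l : list (Pt F),
    (forall x, In x l -> over x = i) /\
    forall m : Mor F, src m = i -> tgt m = i -> (forall x, In x l -> act m x x) ->
      forall x, over x = i -> act m x x.

Definition gaut (i : Ob F) : Type := {m : Mor F | src m = i /\ tgt m = i}.

End Groupoids.

Section Main.
Variables (L : lang) (U : structure L) (N : lang_ext L unit).
Variables (X : expansion U N) (A : zset U) (p : newsort X -> A).

Definition Ueq := eq_structure (expand X).

Definition to_Ueq (G : list (sort L)) (x : env U G) :
    env Ueq (map inl (map inl G)) :=
  to_exp (eq_expansion (expand X)) (to_exp X x).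

Variable F : groupoid_family (M := U) (zval (X := A)).
Variable F' : groupoid_family (M := Ueq) (fun a : A => to_Ueq (zval a)).

(* 0-definable maps identifying the data of [F] with part of the data of [F'],
   the elements of [A] with the additional objects, and [newsort X] with the
   points of the additional objects.  Inclusion of sets that live in different
   products of sorts is rendered by such maps. *)
Record extension_maps := ExtensionMaps {
  iOb : Ob F -> Ob F';
  iMor : Mor F -> Mor F';
  iPt : Pt F -> Pt F';
  newob : A -> Ob F';
  newpt : newsort X -> Pt F';
  iOb_def : zero_definable
    (image (fun i => env_app (to_Ueq (zval i)) (zval (iOb i))));
  iMor_def : zero_definable
    (image (fun m => env_app (to_Ueq (zval m)) (zval (iMor m))));
  iPt_def : zero_definable
    (image (fun x => env_app (to_Ueq (zval x)) (zval (iPt x))));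
  newob_def : zero_definable
    (image (fun a => env_app (to_Ueq (zval a)) (zval (newob a))));
  newpt_def : zero_definable (M := Ueq) (G := inl (inr tt) :: zctx (Pt F'))
    (image (fun s => (s, zval (newpt s))))
}.

Variable E : extension_maps.

(* The fibre of [F'] at [a] is a one-object extension of the fibre of [F] at [a],
   with additional object [newob a], whose set of points is the fibre of [p]. *)
Record one_object_extension (a : A) : Prop := OneObjectExtension {
  iOb_base : forall i : Ob F, base i = a -> base (iOb E i) = a;
  iOb_inj : forall i j : Ob F, base i = a -> base j = a ->
    iOb E i = iOb E j -> i = j;
  newob_base : base (newob E a) = a;
  newob_new : forall i : Ob F, base i = a -> iOb E i <> newob E a;
  ob_cases : forall i' : Ob F', base i' = a ->
    i' = newob E a \/ exists i : Ob F, base i = a /\ iOb E i = i';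

  iPt_over : forall x : Pt F, base (over x) = a ->
    over (iPt E x) = iOb E (over x);
  iPt_inj : forall x y : Pt F, base (over x) = a -> base (over y) = a ->
    iPt E x = iPt E y -> x = y;
  iPt_onto : forall (i : Ob F) (x' : Pt F'), base i = a -> over x' = iOb E i ->
    exists x : Pt F, over x = i /\ iPt E x = x';

  iMor_ends : forall m : Mor F, base (src m) = a ->
    src (iMor E m) = iOb E (src m) /\ tgt (iMor E m) = iOb E (tgt m);
  iMor_act : forall (m : Mor F) (x y : Pt F), base (src m) = a ->
    over x = src m -> over y = tgt m ->
    (act (iMor E m) (iPt E x) (iPt E y) <-> act m x y);
  iMor_inj : forall m n : Mor F, base (src m) = a -> base (src n) = a ->
    iMor E m = iMor E n -> m = n;
  iMor_full : forall (i j : Ob F) (m' : Mor F'), base i = a -> base j = a ->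
    src m' = iOb E i -> tgt m' = iOb E j ->
    exists m : Mor F, src m = i /\ tgt m = j /\ iMor E m = m';

  newpt_over : forall s, p s = a -> over (newpt E s) = newob E a;
  newpt_inj : forall s t, p s = a -> p t = a -> newpt E s = newpt E t -> s = t;
  newpt_onto : forall x' : Pt F', over x' = newob E a ->
    exists s, p s = a /\ newpt E s = x'
}.

(* An isomorphism between the vertex group of [F'] at [newob a] and the group
   [Aut(S_a/U)] that is compatible with the two actions on [S_a]. *)
Definition same_action (a : A) : Prop :=
  exists h : gaut (newob E a) -> aut_fibre p a,
    bijective h /\
    (forall m n r : gaut (newob E a),
       (forall x z, act (proj1_sig r) x z <->
          exists y, act (proj1_sig m) x y /\ act (proj1_sig n) y z) ->
       forall x, proj1_sig (h r) x = proj1_sig (h n) (proj1_sig (h m) x)) /\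
    (forall (m : gaut (newob E a)) (x y : fibre p a),
       act (proj1_sig m) (newpt E (proj1_sig x)) (newpt E (proj1_sig y)) <->
       proj1_sig (h m) x = y).

End Main.

(* Main.v *)
From Corelib Require Import ssreflect.
From Stdlib Require Import Classical ClassicalEpsilon FunctionalExtensionality.
From Stdlib Require Import PropExtensionality Eqdep List RelationClasses Cantor Wellfounded.
From mathcomp Require eqtype ssrbool boolp classical_sets wochoice.
Require Import Defs.
Set Implicit Arguments.
Unset Strict Implicit.
Unset Printing Implicit Defensive.
Unset Asymmetric Patterns.

(* An injection of a fibre [S_a] into [U] is given by a formula [chi] and a parameter
   [b].  By homogeneity over [U], stable embeddedness and compactness, some formula
   over [U] satisfied by [b] has only realisations conjugate to [b] under
   [Aut(U'/U)]; another compactness argument makes the formulas uniform in [a].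
   For such a formula with parameter [u], the injections [f_z], for [z] realising
   it, and their conjugates form a torsor under [Aut(S_a/U)] with a common image
   [O_(a,u)] in [U].  Conjugacy itself is first-order: by independence of the fibres
   and finite generation of the language, [b] and [z] are conjugate over [U] iff
   [f_z^-1 f_b], extended by the identity outside [S_a], preserves finitely many
   symbols.  The bijections [f_z' f_z^-1] between the sets [O_(a,u)] are the morphisms
   of [G_a], coded in [U] by elimination of imaginaries; adding the fibres [S_a]
   themselves as objects, with the [f_z] as morphisms, gives [G'_a] in [(U')^eq].
   An automorphism of [S_a] that fixes the coordinates in [S_a] of a parameter of
   an injection extends, by independence, to one fixing the parameter, so it is
   trivial: this is finite faithfulness. *)

(** * Renaming of variables *)

(** The type of a parameter over all of [U] is a type over a set that need not be small, and
    saturation says nothing about such types. Stable embeddedness replaces it by small data: each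
    formula cuts out on [U] a set definable with a finite tuple of parameters, so one tuple for each
    formula controls the type. This needs the formulas of [U'] to be few; up to equivalence they lie
    in a sublanguage with finitely many new symbols, whose formulas in a given context inject into
    the closed formulas of [L]. Saturation is assumed for formulas in one variable only, so
    compactness in several variables is obtained by projecting variables away one at a time. The
    sets that make up the family in [U] are first defined in [U'], where the identifications live;
    since they lie in products of sorts of [U], the absence of new 0-definable sets makes them
    0-definable in [U]. The torsors make composition formal: a composite is again of the form
    [f_z' f_z^-1] because any two identifications attached to an object differ by an element of the
    group. *)

Section Renaming.
Variable S : Type.

Definition ren (G D : list S) := forall s, var G s -> var D s.

(** The motive [P] is abstracted inside the match, so case analysis on a variable of a nonempty
    context needs no inversion of an equality between contexts. *)
Definition var_cases (t : S) (G : list S) (P : S -> Type) (h0 : P t)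
    (hS : forall s, var G s -> P s) (s : S) (v : var (t :: G) s) : P s :=
  match v in var G0 s0
    return match G0 with
           | [] => unit
           | t0 :: G1 => forall P : S -> Type,
               P t0 -> (forall s, var G1 s -> P s) -> P s0
           end
  with
  | var0 _ _ => fun P h0 _ => h0
  | varS _ v => fun P _ hS => hS _ v
  end P h0 hS.

Definition up_ren (t : S) (G D : list S) (r : ren G D) : ren (t :: G) (t :: D) :=
  fun s => var_cases (P := var (t :: D)) (var0 t D) (fun s v => varS t (r s v)) (s := s).

(** Environments are contravariant: [r] names, for each variable of [G], the coordinate of [e] to be
    read. Permuting, repeating and dropping coordinates are all instances. *)
Fixpoint pull (M : S -> Type) (G D : list S) : ren G D -> env M D -> env M G :=
  match G with
  | [] => fun _ _ => tt
  | s :: G' => fun r e => (lookup (r s (var0 s G')) e, pull (fun t v => r t (varS s v)) e)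
  end.

Variable M : S -> Type.

Lemma lookup_pull (G D : list S) (r : ren G D) (e : env M D) s (v : var G s) :
  lookup v (pull r e) = lookup (r s v) e.
Proof. by elim: v D r e => [t G'|t u G' v IH] D r e //=; rewrite IH. Qed.

Lemma env_ext (G : list S) (e e' : env M G) :
  (forall s (v : var G s), lookup v e = lookup v e') -> e = e'.
Proof.
elim: G e e' => [[] []|s G IH [x e] [x' e']] H //.
have -> : x = x' by exact: (H s (var0 s G)).
by rewrite (IH e e') // => t v; exact: (H t (varS s v)).
Qed.

Lemma pull_eq (G D : list S) (r : ren G D) (e : env M D) (f : env M G) :
  (forall s (v : var G s), lookup (r s v) e = lookup v f) -> pull r e = f.
Proof. by move=> H; apply: env_ext => s v; rewrite lookup_pull. Qed.

Lemma pull_up (t : S) (G D : list S) (r : ren G D) (x : M t) (e : env M D) :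
  pull (up_ren (t := t) r) (x, e) = (x, pull r e) :> env M (t :: G).
Proof. by congr pair; apply: env_ext => s v; rewrite !lookup_pull. Qed.

Lemma pull_comp (G D E : list S) (r : ren G D) (r' : ren D E) (e : env M E) :
  pull r (pull r' e) = pull (fun s v => r' s (r s v)) e.
Proof. by apply: pull_eq => s v; rewrite !lookup_pull. Qed.

Lemma pull_id (G : list S) (e : env M G) : pull (fun s v => v) e = e.
Proof. exact: pull_eq. Qed.

Fixpoint vleft (G D : list S) s (v : var G s) : var (G ++ D) s :=
  match v in var G0 s0 return var (G0 ++ D) s0 with
  | var0 _ _ => var0 _ _
  | varS _ v' => varS _ (vleft D v')
  end.

Fixpoint vright (G D : list S) s (v : var D s) : var (G ++ D) s :=
  match G with [] => v | t :: G' => varS t (vright G' v) end.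

Lemma lookup_vleft (G D : list S) (x : env M G) (y : env M D) s (v : var G s) :
  lookup (vleft D v) (env_app x y) = lookup v x.
Proof. by elim: v x => [t G'|t u G' v IH] x //=; rewrite IH. Qed.

Lemma lookup_vright (G D : list S) (x : env M G) (y : env M D) s (v : var D s) :
  lookup (vright G v) (env_app x y) = lookup v y.
Proof. by elim: G x => [|t G' IH] x //=. Qed.

Definition eleft (G D : list S) (e : env M (G ++ D)) : env M G :=
  pull (fun s v => vleft D v) e.

Definition eright (G D : list S) (e : env M (G ++ D)) : env M D :=
  pull (fun s v => vright G v) e.

Lemma eleft_app (G D : list S) (x : env M G) (y : env M D) : eleft (env_app x y) = x.
Proof. by apply: pull_eq => s v; rewrite lookup_vleft. Qed.

Lemma eright_app (G D : list S) (x : env M G) (y : env M D) : eright (env_app x y) = y.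
Proof. by apply: pull_eq => s v; rewrite lookup_vright. Qed.

Lemma app_split (G D : list S) (e : env M (G ++ D)) : env_app (eleft e) (eright e) = e.
Proof.
elim: G e => [|s G IH] e /=; first exact: pull_id.
case: e => x e; congr pair.
rewrite -[in RHS](IH e); congr env_app.
- by apply: pull_eq => t v; rewrite lookup_pull.
- by apply: pull_eq => t v; rewrite lookup_pull.
Qed.

Lemma env_app_inj (G D : list S) (x x' : env M G) (y y' : env M D) :
  env_app x y = env_app x' y' -> x = x' /\ y = y'.
Proof.
by move=> H; split; [rewrite -(eleft_app x y) H eleft_app
                    |rewrite -(eright_app x y) H eright_app].
Qed.

Fixpoint ren_split (G D E : list S) : ren G E -> ren D E -> ren (G ++ D) E :=
  match G with
  | [] => fun _ r => r
  | t :: G' => fun r1 r2 s =>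
      var_cases (P := var E) (r1 t (var0 t G')) (ren_split (fun s v => r1 s (varS t v)) r2) (s := s)
  end.

Lemma pull_split (G D E : list S) (r1 : ren G E) (r2 : ren D E) (e : env M E) :
  pull (ren_split r1 r2) e = env_app (pull r1 e) (pull r2 e).
Proof. by elim: G r1 => [|t G IH] r1 //=; rewrite -IH. Qed.

End Renaming.

Scheme term_ind2 := Induction for term Sort Prop
with terms_ind2 := Induction for terms Sort Prop.
Combined Scheme term_terms_ind from term_ind2, terms_ind2.

Section RenameFormula.
Variable L : lang.

Fixpoint tren (G D : list (sort L)) (r : ren G D) s (t : term G s) : term D s :=
  match t with
  | Var v => Var (r _ v)
  | App ts => App (tsren r ts)
  end
with tsren (G D : list (sort L)) (r : ren G D) E (ts : terms G E) : terms D E :=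
  match ts with
  | tnil _ => tnil _
  | tcons t ts' => tcons (tren r t) (tsren r ts')
  end.

Fixpoint fren (G : list (sort L)) (phi : formula G) : forall D, ren G D -> formula D :=
  match phi with
  | Bot _ => fun D r => Bot D
  | Eq t u => fun D r => Eq (tren r t) (tren r u)
  | Rel ts => fun D r => Rel (tsren r ts)
  | Imp phi psi => fun D r => Imp (fren phi r) (fren psi r)
  | All phi => fun D r => All (fren phi (up_ren r))
  end.

Variable M : structure L.

Lemma eval_ren (G D : list (sort L)) (r : ren G D) (e : env M D) :
  (forall s (t : term G s), teval e (tren r t) = teval (pull r e) t) /\
  (forall E (ts : terms G E), tseval e (tsren r ts) = tseval (pull r e) ts).
Proof.
apply: term_terms_ind => //=.
- by move=> s v; rewrite lookup_pull.
- by move=> f ts ->.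
- by move=> s D' t -> ts ->.
Qed.

Lemma sat_ren (G : list (sort L)) (phi : formula G) D (r : ren G D) (e : env M D) :
  sat (fren phi r) e <-> sat phi (pull r e).
Proof.
elim: phi D r e => [G'|G' s t u|G' q ts|G' phi IH1 psi IH2|G' s phi IH] D r e //=.
- by rewrite !(proj1 (eval_ren r e)).
- by rewrite (proj2 (eval_ren r e)).
- by rewrite IH1 IH2.
- by split=> H x; move: (H x); rewrite IH pull_up.
Qed.

End RenameFormula.

(** * Types with coordinates, and 0-definable predicates on them *)

(** A type identified with a product of sorts of [N]. Definability can then be stated for predicates
    on ordinary products of types, and contexts and indices are handled once, by the instances. *)
Class Rep (L : lang) (N : structure L) (X : Type) := MkRep {
  rctx : list (sort L);
  renc : X -> env N rctx;
  rdec : env N rctx -> X;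
  rencK : forall x, rdec (renc x) = x;
  rdecK : forall e, renc (rdec e) = e
}.
Arguments rctx {L} N X {Rep}.
Arguments renc {L} N {X Rep}.
Arguments rdec {L} N {X Rep}.

#[export] Hint Mode Rep + + ! : typeclass_instances.
#[export] Hint Opaque env : typeclass_instances.

#[export] Instance Rep_env (L : lang) (N : structure L) G : Rep N (env N G) :=
  MkRep (N := N) (X := env N G) (renc := fun x => x) (rdec := fun x => x)
    (fun x => eq_refl) (fun x => eq_refl).

#[export] Instance Rep_unit (L : lang) (N : structure L) : Rep N unit :=
  MkRep (N := N) (X := unit) (rctx := []) (renc := fun x => x) (rdec := fun x => x)
    (fun x => eq_refl) (fun x => eq_refl).

#[export] Instance Rep_car (L : lang) (N : structure L) s : Rep N (N s).
Proof.
refine (MkRep (N := N) (X := N s) (rctx := [s]) (renc := fun x => (x, tt)) (rdec := fst) _ _).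
- by [].
- by case=> x [].
Defined.

#[export] Instance Rep_prod (L : lang) (N : structure L) X Y (RX : Rep N X) (RY : Rep N Y) :
  Rep N (X * Y)%type.
Proof.
refine (MkRep (N := N) (X := (X * Y)%type) (rctx := rctx N X ++ rctx N Y)
  (renc := fun t => env_app (renc N (fst t)) (renc N (snd t)))
  (rdec := fun e => (rdec N (eleft e), rdec N (eright e))) _ _).
- by case=> x y /=; rewrite eleft_app eright_app !rencK.
- by move=> e /=; rewrite !rdecK app_split.
Defined.

Lemma Rep_inhabited (L : lang) (N : structure L) X (RX : Rep N X) : inhabited X.
Proof. case: (env_inhabited N (rctx N X)) => e; exact: (inhabits (rdec N e)). Qed.

Lemma renc_inj (L : lang) (N : structure L) X (RX : Rep N X) (x y : X) :
  renc N x = renc N y -> x = y.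
Proof. by move=> H; rewrite -(rencK (N := N) x) H rencK. Qed.

Definition zd (L : lang) (N : structure L) (X : Type) {RX : Rep N X} (P : X -> Prop) : Prop :=
  exists phi : formula (rctx N X), forall x, P x <-> sat phi (renc N x).

(* [f] permutes, repeats and drops coordinates, as a change of variables does. *)
Definition pm (L : lang) (N : structure L) (X Y : Type) {RX : Rep N X} {RY : Rep N Y} (f : X -> Y) : Prop :=
  exists r : ren (rctx N Y) (rctx N X), forall x, renc N (f x) = pull r (renc N x).

Arguments zd {L} N {X RX} P.
Arguments pm {L} N {X Y RX RY} f.

Section Zd.
Variables (L : lang) (N : structure L).

Context {X Y Z : Type} {RX : Rep N X} {RY : Rep N Y} {RZ : Rep N Z}.

Lemma pm_id : pm N (fun x : X => x).
Proof. by exists (fun s v => v) => x; rewrite pull_id. Qed.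

Lemma pm_comp (f : X -> Y) (g : Y -> Z) : pm N f -> pm N g -> pm N (fun x => g (f x)).
Proof.
move=> [r Hr] [r' Hr']; exists (fun s v => r s (r' s v)) => x.
by rewrite Hr' Hr pull_comp.
Qed.

Lemma pm_pair (f : X -> Y) (g : X -> Z) : pm N f -> pm N g -> pm N (fun x => (f x, g x)).
Proof. by move=> [r Hr] [r' Hr']; exists (ren_split r r') => x; rewrite pull_split /= Hr Hr'. Qed.

Lemma pm_fst (f : X -> Y * Z) : pm N f -> pm N (fun x => fst (f x)).
Proof.
move=> [r Hr]; exists (fun s v => r s (vleft _ v)) => x.
by rewrite -(pull_comp (fun s v => vleft _ v) r) -Hr /= -/(eleft _) eleft_app.
Qed.

Lemma pm_snd (f : X -> Y * Z) : pm N f -> pm N (fun x => snd (f x)).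
Proof.
move=> [r Hr]; exists (fun s v => r s (vright _ v)) => x.
by rewrite -(pull_comp (fun s v => vright _ v) r) -Hr /= -/(eright _) eright_app.
Qed.

Lemma pm_tt : pm N (fun x : X => tt).
Proof. by exists (fun s (v : var [] s) => match v with end). Qed.

Lemma zd_iff_ext (P Q : X -> Prop) : (forall x, P x <-> Q x) -> zd N P -> zd N Q.
Proof. by move=> H [phi Hphi]; exists phi => x; rewrite -H. Qed.

Lemma zd_comp (P : Y -> Prop) (f : X -> Y) : zd N P -> pm N f -> zd N (fun x => P (f x)).
Proof.
move=> [phi Hphi] [r Hr]; exists (fren phi r) => x.
by rewrite sat_ren -Hr.
Qed.

Lemma zd_imp (P Q : X -> Prop) : zd N P -> zd N Q -> zd N (fun x => P x -> Q x).
Proof. by move=> [p Hp] [q Hq]; exists (Imp p q) => x /=; rewrite Hp Hq. Qed.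

Lemma zd_False : zd N (fun _ : X => False).
Proof. by exists (Bot _). Qed.

Lemma zd_not (P : X -> Prop) : zd N P -> zd N (fun x => ~ P x).
Proof. by move=> HP; apply: zd_imp => //; exact: zd_False. Qed.

Lemma zd_True : zd N (fun _ : X => True).
Proof. by apply: zd_iff_ext (zd_not zd_False) => x; split=> // _ []. Qed.

Lemma zd_and (P Q : X -> Prop) : zd N P -> zd N Q -> zd N (fun x => P x /\ Q x).
Proof.
move=> HP HQ; apply: zd_iff_ext (zd_not (zd_imp HP (zd_not HQ))) => x; split.
- by move=> H; apply: NNPP => H'; apply: H => p q; apply: H'.
- by move=> [p q] H; exact: H.
Qed.

Lemma zd_or (P Q : X -> Prop) : zd N P -> zd N Q -> zd N (fun x => P x \/ Q x).
Proof.
move=> HP HQ; apply: zd_iff_ext (zd_imp (zd_not HP) HQ) => x; split.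
- by case: (classic (P x)) => [p _|np H]; [left|right; exact: H].
- by case.
Qed.

Lemma zd_iff (P Q : X -> Prop) : zd N P -> zd N Q -> zd N (fun x => P x <-> Q x).
Proof. by move=> HP HQ; apply: zd_and; apply: zd_imp. Qed.

Lemma zd_all_list (I : Type) (l : list I) (P : I -> X -> Prop) :
  (forall i, In i l -> zd N (P i)) -> zd N (fun x => forall i, In i l -> P i x).
Proof.
elim: l => [|i l IH] H; first by apply: zd_iff_ext zd_True => x; split=> // _ i [].
apply: zd_iff_ext (zd_and (H i (or_introl eq_refl)) (IH (fun j Hj => H j (or_intror Hj)))).
move=> x; split=> [[Hi Hl] j [<- //|]|Hl]; first exact: Hl.
by split; [apply: Hl; left|move=> j Hj; apply: Hl; right].
Qed.

End Zd.

Fixpoint all_ctx (L : lang) (D G : list (sort L)) : formula (D ++ G) -> formula G :=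
  match D with
  | [] => fun phi => phi
  | s :: D' => fun phi => all_ctx (D := D') (All phi)
  end.

Lemma sat_all_ctx (L : lang) (N : structure L) (D G : list (sort L)) (phi : formula (D ++ G))
    (g : env N G) :
  sat (all_ctx phi) g <-> forall d : env N D, sat phi (env_app d g).
Proof.
elim: D phi => [|s D IH] phi /=; first by split=> [H []|/(_ tt)].
by rewrite IH; split=> [H [x d]|H d x]; [exact: (H d x)|exact: (H (x, d))].
Qed.

Definition fiff (L : lang) (G : list (sort L)) (phi psi : formula G) : formula G :=
  Imp (Imp (Imp phi psi) (Imp (Imp psi phi) (Bot G))) (Bot G).

Lemma sat_fiff (L : lang) (N : structure L) (G : list (sort L)) (phi psi : formula G) (e : env N G) :
  sat (fiff phi psi) e <-> (sat phi e <-> sat psi e).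
Proof.
split=> [/= H|/= [H1 H2] H]; last by apply: H.
by apply: NNPP => H'; apply: H => H1 H2; apply: H'; split.
Qed.

Section ZdQuant.
Variables (L : lang) (N : structure L).
Context {X Y : Type} {RX : Rep N X} {RY : Rep N Y}.

Lemma zd_all (P : X -> Y -> Prop) :
  zd N (fun t : X * Y => P (fst t) (snd t)) -> zd N (fun x => forall y, P x y).
Proof.
move=> HP.
have [phi Hphi] : zd N (fun t : Y * X => P (snd t) (fst t)).
  apply: (zd_comp (f := fun t => (snd t, fst t)) HP).
  by apply: pm_pair; [apply: pm_snd|apply: pm_fst]; exact: pm_id.
exists (all_ctx (D := rctx N Y) phi) => x; rewrite sat_all_ctx; split=> H y.
- by have := proj1 (Hphi (rdec N y, x)) (H _); rewrite /= rdecK.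
- by apply: (proj2 (Hphi (y, x))); exact: H.
Qed.

Lemma zd_ex (P : X -> Y -> Prop) :
  zd N (fun t : X * Y => P (fst t) (snd t)) -> zd N (fun x => exists y, P x y).
Proof.
move=> HP; apply: zd_iff_ext (zd_not (zd_all (P := fun x y => ~ P x y) (zd_not HP))) => x.
split=> [H|[y Hy] H]; last exact: H Hy.
by apply: NNPP => H'; apply: H => y Hy; apply: H'; exists y.
Qed.

Lemma zd_pull_eq (G D : list (sort L)) (r r' : ren G D) :
  zd N (fun e : env N D => pull r e = pull r' e).
Proof.
elim: G r r' => [|s G IH] r r'.
  by apply: (zd_iff_ext (P := fun _ => True)); [|exact: zd_True].
have H0 : zd N (fun e : env N D =>
    lookup (r s (var0 s G)) e = lookup (r' s (var0 s G)) e).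
  by exists (Eq (Var (r s (var0 s G))) (Var (r' s (var0 s G)))).
apply: zd_iff_ext (zd_and H0 (IH (fun t v => r t (varS s v)) (fun t v => r' t (varS s v)))) => e /=.
by split=> [[-> ->]|[]].
Qed.

Lemma zd_eq (f g : X -> Y) : pm N f -> pm N g -> zd N (fun x => f x = g x).
Proof.
move=> [r Hr] [r' Hr']; have [phi Hphi] := zd_pull_eq r r'.
exists phi => x; rewrite -Hphi /= -Hr -Hr'; split=> [-> //|]; exact: renc_inj.
Qed.

End ZdQuant.

Section ZdCurry.
Variables (L : lang) (N : structure L).
Context {X Y1 Y2 Y3 : Type} {RX : Rep N X} {R1 : Rep N Y1} {R2 : Rep N Y2} {R3 : Rep N Y3}.

Lemma zd2 (P : Y1 -> Y2 -> Prop) (f1 : X -> Y1) (f2 : X -> Y2) :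
  zd N (fun t : Y1 * Y2 => P (fst t) (snd t)) ->
  pm N f1 -> pm N f2 -> zd N (fun x => P (f1 x) (f2 x)).
Proof. by move=> H H1 H2; apply: (zd_comp (f := fun x => (f1 x, f2 x)) H); apply: pm_pair. Qed.

Lemma zd3 (P : Y1 -> Y2 -> Y3 -> Prop) (f1 : X -> Y1) (f2 : X -> Y2) (f3 : X -> Y3) :
  zd N (fun t : Y1 * Y2 * Y3 => P (fst (fst t)) (snd (fst t)) (snd t)) ->
  pm N f1 -> pm N f2 -> pm N f3 -> zd N (fun x => P (f1 x) (f2 x) (f3 x)).
Proof.
move=> H H1 H2 H3; apply: (zd_comp (f := fun x => (f1 x, f2 x, f3 x)) H).
by do !apply: pm_pair.
Qed.

End ZdCurry.

Fixpoint ren_terms (L : lang) (G D : list (sort L)) : ren D G -> terms G D :=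
  match D with
  | [] => fun _ => tnil G
  | s :: D' => fun r => tcons (Var (r s (var0 s D'))) (ren_terms (fun t v => r t (varS s v)))
  end.

Lemma eval_ren_terms (L : lang) (N : structure L) (G D : list (sort L)) (r : ren D G) (e : env N G) :
  tseval e (ren_terms r) = pull r e.
Proof. by elim: D r => [|s D IH] r //=; rewrite IH. Qed.

Lemma zd_fint (L : lang) (N : structure L) (f : fsym L) :
  zd N (fun t : env N (farity f) * N (fres f) => fint (fst t) = snd t).
Proof.
exists (Eq (App (ren_terms (fun s v => vleft [fres f] v)))
           (Var (vright (farity f) (var0 (fres f) [])))) => -[v w] /=.
by rewrite eval_ren_terms -/(eleft _) eleft_app lookup_vright.
Qed.

Lemma zd_rint (L : lang) (N : structure L) (r : rsym L) :
  zd N (fun v : env N (rarity r) => rint v).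
Proof.
by exists (Rel (ren_terms (fun s v => v))) => v /=; rewrite eval_ren_terms pull_id.
Qed.

Ltac pm_tac :=
  lazymatch goal with
  | |- pm _ (fun x => x) => exact: pm_id
  | |- pm _ fst => apply: (pm_fst (f := fun t => t)); pm_tac
  | |- pm _ snd => apply: (pm_snd (f := fun t => t)); pm_tac
  | |- pm _ (fun _ => (_, _)) => apply: pm_pair; pm_tac
  | |- pm _ (fun _ => fst _) => apply: pm_fst; pm_tac
  | |- pm _ (fun _ => snd _) => apply: pm_snd; pm_tac
  | |- pm _ (fun _ => tt) => exact: pm_tt
  | |- _ => assumption
  end.

Ltac zd_step :=
  lazymatch goal with
  | |- zd _ (fun _ => False) => apply: zd_False
  | |- zd _ (fun _ => True) => apply: zd_True
  | |- zd _ (fun _ => ~ _) => apply: zd_not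
  | |- zd _ (fun _ => _ /\ _) => apply: zd_and
  | |- zd _ (fun _ => _ \/ _) => apply: zd_or
  | |- zd _ (fun _ => _ <-> _) => apply: zd_iff
  | |- zd _ (fun _ => exists _, _) => apply: zd_ex
  | |- zd _ (fun _ => _ = _) => apply: zd_eq; [solve [pm_tac] | solve [pm_tac]]
  | |- zd _ (fun _ => _ -> _) => first [apply: zd_imp | apply: zd_all]
  | |- zd _ (fun _ => forall _, _) => apply: zd_all
  end.

Definition pdef (L : lang) (M : structure L) (Y : Type) {RY : Rep M Y} (P : Y -> Prop) : Prop :=
  exists (H : list (sort L)) (Q : Y * env M H -> Prop) (e : env M H),
    zd M Q /\ forall y, P y <-> Q (y, e).

Arguments pdef {L} M {Y RY} P.

Lemma pdef_intro (L : lang) (M : structure L) (Y W : Type) (RY : Rep M Y) (RW : Rep M W)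
    (P : Y -> Prop) (Q : Y -> W -> Prop) (w : W) :
  zd M (fun t : Y * W => Q (fst t) (snd t)) -> (forall y, P y <-> Q y w) -> pdef M P.
Proof.
move=> HQ HP; exists (rctx M W), (fun t => Q (fst t) (rdec M (snd t))), (renc M w); split.
- apply: (zd2 HQ); first by pm_tac.
  by exists (fun s v => vright _ v) => -[y e] /=; rewrite rdecK -/(eright _) eright_app.
- by move=> y /=; rewrite rencK.
Qed.

(** * Expansions *)

Section Lift.
Variables (S S' : Type) (j : S -> S') (M : S' -> Type).

Fixpoint emb_var (G : list S) s (v : var G s) : var (map j G) (j s) :=
  match v in var G0 s0 return var (map j G0) (j s0) with
  | var0 s G => var0 (j s) (map j G)
  | varS t v' => varS (j t) (emb_var v')
  end.

Lemma lookup_lift (G : list S) (e : env (fun s => M (j s)) G) s (v : var G s) :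
  lookup (emb_var v) (lift e) = lookup v e.
Proof. by elim: v e => [t G'|t u G' v IH] e //=; rewrite IH. Qed.

Lemma unlift_lift (G : list S) (e : env (fun s => M (j s)) G) : unlift (lift (j := j) (M := M) e) = e.
Proof. by elim: G e => [[]|s G IH [x e]] //=; rewrite IH. Qed.

Lemma lift_unlift (G : list S) (e : env M (map j G)) : lift (unlift e) = e.
Proof. by elim: G e => [[]|s G IH [x e]] //=; rewrite IH. Qed.

Fixpoint emb_ren (G D : list S) : ren G D -> ren (map j G) (map j D) :=
  match G with
  | [] => fun _ s v => match v in var G0 s0
             return match G0 with [] => var (map j D) s0 | _ => unit end with
             | var0 _ _ => tt | varS _ _ => tt end
  | t :: G' => fun r s =>
      var_cases (P := var (map j D)) (emb_var (r t (var0 t G')))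
        (@emb_ren G' D (fun s v => r s (varS t v))) (s := s)
  end.

Lemma pull_emb (G D : list S) (r : ren G D) (e : env (fun s => M (j s)) D) :
  pull (emb_ren r) (lift e) = lift (pull r e).
Proof.
elim: G r => [|t G IH] r //=; rewrite lookup_lift; congr pair.
by rewrite -IH.
Qed.

Fixpoint map_app_ren (G D : list S) : ren (map j (G ++ D)) (map j G ++ map j D) :=
  match G return ren (map j (G ++ D)) (map j G ++ map j D) with
  | [] => fun s v => v
  | t :: G' => fun s => var_cases (P := var (map j (t :: G') ++ map j D)) (var0 (j t) _)
                 (fun s v => varS (j t) (@map_app_ren G' D s v)) (s := s)
  end.

Lemma pull_map_app (G D : list S) (x : env (fun s => M (j s)) G) (y : env (fun s => M (j s)) D) :
  pull (@map_app_ren G D) (env_app (lift x) (lift y)) = lift (env_app x y).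
Proof.
elim: G x => [|t G IH] x /=; first exact: pull_id.
rewrite -IH; congr pair; by apply: env_ext => s v; rewrite !lookup_pull.
Qed.

End Lift.

Section EmbedFormula.
Variables (L : lang) (K : Type) (U : structure L) (N : lang_ext L K) (X : expansion U N).

Fixpoint emb_term (G : list (sort L)) s (t : term G s) :
    @term (extend N) (map inl G) (inl s) :=
  match t in term _ s0 return @term (extend N) (map inl G) (inl s0) with
  | @Var _ _ s1 v => @Var (extend N) (map inl G) (inl s1) (emb_var (inl : sort L -> sort (extend N)) v)
  | @App _ _ f ts => @App (extend N) _ (inl f) (emb_terms ts)
  end
with emb_terms (G : list (sort L)) D (ts : terms G D) :
    @terms (extend N) (map inl G) (map inl D) :=
  match ts in terms _ D0 return @terms (extend N) (map inl G) (map inl D0) with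
  | tnil _ => tnil _
  | tcons t ts' => tcons (emb_term t) (emb_terms ts')
  end.

Fixpoint emb_formula (G : list (sort L)) (phi : formula G) : @formula (extend N) (map inl G) :=
  match phi in formula G0 return @formula (extend N) (map inl G0) with
  | Bot G => @Bot (extend N) (map inl G)
  | @Eq _ G s t u => @Eq (extend N) (map inl G) (inl s) (emb_term t) (emb_term u)
  | @Rel _ G r ts => @Rel (extend N) (map inl G) (inl r) (emb_terms ts)
  | @Imp _ G phi psi => @Imp (extend N) (map inl G) (emb_formula phi) (emb_formula psi)
  | @All _ G s phi => @All (extend N) (map inl G) (inl s) (emb_formula phi)
  end.

Lemma eval_emb (G : list (sort L)) (e : env U G) :
  (forall s (t : term G s), teval (M := expand X) (to_exp X e) (emb_term t) = teval e t) /\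
  (forall D (ts : terms G D), tseval (M := expand X) (to_exp X e) (emb_terms ts) = to_exp X (tseval e ts)).
Proof.
apply: (@term_terms_ind L G
  (fun s (t : term G s) => teval (M := expand X) (to_exp X e) (emb_term t) = teval e t)
  (fun D (ts : terms G D) => tseval (M := expand X) (to_exp X e) (emb_terms ts) = to_exp X (tseval e ts))).
- by move=> s v; exact: (lookup_lift (j := inl) (M := expand X) e v).
- move=> f ts /= IH; congr fint.
  transitivity (of_exp (to_exp X (tseval e ts))); last exact: unlift_lift.
  by rewrite -IH.
- by [].
- by move=> s D t /= -> ts ->.
Qed.

Lemma sat_emb (G : list (sort L)) (phi : formula G) (e : env U G) :
  sat (M := expand X) (emb_formula phi) (to_exp X e) <-> sat phi e.
Proof.
elim: phi e => [G'|G' s t u|G' r ts|G' phi IH1 psi IH2|G' s phi IH] e //=.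
- by rewrite !(proj1 (eval_emb e)).
- have -> : unlift (j := inl) (M := ext_car U (ncar X)) (tseval (M := expand X) (to_exp X e) (emb_terms ts)) = tseval e ts.
    rewrite -[RHS](unlift_lift (j := inl) (M := expand X)).
    by rewrite (proj2 (eval_emb e)).
  by [].
- by rewrite IH1 IH2.
- by split=> H x; move: (H x); rewrite -(IH (x, e)).
Qed.

Instance Rep_old Y (RY : Rep U Y) : Rep (expand X) Y | 100.
Proof.
refine (MkRep (N := expand X) (X := Y) (rctx := map inl (rctx U Y))
  (renc := fun y => to_exp X (renc U y)) (rdec := fun e => rdec U (of_exp e)) _ _).
- by move=> y; rewrite /of_exp unlift_lift rencK.
- by move=> e; rewrite rdecK; exact: lift_unlift.
Defined.

Lemma zd_old Y (RY : Rep U Y) (P : Y -> Prop) : zd U P -> zd (expand X) P.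
Proof. by move=> [phi H]; exists (emb_formula phi) => y; rewrite H -sat_emb. Qed.

Lemma pm_old Y Z (RY : Rep U Y) (RZ : Rep U Z) (f : Y -> Z) :
  pm U f -> pm (expand X) f.
Proof.
move=> [r Hr]; exists (emb_ren (j := inl) r) => y /=.
by rewrite Hr /to_exp -(pull_emb (j := inl) (M := expand X)).
Qed.

(** A product of two products of sorts of [U] gets coordinates in the expansion in two ways, by
    embedding the product or by pairing the embedded factors. The contexts [map inl (G ++ D)] and
    [map inl G ++ map inl D] are not convertible, so definability is carried between them along the
    identity, which is a change of variables in both directions. *)
Class Compat (Y : Type) (RU : Rep U Y) (RM : Rep (expand X) Y) : Prop := compat :
  @pm _ (expand X) Y Y (Rep_old RU) RM (fun y => y) /\
  @pm _ (expand X) Y Y RM (Rep_old RU) (fun y => y).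

Instance Compat_old Y (RU : Rep U Y) : Compat RU (Rep_old RU) | 100.
Proof. by split; exact: pm_id. Qed.

Instance Compat_prod Y Z (RU : Rep U Y) (RU' : Rep U Z) (RM : Rep (expand X) Y)
  (RM' : Rep (expand X) Z) : Compat RU RM -> Compat RU' RM' ->
  Compat (Rep_prod RU RU') (Rep_prod RM RM').
Proof.
move=> [H1 H2] [H3 H4]; split.
- have Hf : @pm _ (expand X) _ _ (Rep_old (Rep_prod RU RU')) RM fst.
    apply: (pm_comp (RY := Rep_old RU) (g := fun y => y)) H1.
    by apply: pm_old; apply: pm_fst; exact: pm_id.
  have Hs : @pm _ (expand X) _ _ (Rep_old (Rep_prod RU RU')) RM' snd.
    apply: (pm_comp (RY := Rep_old RU') (g := fun y => y)) H3.
    by apply: pm_old; apply: pm_snd; exact: pm_id.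
  have [r Hr] := pm_pair Hf Hs.
  by exists r => -[y z]; rewrite -Hr.
- apply: (pm_comp (RY := Rep_prod (Rep_old RU) (Rep_old RU')) (f := fun t => t) (g := fun t => t)).
    have [r Hr] : @pm _ (expand X) _ _ (Rep_prod RM RM') (Rep_prod (Rep_old RU) (Rep_old RU'))
        (fun t => (fst t, snd t)).
      have Hf : @pm _ (expand X) _ _ (Rep_prod RM RM') (Rep_old RU) fst.
        by apply: (pm_comp (f := fst) (g := fun y => y)) H2; apply: pm_fst; exact: pm_id.
      have Hs : @pm _ (expand X) _ _ (Rep_prod RM RM') (Rep_old RU') snd.
        by apply: (pm_comp (f := snd) (g := fun y => y)) H4; apply: pm_snd; exact: pm_id.
      exact: pm_pair Hf Hs.
    by exists r => -[y z]; rewrite -Hr.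
  exists (@map_app_ren _ _ inl (rctx U Y) (rctx U Z)) => -[y z] /=.
  by symmetry; exact: (pull_map_app (j := inl) (M := expand X)).
Qed.

Lemma zd_compat Y (RU : Rep U Y) (RM : Rep (expand X) Y) (HC : Compat RU RM) (P : Y -> Prop) :
  @zd _ (expand X) Y (Rep_old RU) P <-> @zd _ (expand X) Y RM P.
Proof.
case: HC => H1 H2; split=> H.
- by apply: (zd_comp (f := fun y => y) H).
- by apply: (zd_comp (f := fun y => y) H).
Qed.

Lemma zd_up Y (RU : Rep U Y) (RM : Rep (expand X) Y) (HC : Compat RU RM) (P : Y -> Prop) :
  zd U P -> zd (expand X) P.
Proof. by move=> H; apply/(zd_compat HC); exact: zd_old. Qed.

Lemma no_new (HX : no_new_zero_definable X) Y (RU : Rep U Y) (RM : Rep (expand X) Y)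
    (HC : Compat RU RM) (P : Y -> Prop) :
  zd (expand X) P -> zd U P.
Proof.
move=> /(zd_compat HC) [phi Hphi].
have [psi Hpsi] : zero_definable (fun e : env U (rctx U Y) => P (rdec U e)).
  apply: HX; exists phi => z; rewrite Hphi /= rdecK /to_exp /of_exp.
  by rewrite (lift_unlift (j := inl) (M := expand X)).
by exists psi => y; rewrite -Hpsi rencK.
Qed.

Lemma st_emb (HX : stably_embedded X) Y (RU : Rep U Y) (RM : Rep (expand X) Y)
    (HC : Compat RU RM) (P : Y -> Prop) :
  pdef (expand X) P ->
  exists (E : list (sort L)) (e : env U E) (Q : Y * env U E -> Prop),
    zd U Q /\ forall y, P y <-> Q (y, e).
Proof.
move=> [H [Q [e [HQ HP]]]].
have [phi Hphi] : @zd _ (expand X) (Y * env (expand X) H)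
    (Rep_prod (Rep_old RU) (Rep_env _ H)) Q.
  case: HC => H1 H2.
  apply: (zd_iff_ext (P := fun t => Q (fst t, snd t))); first by case.
  apply: (zd_comp (f := fun t => (fst t, snd t)) HQ).
  apply: pm_pair.
    by apply: (pm_comp (RY := Rep_old RU) (f := fst) (g := fun y => y)) H1; apply: pm_fst; exact: pm_id.
  by apply: (pm_snd (RY := Rep_old RU)); exact: pm_id.
have : definable (fun e : env U (rctx U Y) => P (rdec U e)).
  apply: HX; exists H, phi, e => z; rewrite HP Hphi /= rdecK.
  by rewrite /to_exp /of_exp (lift_unlift (j := inl) (M := expand X)).
move=> [E [psi [f Hf]]].
exists E, f, (fun t => sat psi (env_app (renc U (fst t)) (snd t))); split.
- by exists psi.
- by move=> y; rewrite -Hf rencK.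
Qed.

End EmbedFormula.
#[export] Existing Instance Rep_old | 100.
#[export] Hint Mode Compat + + + + + + + ! : typeclass_instances.
#[export] Existing Instance Compat_old | 100.
#[export] Existing Instance Compat_prod.

#[export] Instance Rep_new (L : lang) (U : structure L) (N : lang_ext L unit) (X : expansion U N) :
  Rep (expand X) (newsort X) := Rep_car (expand X) (inr tt).

(** * Automorphisms *)

Lemma lookup_map (S : Type) (M M' : S -> Type) (h : forall s, M s -> M' s) G (e : env M G) s (v : var G s) :
  lookup v (env_map h e) = h s (lookup v e).
Proof. by elim: v e => [t G'|t u G' v IH] e //=; rewrite IH. Qed.

Section EnvMap.
Variables (S : Type) (M M' M'' : S -> Type).

Lemma env_map_pull (h : forall s, M s -> M' s) G D (r : ren G D) (e : env M D) :
  env_map h (pull r e) = pull r (env_map h e).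
Proof. by apply: env_ext => s v; rewrite lookup_map !lookup_pull lookup_map. Qed.

Lemma env_map_app (h : forall s, M s -> M' s) G D (x : env M G) (y : env M D) :
  env_map h (env_app x y) = env_app (env_map h x) (env_map h y).
Proof. by elim: G x => [|s G IH] x //=; rewrite IH. Qed.

Lemma env_map_comp (h : forall s, M s -> M' s) (k : forall s, M' s -> M'' s) G (e : env M G) :
  env_map k (env_map h e) = env_map (fun s x => k s (h s x)) e.
Proof. by apply: env_ext => s v; rewrite !lookup_map. Qed.

Lemma env_map_id (h : forall s, M s -> M s) G (e : env M G) :
  (forall s x, h s x = x) -> env_map h e = e.
Proof. by move=> H; apply: env_ext => s v; rewrite lookup_map H. Qed.

End EnvMap.

Section Aut.
Variables (L : lang) (M : structure L).

Lemma eval_map (h : forall s, M s -> M s) (F : fsym L -> Prop) G (e : env M G) :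
  (forall f v, F f -> h _ (@fint L M f v) = fint (env_map h v)) ->
  (forall s (t : term G s), term_in F t -> teval (env_map h e) t = h s (teval e t)) /\
  (forall D (ts : terms G D), terms_in F ts -> tseval (env_map h e) ts = env_map h (tseval e ts)).
Proof.
move=> HF; apply: (@term_terms_ind L G
  (fun s t => term_in F t -> teval (env_map h e) t = h s (teval e t))
  (fun D ts => terms_in F ts -> tseval (env_map h e) ts = env_map h (tseval e ts))) => //=.
- by move=> s v _; rewrite lookup_map.
- by move=> f ts IH [Ff Fts]; rewrite IH // HF.
- by move=> s D t IH ts IHs [Ft Fts]; rewrite IH // IHs.
Qed.

(** Asking only for the symbols of a sublanguage is what later turns being an automorphism into
    finitely many conditions, through finite generation. *)
Lemma sat_map (h : forall s, M s -> M s) (F : fsym L -> Prop) (R : rsym L -> Prop)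
    (hbij : forall s, bijective (h s))
    (hF : forall f v, F f -> h _ (@fint L M f v) = fint (env_map h v))
    (hR : forall r v, R r -> @rint L M r v <-> rint (env_map h v))
    G (phi : formula G) (e : env M G) :
  formula_in F R phi -> (sat phi e <-> sat phi (env_map h e)).
Proof.
elim: phi e => [G'|G' s t u|G' r ts|G' phi IH1 psi IH2|G' s phi IH] e //=.
- move=> [Ft Fu]; rewrite !(proj1 (eval_map e hF)) //.
  by split=> [-> //|]; case: (hbij s) => k kK _ /(f_equal k); rewrite !kK.
- by move=> [Rr Fts]; rewrite (proj2 (eval_map e hF)) // -hR.
- by move=> [H1 H2]; rewrite (IH1 e H1) (IH2 e H2).
- move=> H; split=> Hs x; last by apply/(IH (x, e) H); exact: Hs.
  by case: (hbij s) => k _ kK; rewrite -(kK x); apply/(IH (k x, e) H).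
Qed.

Lemma terms_in_all G : (forall s (t : term G s), term_in (fun _ : fsym L => True) t) /\
  (forall D (ts : terms G D), terms_in (fun _ : fsym L => True) ts).
Proof.
exact: (@term_terms_ind L G (fun s t => term_in (fun _ => True) t)
  (fun D ts => terms_in (fun _ => True) ts)).
Qed.

Lemma formula_in_all G (phi : formula (L := L) G) :
  formula_in (fun _ => True) (fun _ => True) phi.
Proof.
elim: phi => //= {}G.
- by move=> s t u; split; apply: (proj1 (terms_in_all G)).
- by move=> r ts; split=> //; apply: (proj2 (terms_in_all G)).
Qed.

Definition elementary (h : forall s, M s -> M s) : Prop :=
  (forall s, bijective (h s)) /\
  forall G (phi : formula G) (e : env M G), sat phi e <-> sat phi (env_map h e).

Lemma automorphismP (h : forall s, M s -> M s) : is_automorphism h <-> elementary h.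
Proof.
split=> [[hbij [hF hR]]|[hbij hsat]].
  split=> // G phi e; apply: (sat_map (F := fun _ => True) (R := fun _ => True)) => //.
  exact: formula_in_all.
split=> //; split=> [f v|r v].
- have [phi Hphi] := zd_fint M f.
  have := proj1 (Hphi (v, fint v)) eq_refl.
  rewrite hsat /= env_map_app => H.
  by symmetry; apply: (proj2 (Hphi (env_map h v, h _ (fint v)))).
- have [phi Hphi] := zd_rint M r.
  by rewrite (Hphi v) hsat -(Hphi (env_map h v)).
Qed.

Definition maps_to (h : forall s, M s -> M s) Y {RY : Rep M Y} (y y' : Y) : Prop :=
  env_map h (renc M y) = renc M y'.

Lemma zd_maps_to (h : forall s, M s -> M s) (Y : Type) (RY : Rep M Y) (P : Y -> Prop) (y y' : Y) :
  elementary h -> zd M P -> maps_to h y y' -> (P y <-> P y').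
Proof. by move=> [_ H] [phi Hphi] Hy; rewrite !Hphi -Hy; exact: H. Qed.

Lemma maps_to_pair (h : forall s, M s -> M s) (Y Z : Type) (RY : Rep M Y) (RZ : Rep M Z) y y' z z' :
  maps_to h (Y := Y) y y' -> maps_to h (Y := Z) z z' -> maps_to h (y, z) (y', z').
Proof. by move=> H1 H2; rewrite /maps_to /= env_map_app H1 H2. Qed.

Lemma maps_to_ex (h : forall s, M s -> M s) (Y : Type) (RY : Rep M Y) (y : Y) :
  exists y', maps_to h y y'.
Proof. by exists (rdec M (env_map h (renc M y))); rewrite /maps_to rdecK. Qed.

Lemma elementary_id : elementary (fun s (x : M s) => x).
Proof.
by split=> [s|G phi e]; [exists (fun x => x)|rewrite env_map_id].
Qed.

Lemma elementary_comp (h k : forall s, M s -> M s) :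
  elementary h -> elementary k -> elementary (fun s x => k s (h s x)).
Proof.
move=> [hb hs] [kb ks]; split=> [s|G phi e].
- case: (hb s) (kb s) => h' h1 h2 [k' k1 k2].
  by exists (fun x => h' (k' x)) => x; rewrite ?h1 ?k1 // ?h2 ?k2 // ?h1 ?k1 // h2 k2.
- by rewrite hs ks env_map_comp.
Qed.

Lemma elementary_inv (h : forall s, M s -> M s) : elementary h ->
  exists k, elementary k /\ (forall s x, k s (h s x) = x) /\ (forall s x, h s (k s x) = x).
Proof.
move=> [hb hs].
have H s : {k : M s -> M s | cancel (h s) k /\ cancel k (h s)}.
  by apply: constructive_indefinite_description; case: (hb s) => k ? ?; exists k.
exists (fun s => proj1_sig (H s)).
have H1 s x : proj1_sig (H s) (h s x) = x by exact: (proj1 (proj2_sig (H s))).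
have H2 s x : h s (proj1_sig (H s) x) = x by exact: (proj2 (proj2_sig (H s))).
split=> //; split=> [s|G phi e]; first by exists (h s).
rewrite [X in _ <-> X]hs env_map_comp env_map_id //.
Qed.

End Aut.

Section AutOver.
Variables (L : lang) (U : structure L) (N : lang_ext L unit) (X : expansion U N).
Notation M := (expand X).

Lemma maps_to_old (h : forall s, M s -> M s) Y (RU : Rep U Y) (RM : Rep M Y) (HC : Compat RU RM) (y : Y) :
  aut_over h -> maps_to h y y.
Proof.
move=> [_ Hid]; rewrite /maps_to; case: HC => [[r Hr] _].
rewrite Hr env_map_pull; congr pull => /=.
move: (renc U y) => e; elim: (rctx U Y) e => [|s G IH] e //=.
by rewrite [env_map _ _]IH (Hid s (fst e)).
Qed.

Lemma aut_over_id : aut_over (X := X) (fun s x => x).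
Proof. by split=> //; apply/automorphismP; exact: elementary_id. Qed.

Lemma aut_over_comp h k : aut_over (X := X) h -> aut_over (X := X) k ->
  aut_over (X := X) (fun s x => k s (h s x)).
Proof.
move=> [/automorphismP Hh hid] [/automorphismP Hk kid]; split.
- by apply/automorphismP; exact: elementary_comp.
- by move=> s x; rewrite hid kid.
Qed.

Lemma aut_over_inv h : aut_over (X := X) h -> exists k, aut_over (X := X) k /\
  (forall s x, k s (h s x) = x) /\ (forall s x, h s (k s x) = x).
Proof.
move=> [/automorphismP Hh hid]; have [k [Hk [H1 H2]]] := elementary_inv Hh.
exists k; split=> //; split; first exact/automorphismP.
by move=> s x; rewrite -[in LHS](hid s x) H1.
Qed.

Lemma zd_aut h Y (RY : Rep M Y) (P : Y -> Prop) (y y' : Y) :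
  aut_over (X := X) h -> zd M P -> maps_to h y y' -> (P y <-> P y').
Proof. by move=> [/automorphismP Hh _]; exact: zd_maps_to. Qed.

End AutOver.

(** * Cardinal arithmetic *)

Definition card_le (X Y : Type) : Prop := exists f : X -> Y, injective f.

Lemma card_le_trans X Y Z : card_le X Y -> card_le Y Z -> card_le X Z.
Proof. by move=> [f Hf] [g Hg]; exists (fun x => g (f x)) => x y /Hg /Hf. Qed.

Lemma dep_choice (T : Type) (B : T -> Type) (R : forall x, B x -> Prop) :
  (forall x, exists y, R x y) -> exists f : forall x, B x, forall x, R x (f x).
Proof.
move=> H; exists (fun x => proj1_sig (constructive_indefinite_description _ (H x))) => x.
by case: constructive_indefinite_description.
Qed.

Lemma zorn (T : Type) (P : (T -> Prop) -> Prop) :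
  (forall F : (T -> Prop) -> Prop, (forall A, F A -> P A) ->
     (forall A B, F A -> F B -> (forall x, A x -> B x) \/ (forall x, B x -> A x)) ->
     P (fun x => exists A, F A /\ A x)) ->
  exists A, P A /\ forall B, P B -> (forall x, A x -> B x) -> forall x, B x -> A x.
Proof.
move=> H; have [|A [PA HA]] := @classical_sets.Zorn_bigcup T P.
- move=> F FP Ftot.
  have -> : classical_sets.bigcup F (fun X => X) = (fun x => exists A, F A /\ A x).
    apply: functional_extensionality => x; apply: propositional_extensionality.
    by split=> [[A FA Ax]|[A [FA Ax]]]; exists A.
  by apply: H => //; exact: FP.
- exists A; split=> // B PB AB; apply: NNPP => HBA.
  by apply: (HA B) => //; split.
Qed.

(** Take a maximal partial injection: if it is neither total nor onto, an unmatched [x] and an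
    unmatched [y] can be paired, which contradicts maximality. *)
Lemma card_le_total X Y : card_le X Y \/ card_le Y X.
Proof.
pose P (G : X * Y -> Prop) := forall x y x' y', G (x, y) -> G (x', y') -> (x = x' <-> y = y').
have [|G [PG HG]] := @zorn (X * Y) P.
  move=> F FP Ftot x y x' y' [A [FA Ax]] [B [FB Bx]].
  case: (Ftot A B FA FB) => HAB.
    exact: (FP B FB x y x' y' (HAB _ Ax) Bx).
  exact: (FP A FA x y x' y' Ax (HAB _ Bx)).
case: (classic (forall x, exists y, G (x, y))) => [Hx|Hx].
  have [f Hf] := dep_choice Hx.
  by left; exists f => x x' E; apply/(PG _ _ _ _ (Hf x) (Hf x')).
case: (classic (forall y, exists x, G (x, y))) => [Hy|Hy].
  have [f Hf] := dep_choice Hy.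
  by right; exists f => y y' E; apply/(PG _ _ _ _ (Hf y) (Hf y')).
have [x Hx'] := not_all_ex_not _ _ Hx; have [y Hy'] := not_all_ex_not _ _ Hy.
exfalso; apply: (Hx'); exists y.
apply: (HG (fun t => G t \/ t = (x, y))) => [|t Gt|]; [|by left|by right].
move=> a b a' b' [H1|[-> ->]] [H2|[-> ->]] //; first exact: PG.
- split=> E; exfalso; first by apply: Hx'; exists b; rewrite -E.
  by apply: Hy'; exists a; rewrite -E.
- split=> E; exfalso; first by apply: Hx'; exists b'; rewrite E.
  by apply: Hy'; exists a'; rewrite E.
Qed.

(** * An infinite set absorbs its square *)

Section Square.
Variables (X : Type) (f0 : nat -> X).
Hypothesis f0_inj : injective f0.

(* [G] is the graph of an injection from the square of [D G] to [D G]. *)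
Let D (G : X * X * X -> Prop) (x : X) : Prop := exists z, G (x, x, z).
Let good (G : X * X * X -> Prop) : Prop :=
  (forall x y z z', G (x, y, z) -> G (x, y, z') -> z = z') /\
  (forall x y x' y' z, G (x, y, z) -> G (x', y', z) -> x = x' /\ y = y') /\
  (forall x y z, G (x, y, z) -> D G x /\ D G y /\ D G z) /\
  (forall x y, D G x -> D G y -> exists z, G (x, y, z)).
Let G0 (t : X * X * X) : Prop := exists m n, t = (f0 m, f0 n, f0 (Cantor.to_nat (m, n))).

Let good_G0 : good G0.
Proof.
have HD n : D G0 (f0 n) by exists (f0 (Cantor.to_nat (n, n))), n, n.
split; [|split; [|split]].
- by move=> x y z z' [m [n [-> -> ->]]] [m' [n' [/f0_inj <- /f0_inj <- ->]]].
- move=> x y x' y' z [m [n [-> -> ->]]] [m' [n' [-> -> E]]].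
  have E' : Cantor.to_nat (m, n) = Cantor.to_nat (m', n') by exact: f0_inj.
  by case: (Cantor.to_nat_inj _ _ E') => -> ->.
- by move=> x y z [m [n [-> -> ->]]].
- move=> x y [z [m [n [-> _ _]]]] [z' [m' [n' [-> _ _]]]].
  by exists (f0 (Cantor.to_nat (m, m'))), m, m'.
Qed.

Let good_ext G G' : (forall t, G t <-> G' t) -> good G -> good G'.
Proof.
move=> H; have -> // : G = G'.
by apply: functional_extensionality => t; apply: propositional_extensionality.
Qed.

(** Among injections of the square of some [Y] into [Y] that extend Cantor pairing on the copy of
    the natural numbers, take a maximal one. If the complement of [Y] embeds in [Y], so does the
    whole type, and the injection transports. Otherwise [Y] has a copy [h Y] in its complement, and
    the injection extends to the union of the two, against maximality. *)
Lemma card_square : card_le (X * X) X.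
Proof.
(* Adding [G0] by hand lets the empty chain satisfy the condition, since its union then stands for
   [G0] itself. *)
pose P (G : X * X * X -> Prop) := good (fun t => G0 t \/ G t).
have [|A [PA HA]] := @zorn _ P.
  move=> F FP Ftot.
  case: (classic (exists A, F A)) => [[A0 FA0]|HF]; last first.
    apply: good_ext good_G0 => t.
    by split=> [|[//|[A [FA _]]]]; [left|case: HF; exists A].
  have H1 t : (G0 t \/ exists A, F A /\ A t) -> exists A, F A /\ (G0 t \/ A t).
    by case=> [H|[A [FA At]]]; [exists A0; split=> //; left|exists A; split=> //; right].
  have H2 A t : F A -> G0 t \/ A t -> G0 t \/ exists A, F A /\ A t.
    by move=> FA [H|H]; [left|right; exists A].
  have H3 A B : F A -> F B -> exists C, F C /\ (forall t, G0 t \/ A t -> G0 t \/ C t) /\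
      (forall t, G0 t \/ B t -> G0 t \/ C t).
    move=> FA FB; case: (Ftot A B FA FB) => H; [exists B|exists A]; split=> //;
    by split=> t [Ht|Ht]; [left|right|left|right] => //; apply: H.
  split; [|split; [|split]].
  - move=> x y z z' /H1 [A [FA Ax]] /H1 [B [FB Bx]].
    have [C [FC [AC BC]]] := H3 A B FA FB.
    exact: (proj1 (FP C FC) _ _ _ _ (AC _ Ax) (BC _ Bx)).
  - move=> x y x' y' z /H1 [A [FA Ax]] /H1 [B [FB Bx]].
    have [C [FC [AC BC]]] := H3 A B FA FB.
    exact: (proj1 (proj2 (FP C FC)) _ _ _ _ _ (AC _ Ax) (BC _ Bx)).
  - move=> x y z /H1 [A [FA Ax]].
    have [[a Ha] [[b Hb] [c Hc]]] := proj1 (proj2 (proj2 (FP A FA))) _ _ _ Ax.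
    by split; [exists a|split; [exists b|exists c]]; apply: (H2 A).
  - move=> x y [a /H1 [A [FA Ax]]] [b /H1 [B [FB Bx]]].
    have [C [FC [AC BC]]] := H3 A B FA FB.
    have [z Hz] := proj2 (proj2 (proj2 (FP C FC))) x y
      (ex_intro _ a (AC _ Ax)) (ex_intro _ b (BC _ Bx)).
    by exists z; apply: (H2 C).
pose G t := G0 t \/ A t.
have [Gfun [Ginj [Gdom Gtot]]] : good G by exact: PA.
pose Y := D G.
have Yf n : Y (f0 n).
  by exists (f0 (Cantor.to_nat (n, n))); left; exists n, n.
have [g Hg] : exists g : X -> X -> X, forall x y, Y x -> Y y -> G (x, y, g x y).
  have Hex x y : exists z, Y x -> Y y -> G (x, y, z).
    case: (classic (Y x /\ Y y)) => [[Yx Yy]|H]; last by exists x => Yx Yy; case: H.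
    by have [z Hz] := Gtot x y Yx Yy; exists z.
  have [g Hg] := dep_choice (fun t : X * X => Hex (fst t) (snd t)).
  by exists (fun x y => g (x, y)) => x y; exact: (Hg (x, y)).
have gY x y : Y x -> Y y -> Y (g x y).
  by move=> Yx Yy; have [_ [_]] := Gdom _ _ _ (Hg x y Yx Yy).
have ginj x y x' y' : Y x -> Y y -> Y x' -> Y y' -> g x y = g x' y' -> x = x' /\ y = y'.
  move=> Yx Yy Yx' Yy' E; apply: (Ginj x y x' y' (g x y)); first exact: Hg.
  by rewrite E; exact: Hg.
have f0I m n : f0 m = f0 n -> m = n by exact: f0_inj.
case: (card_le_total {x | ~ Y x} {x | Y x}) => [[i Hi]|[e He]].
(* [k] embeds the whole type into [Y]; the tags [f0 0] and [f0 1] keep the images of [Y] and of its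
   complement apart. *)
- pose k x := match excluded_middle_informative (Y x) with
    | left Yx => g (f0 0) x
    | right nY => g (f0 1) (proj1_sig (i (exist _ x nY))) end.
  have kY x : Y (k x).
    by rewrite /k; case: excluded_middle_informative => H; apply: gY => //; exact: proj2_sig.
  have kinj x y : k x = k y -> x = y.
    rewrite /k; case: excluded_middle_informative => H; case: excluded_middle_informative => H' E.
    + by case: (ginj _ _ _ _ _ _ _ _ E).
    + by case: (ginj _ _ _ _ (Yf 0) H (Yf 1) (proj2_sig _) E) => /f0_inj.
    + by case: (ginj _ _ _ _ (Yf 1) (proj2_sig _) (Yf 0) H' E) => /f0_inj.
    + case: (ginj _ _ _ _ (Yf 1) (proj2_sig _) (Yf 1) (proj2_sig _) E) => _ E'.
      have /Hi [] : i (exist _ x H) = i (exist _ y H') by exact: eq_sig_hprop (fun _ => proof_irrelevance _) _ _ E'.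
      by [].
  exists (fun t => g (k (fst t)) (k (snd t))) => -[x y] [x' y'] /= E.
  by case: (ginj _ _ _ _ (kY _) (kY _) (kY _) (kY _) E) => /kinj -> /kinj ->.
exfalso.
have [h [hY hinj]] : exists h : X -> X, (forall x, Y x -> ~ Y (h x)) /\
    forall x y, Y x -> Y y -> h x = h y -> x = y.
  exists (fun x => match excluded_middle_informative (Y x) with
    | left Yx => proj1_sig (e (exist _ x Yx)) | right _ => x end).
  split=> [x Yx|x y Yx Yy].
    by case: excluded_middle_informative => // H; exact: (proj2_sig (e (exist _ x H))).
  case: excluded_middle_informative => // H; case: excluded_middle_informative => // H' E.
  have /He [] : e (exist _ x H) = e (exist _ y H') by exact: eq_sig_hprop (fun _ => proof_irrelevance _) _ _ E.
  by [].
(* The three tags code the three remaining blocks of the square of [Y] and its copy. *)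
pose c (i : bool) x := if i then h x else x.
pose tag (i j : bool) := f0 (if i then if j then 3 else 2 else 1).
pose B (t : X * X * X) := G t \/ exists i j x y, Y x /\ Y y /\ (i = true \/ j = true) /\
  t = (c i x, c j y, h (g (tag i j) (g x y))).
have cinj i j x y : Y x -> Y y -> c i x = c j y -> i = j /\ x = y.
  move=> Yx Yy; case: i; case: j => //= E; first by rewrite (hinj x y).
  + by case: (hY x Yx); rewrite E.
  + by case: (hY y Yy); rewrite -E.
have Gc i j x y z : Y x -> Y y -> G (c i x, c j y, z) -> ~ (i = true \/ j = true).
  move=> Yx Yy /Gdom [H1 [H2 _]] [E|E].
  + by apply: (hY x Yx); move: H1; rewrite E.
  + by apply: (hY y Yy); move: H2; rewrite E.
have YtY i j : Y (tag i j) by exact: Yf.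
have gYt i j x y : Y x -> Y y -> Y (g (tag i j) (g x y)).
  by move=> Yx Yy; exact: gY (YtY i j) (gY _ _ Yx Yy).
have BD x : D B x <-> exists i y, Y y /\ x = c i y.
  split=> [[z [/Gdom [H _]|[i [j [u [v [Yu [Yv [_ [-> _ _]]]]]]]]]]|[[] [y [Yy ->]]]].
  + by exists false, x.
  + by exists i, u.
  + by exists (h (g (tag true true) (g y y))); right; exists true, true, y, y; do !split=> //; left.
  + by case: Yy => z Hz; exists z; left.
have goodB : good B.
  split; [|split; [|split]].
  - move=> x y z z' [H|[i [j [u [v [Yu [Yv [Hij [-> -> ->]]]]]]]]] [H'|[i' [j' [u' [v' [Yu' [Yv' [Hij' E]]]]]]]].
    + exact: Gfun H H'.
    + by case: E => E1 E2 _; rewrite E1 E2 in H; case: (Gc _ _ _ _ _ Yu' Yv' H).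
    + by case: (Gc _ _ _ _ _ Yu Yv H').
    + case: E => E1 E2 ->; case: (cinj _ _ _ _ Yu Yu' E1) => <- <-.
      by case: (cinj _ _ _ _ Yv Yv' E2) => <- <-.
  - move=> x y x' y' z [H|[i [j [u [v [Yu [Yv [Hij [-> -> ->]]]]]]]]] [H'|[i' [j' [u' [v' [Yu' [Yv' [Hij' E]]]]]]]].
    + exact: Ginj H H'.
    + case: E => _ _ E; case: (Gdom _ _ _ H) => _ [_]; rewrite E => HY.
      by case: (hY _ (gYt _ _ _ _ Yu' Yv') HY).
    + by case: (Gdom _ _ _ H') => _ [_] HY; case: (hY _ (gYt _ _ _ _ Yu Yv) HY).
    + case: E => -> -> /hinj E.
      have := ginj _ _ _ _ (YtY i j) (gY _ _ Yu Yv) (YtY i' j') (gY _ _ Yu' Yv')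
        (E (gYt _ _ _ _ Yu Yv) (gYt _ _ _ _ Yu' Yv')).
      move=> [/f0_inj Et] /(ginj _ _ _ _ Yu Yv Yu' Yv') [<- <-].
      move: Hij Hij' Et; clear; case: i; case: j; case: i'; case: j' => //= Hij Hij' _;
      by [|case: Hij|case: Hij'].
  - move=> x y z [H|[i [j [u [v [Yu [Yv [Hij [-> -> ->]]]]]]]]].
    + case: (Gdom _ _ _ H) => H1 [H2 H3].
      by split; [|split]; apply/BD; exists false; [exists x|exists y|exists z].
    + split; [|split]; apply/BD; [by exists i, u|by exists j, v|].
      by exists true, (g (tag i j) (g u v)); split=> //; exact: gYt.
  - move=> x y /BD [i [u [Yu ->]]] /BD [j [v [Yv ->]]].
    case: (classic (i = true \/ j = true)) => [Hij|Hij].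
    + by exists (h (g (tag i j) (g u v))); right; exists i, j, u, v.
    + case: i Hij => [[]|]; [by left|]; case: j => [[]|_]; first by right.
      by exists (g u v); left; exact: Hg.
have PB : P B.
  by apply: good_ext goodB => t; split=> [|[H|//]]; [right|left; left].
(* Maximality puts a triple of a new block into [G], whose triples have all coordinates in [Y],
   although [h (f0 0)] is outside [Y]. *)
have HD : G (h (f0 0), h (f0 0), h (g (tag true true) (g (f0 0) (f0 0)))).
  right; apply: (HA B PB); first by move=> t At; left; right.
  by right; exists true, true, (f0 0), (f0 0); do !split=> //; left.
by case: (Gdom _ _ _ HD) => HY; case: (hY _ (Yf 0) HY).
Qed.
End Square.

(** The length is stored separately, so the iterated pairing has to be injective only on lists of
    equal length. *)
Lemma card_list (X : Type) (f0 : nat -> X) : injective f0 -> card_le (list X) X.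
Proof.
move=> f0_inj; have [g ginj] := card_square f0_inj.
pose c := fix c (l : list X) := match l with [] => f0 0 | x :: l' => g (x, c l') end.
have cinj l l' : length l = length l' -> c l = c l' -> l = l'.
  elim: l l' => [|x l IH] [|x' l'] //= [El] /ginj [-> E].
  by rewrite (IH l').
exists (fun l => g (f0 (length l), c l)) => l l' /ginj [/f0_inj El E].
exact: cinj.
Qed.

(** * Closure properties of the sets with fewer elements than the structure *)

Section Small.
Variables (P Phi : Type) (f0 : nat -> Phi) (g0 : Phi * Phi -> Phi).
Hypothesis f0_inj : injective f0.
Hypothesis g0_inj : injective g0.
Hypothesis PhiP : card_lt Phi P.

Lemma small_le X Y : card_le X Y -> card_lt Y P -> card_lt X P.
Proof. by move=> H HY H'; apply: HY; apply: card_le_trans H' H. Qed.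

(** If [P] embedded in these lists it would embed in the infinite set [X + Phi], hence in the larger
    of [X] and [Phi], and neither contains a copy of [P]. The summand [Phi] makes the set
    infinite. *)
Let small_list_sum X : card_lt X P -> card_lt (list (X + Phi)) P.
Proof.
move=> HX H.
have H1 : card_le P (X + Phi).
  apply: card_le_trans H _.
  by apply: (@card_list _ (fun n => inr (f0 n))) => m n [] /f0_inj.
case: (card_le_total X Phi) => [[i Hi]|[i Hi]].
- apply: PhiP; apply: card_le_trans H1 _.
  exists (fun t => match t with inl x => g0 (f0 0, i x) | inr y => g0 (f0 1, y) end).
  move=> [x|x] [y|y] /g0_inj [].
  + by move=> /Hi ->.
  + by move=> /f0_inj.
  + by move=> /f0_inj.
  + by move=> ->.
- have Hf : injective (fun n => i (f0 n)) by move=> m n /Hi /f0_inj.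
  have [g Hg] := card_square Hf.
  apply: HX; apply: card_le_trans H1 _.
  exists (fun t => match t with inl x => g (i (f0 0), x) | inr y => g (i (f0 1), i y) end).
  move=> [x|x] [y|y] /Hg [].
  + by move=> ->.
  + by move=> /Hi /f0_inj.
  + by move=> /Hi /f0_inj.
  + by move=> /Hi ->.
Qed.

Lemma small_list X : card_lt X P -> card_lt (list X) P.
Proof.
move=> /small_list_sum; apply: small_le; exists (map inl) => l l'.
by elim: l l' => [|x l IH] [|x' l'] //= [-> /IH ->].
Qed.

Lemma small_nat : card_lt nat P.
Proof. by apply: small_le PhiP; exists f0. Qed.

Lemma small_sum X Y : card_lt X P -> card_lt Y P -> card_lt (X + Y) P.
Proof.
wlog H : X Y / card_le X Y.
  move=> Hw HX HY; case: (card_le_total X Y) => H; first exact: Hw.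
  apply: (small_le (Y := (Y + X)%type)); last exact: Hw.
  by exists (fun t => match t with inl x => inr x | inr y => inl y end) => -[x|x] [y|y] // [->].
move=> _ HY; apply: small_le (small_list_sum HY); case: H => i Hi.
exists (fun t => match t with inl x => [inl (i x)] | inr y => [inl y; inr (f0 0)] end).
by move=> [x|x] [y|y] // []; [move=> /Hi ->|move=> ->].
Qed.

Lemma small_prod X Y : card_lt X P -> card_lt Y P -> card_lt (X * Y) P.
Proof.
move=> HX HY; apply: small_le (small_list (small_sum HX HY)).
by exists (fun t => [inl (fst t); inr (snd t)]) => -[x y] [x' y'] [-> ->].
Qed.

(** A point of the union is determined by an index [j] and its position in the list [B j]. *)
Lemma small_union (J T : Type) (B : J -> list T) :
  card_lt J P -> card_lt {x | exists j, In x (B j)} P.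
Proof.
move=> HJ; apply: small_le (small_prod HJ small_nat).
have H (x : {x | exists j, In x (B j)}) :
    exists t : J * nat, nth_error (B (fst t)) (snd t) = Some (proj1_sig x).
  case: x => x [j Hj] /=; have [n Hn] := In_nth_error _ _ Hj.
  by exists (j, n).
have [f Hf] := dep_choice H; exists f => -[x Hx] [y Hy] E.
apply: eq_sig_hprop => [z u v|]; first exact: proof_irrelevance.
by have := Hf (exist _ x Hx); rewrite E Hf => -[].
Qed.

End Small.

(** The well-ordering principle gives a relation for which every nonempty set has a unique least
    element. Reflexivity, antisymmetry, totality and transitivity come from sets with one, two and
    three elements; the order sought is its strict part. *)
Lemma well_order_ex (T : Type) : exists lt : T -> T -> Prop,
  well_founded lt /\ (forall x y, lt x y \/ x = y \/ lt y x) /\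
  (forall x y z, lt x y -> lt y z -> lt x z).
Proof.
have [R HR] : exists R : T -> T -> Prop, forall A : T -> Prop, (exists x, A x) ->
    exists! z, A z /\ forall x, A x -> R z x.
  have [R HR] := wochoice.well_ordering_principle (boolp.boolp_classicType__canonical__eqtype_Equality T).
  exists (fun x y => is_true (R x y)) => A [x Ax].
  have HA z : is_true (ssrbool.in_mem z (@ssrbool.mem T (ssrbool.predPredType T) (fun x : T => boolp.asbool (A x)))) <-> A z.
    by split; [exact: (ssrbool.elimT (boolp.asboolP _))|exact: (ssrbool.introT (boolp.asboolP _))].
  have [|z [[Az Hz] Hz']] := HR (fun x => boolp.asbool (A x)).
    by exists x; apply/HA.
  exists z; split.
    by split; [exact/HA|move=> y Ay; apply: Hz; exact/HA].
  move=> y [Ay Hy]; apply: Hz'; split; first exact/HA.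
  by move=> u /HA Au; exact: Hy.
have Hrefl x : R x x.
  by have [z [[-> Hz] _]] := HR (fun y => y = x) (ex_intro _ x eq_refl); exact: Hz.
have Hanti x y : R x y -> R y x -> x = y.
  move=> Hxy Hyx; have [|z [_ Hz]] := HR (fun z => z = x \/ z = y); first by exists x; left.
  rewrite -(Hz x) ?(Hz y) //; split; try (by left); try (by right).
  - by move=> u [->|->].
  - by move=> u [->|->].
have Htot x y : R x y \/ R y x.
  have [|z [[Hz Hz'] _]] := HR (fun z => z = x \/ z = y); first by exists x; left.
  by case: Hz => ?; subst z; [left; apply: Hz'; right|right; apply: Hz'; left].
have Htrans x y z : R x y -> R y z -> R x z.
  move=> Hxy Hyz.
  have [|u [[Hu Hu'] _]] := HR (fun u => u = x \/ u = y \/ u = z); first by exists x; left.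
  case: Hu => [|[|]] ?; subst u.
  - by apply: Hu'; right; right.
  - by rewrite (Hanti x y) //; apply: Hu'; left.
  - rewrite -(Hanti y z) //; apply: Hu'; by right; left.
exists (fun x y => R x y /\ x <> y); split; [|split].
- move=> x; apply: NNPP => Hx.
  have [|z [[Hz Hz'] _]] := HR (fun x => ~ Acc (fun x y => R x y /\ x <> y) x); first by exists x.
  apply: Hz; constructor=> y [Hyz Hne]; apply: NNPP => Hy.
  by apply: Hne; apply: Hanti => //; exact: Hz'.
- move=> x y; case: (classic (x = y)) => H; first by right; left.
  by case: (Htot x y) => H'; [left|right; right; split=> // E; apply: H].
- move=> x y z [Hxy Hne] [Hyz Hne']; split; first exact: Htrans Hyz.
  by move=> E; subst z; apply: Hne; exact: Hanti.
Qed.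

(* Cutting off at the least long initial segment gives the initial ordinal. *)
Lemma initial_order (T : Type) : exists lt : T -> T -> Prop,
  well_founded lt /\ (forall x y, lt x y \/ x = y \/ lt y x) /\
  (forall x y z, lt x y -> lt y z -> lt x z) /\ forall x, card_lt {y | lt y x} T.
Proof.
have [lt [wf [tot tr]]] := well_order_ex T.
case: (classic (exists x, ~ card_lt {y | lt y x} T)) => [[x Hx]|H]; last first.
  exists lt; do !split=> //; move=> x; apply: NNPP => Hx; apply: H; by exists x.
have [x0 [/NNPP [f Hf] Hmin]] : exists x0, ~ card_lt {y | lt y x0} T /\
    forall y, lt y x0 -> card_lt {z | lt z y} T.
  elim/(well_founded_ind wf): x Hx => x IH Hx.
  case: (classic (exists y, lt y x /\ ~ card_lt {z | lt z y} T)) => [[y [Hy Hy']]|H].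
    exact: IH Hy Hy'.
  exists x; split=> // y Hy; apply: NNPP => Hy'; apply: H; by exists y.
exists (fun x y => lt (proj1_sig (f x)) (proj1_sig (f y))); split; [|split; [|split]].
- exact: (wf_inverse_image _ _ lt (fun x => proj1_sig (f x)) wf).
- move=> x1 y; case: (tot (proj1_sig (f x1)) (proj1_sig (f y))) => [|[|]] H; [by left| |by right; right].
  right; left; apply: Hf; apply: eq_sig_hprop => [z u v|//]; exact: proof_irrelevance.
- by move=> x1 y z; exact: tr.
- move=> y; apply: small_le (Hmin _ (proj2_sig (f y))).
  exists (fun z : {z | lt (proj1_sig (f z)) (proj1_sig (f y))} =>
    exist (fun u => lt u (proj1_sig (f y))) (proj1_sig (f (proj1_sig z))) (proj2_sig z)).
  move=> [u Hu] [v Hv] [E]; apply: eq_sig_hprop => [z ? ?|/=]; first exact: proof_irrelevance.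
  by apply: Hf; apply: eq_sig_hprop => [z ? ?|//]; exact: proof_irrelevance.
Qed.

(** * Counting formulas *)

(* Closed formulas absorb trees over the symbols of the language, since [Imp] is
   an injective pairing; this bounds the number of formulas of a finitely
   generated expansion. *)
Section Codes.
Variable L : lang.
Notation Phi := (@formula L []).

Definition imp_parts (G : list (sort L)) (phi : formula G) : formula G * formula G :=
  match phi in formula G0 return formula G0 * formula G0 with
  | Imp phi psi => (phi, psi)
  | psi => (psi, psi)
  end.

Definition cpair (t : Phi * Phi) : Phi := Imp (fst t) (snd t).

Lemma cpair_inj : injective cpair.
Proof. by move=> [a b] [a' b'] /(f_equal (@imp_parts [])). Qed.

Lemma cpair_inj2 a b a' b' : cpair (a, b) = cpair (a', b') -> a = a' /\ b = b'.
Proof. by move/cpair_inj => E; split; [exact: (f_equal fst E)|exact: (f_equal snd E)]. Qed.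

Fixpoint cnat (n : nat) : Phi :=
  match n with 0 => Bot [] | S n' => Imp (cnat n') (Bot []) end.

Lemma cnat_inj : injective cnat.
Proof.
elim=> [|m IH] [|n] // /(f_equal (@imp_parts [])) /= [] /IH -> //.
Qed.

Arguments cnat : simpl never.

Fixpoint close (G : list (sort L)) : formula G -> Phi :=
  match G with
  | [] => fun phi => phi
  | s :: G' => fun phi => close (All phi)
  end.

(** [head] reads back the symbol from which a closed formula was built, which shows the codings of
    symbols and sorts injective. A symbol found under the quantifiers takes precedence over the
    quantified sorts, so [close] does not hide it. *)
Inductive head_symbol := HF (f : fsym L) | HR (r : rsym L) | HS (s : sort L) | HNone.

Fixpoint head (G : list (sort L)) (phi : formula G) : head_symbol :=
  match phi with
  | Eq (@App _ _ f _) _ => HF f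
  | @Rel _ _ r _ => HR r
  | @All _ _ s phi => match head phi with HNone => HS s | h => h end
  | _ => HNone
  end.

Lemma head_close (G : list (sort L)) (phi : formula G) : head phi <> HNone ->
  head (close phi) = head phi.
Proof.
elim: G phi => [|s G IH] phi H //=.
by rewrite IH /=; case: (head phi) H.
Qed.

Definition cfsym (f : fsym L) : Phi :=
  let t := App (ren_terms (fun s (v : var (farity f) s) => v)) in close (Eq t t).
Definition crsym (r : rsym L) : Phi :=
  close (Rel (ren_terms (fun s (v : var (rarity r) s) => v))).
Definition csort (s : sort L) : Phi := @All L [] s (Bot [s]).

Lemma cfsym_inj : injective cfsym.
Proof. by move=> f g /(f_equal (@head [])); rewrite !head_close //= => -[]. Qed.

Lemma crsym_inj : injective crsym.
Proof. by move=> f g /(f_equal (@head [])); rewrite !head_close //= => -[]. Qed.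

Lemma csort_inj : injective csort.
Proof. by move=> s t /(f_equal (@head [])) /= []. Qed.

Definition clist (T : Type) (c : T -> Phi) : list T -> Phi :=
  fix cl l := match l with [] => Bot [] | x :: l' => cpair (c x, cl l') end.

Lemma clist_inj (T : Type) (c : T -> Phi) : injective c -> injective (clist c).
Proof.
move=> Hc; elim=> [|x l IH] [|y l'] //.
by move=> /cpair_inj2 [] /Hc -> /IH ->.
Qed.

Variables (N : lang_ext L unit) (F : fsym (extend N) -> Prop) (R : rsym (extend N) -> Prop).
Variables (lf : list (nfsym N)) (lr : list (nrsym N)).
Hypothesis Flf : forall g, F (inr g) -> In g lf.
Hypothesis Rlr : forall q, R (inr q) -> In q lr.

Let index_ex (T : Type) (l : list T) : exists i : T -> nat,
  forall x, In x l -> nth_error l (i x) = Some x.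
Proof.
have H x : exists n, In x l -> nth_error l n = Some x.
  case: (classic (In x l)) => [Hx|Hx]; last by exists 0.
  by have [n Hn] := In_nth_error _ _ Hx; exists n.
exact: dep_choice H.
Qed.

(** Old symbols and sorts keep their codes under the tag 0. New ones are coded under the tag 1 by
    their position in a finite list, which identifies only the members of that list. *)
Let csum (T : Type) (c : T -> Phi) (T' : Type) (i : T' -> nat) (t : T + T') : Phi :=
  match t with inl x => cpair (cnat 0, c x) | inr y => cpair (cnat 1, cnat (i y)) end.

Let csum_inj (T : Type) (c : T -> Phi) (T' : Type) (l : list T') (i : T' -> nat) t t' :
  injective c -> (forall x, In x l -> nth_error l (i x) = Some x) ->
  (forall y, t = inr y -> In y l) -> (forall y, t' = inr y -> In y l) ->
  csum c i t = csum c i t' -> t = t'.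
Proof.
move=> Hc Hi; case: t => x; case: t' => y Hx Hy /cpair_inj2 [E0 E1].
- by rewrite (Hc _ _ E1).
- by move: (cnat_inj E0).
- by move: (cnat_inj E0).
- move: E1 => /cnat_inj E; have := Hi _ (Hx x eq_refl); rewrite E (Hi _ (Hy y eq_refl)).
  by move=> [->].
Qed.

Fixpoint cvar (T : Type) (G : list T) s (v : var G s) : nat :=
  match v with var0 _ _ => 0 | varS _ v' => S (cvar v') end.

Lemma var_inv (T : Type) (t : T) (G : list T) s (v : var (t :: G) s) :
  existT (var (t :: G)) s v = existT (var (t :: G)) t (var0 t G) \/ exists v', v = varS t v'.
Proof.
refine (match v in var G0 s0 return match G0 return var G0 s0 -> Prop with
  | [] => fun _ => True
  | t :: G => fun v => existT (var (t :: G)) s0 v = existT (var (t :: G)) t (var0 t G) \/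
      exists v', v = varS t v' end v with var0 _ _ => or_introl eq_refl | varS _ v' => _ end).
by right; exists v'.
Qed.

Lemma cvar_inj (T : Type) (G : list T) s (v : var G s) s' (v' : var G s') :
  cvar v = cvar v' -> existT (var G) s v = existT (var G) s' v'.
Proof.
elim: v s' v' => [t G'|t u G' v IH] s' v'.
- case: (var_inv v') => [->|[w ->]] //.
- case: (var_inv v') => [E|[w ->]] /=.
    have : cvar (projT2 (existT (var (u :: G')) s' v')) = 0 by rewrite E.
    by move=> /= ->.
  move=> [] /IH E.
  by have := f_equal (fun p => existT (var (u :: G')) (projT1 p) (varS u (projT2 p))) E.
Qed.

Fixpoint cterm (L' : lang) (cf : fsym L' -> Phi) (G : list (sort L')) s (t : term G s) : Phi :=
  match t with
  | @Var _ _ _ v => cpair (cnat 0, cnat (cvar v))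
  | @App _ _ f ts => cpair (cnat 1, cpair (cf f, cterms cf ts))
  end
with cterms (L' : lang) (cf : fsym L' -> Phi) (G : list (sort L')) D (ts : terms G D) : Phi :=
  match ts with
  | tnil _ => Bot []
  | @tcons _ _ _ _ t ts' => cpair (cterm cf t, cterms cf ts')
  end.

(** Nested pairs with a tag for each constructor. Injectivity is limited to the sublanguage because
    only there does the position of a new symbol determine it. *)
Lemma card_formula_codes :
  exists c : forall G : list (sort (extend N)), formula G -> Phi,
    forall G (phi psi : formula G), formula_in F R phi -> formula_in F R psi ->
      c G phi = c G psi -> phi = psi.
Proof.
have [jf Hjf] := index_ex lf; have [jr Hjr] := index_ex lr.
pose cs : sort (extend N) -> Phi := csum csort (fun _ : unit => 0).
have cs_inj : injective cs.
  by move=> [s|[]] [t|[]] // /cpair_inj2 [] // _ /csort_inj ->.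
pose cf : fsym (extend N) -> Phi := csum cfsym jf.
pose cr : rsym (extend N) -> Phi := csum crsym jr.
have cf_inj f g : F f -> F g -> cf f = cf g -> f = g.
  move=> Ff Fg; apply: (csum_inj cfsym_inj Hjf).
  - by move=> y E; apply: Flf; rewrite -E.
  - by move=> y E; apply: Flf; rewrite -E.
have cr_inj f g : R f -> R g -> cr f = cr g -> f = g.
  move=> Ff Fg; apply: (csum_inj crsym_inj Hjr).
  - by move=> y E; apply: Rlr; rewrite -E.
  - by move=> y E; apply: Rlr; rewrite -E.
pose ct := @cterm (extend N) cf; pose cts := @cterms (extend N) cf.
have ct_inj G : (forall s (t : term G s), term_in F t -> forall s' (t' : term G s'), term_in F t' ->
      ct G s t = ct G s' t' -> existT (term G) s t = existT (term G) s' t') /\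
    (forall D (ts : terms G D), terms_in F ts -> forall D' (ts' : terms G D'), terms_in F ts' ->
      cts G D ts = cts G D' ts' -> existT (terms G) D ts = existT (terms G) D' ts').
  apply: (@term_terms_ind _ G
    (fun s t => term_in F t -> forall s' (t' : term G s'), term_in F t' ->
      ct G s t = ct G s' t' -> existT (term G) s t = existT (term G) s' t')
    (fun D ts => terms_in F ts -> forall D' (ts' : terms G D'), terms_in F ts' ->
      cts G D ts = cts G D' ts' -> existT (terms G) D ts = existT (terms G) D' ts')).
  - move=> s v _ s' [{}s' v' _|f ts _ /cpair_inj2 [] //].
    by move=> /cpair_inj2 [] _ /cnat_inj Ev; have E := cvar_inj Ev; exact: (f_equal (fun p => existT (term G) (projT1 p) (Var (projT2 p))) E).
  - move=> f ts IH /= [Ff Fts] s' [{}s' v' _ /cpair_inj2 [] //|g ts' [Fg Fts']].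
    move=> /cpair_inj2 [] _ /cpair_inj2 [] /cf_inj E E'.
    have {E} Ef := E Ff Fg; subst g.
    by rewrite (inj_pair2 _ _ _ _ _ (IH Fts _ ts' Fts' E')).
  - by move=> _ D' [].
  - move=> s D t IHt ts IHs /= [Ft Fts] D' [//|s' {}D' t' ts' /= [Ft' Fts']].
    move=> /cpair_inj2 [] /(IHt Ft _ _ Ft') Et /(IHs Fts _ _ Fts') Es.
    have E1 := f_equal (@projT1 _ _) Et; have E2 := f_equal (@projT1 _ _) Es.
    move: E1 E2 => /= E1 E2; subst s' D'.
    by rewrite (inj_pair2 _ _ _ _ _ Et) (inj_pair2 _ _ _ _ _ Es).
pose cphi := fix cphi G (phi : @formula (extend N) G) : Phi :=
  match phi with
  | Bot _ => cpair (cnat 0, cnat 0)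
  | @Eq _ G s t u => cpair (cnat 1, cpair (ct G s t, ct G s u))
  | @Rel _ G r ts => cpair (cnat 2, cpair (cr r, cts G _ ts))
  | @Imp _ G phi psi => cpair (cnat 3, cpair (cphi G phi, cphi G psi))
  | @All _ G s phi => cpair (cnat 4, cpair (cs s, cphi _ phi))
  end.
exists cphi.
(* Case analysis on [psi] requires its context to vary, hence an equality of dependent pairs, from
   which the formulas are extracted at the end. *)
suff H G (phi : @formula (extend N) G) : formula_in F R phi -> forall G' (psi : formula G'), G = G' ->
    formula_in F R psi -> cphi G phi = cphi G' psi ->
    existT (@formula (extend N)) G phi = existT (@formula (extend N)) G' psi.
  move=> G phi psi H1 H2 E; exact: inj_pair2 _ _ _ _ _ (H G phi H1 G psi eq_refl H2 E).
elim: phi => [{}G|{}G s t u|{}G r ts|{}G phi1 IH1 phi2 IH2|{}G s phi IH] /= H1 G'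
  [{}G'|{}G' s' t' u'|{}G' r' ts'|{}G' phi1' phi2'|{}G' s' phi'] /= EG H2 /cpair_inj2 [] /cnat_inj // _.
- by rewrite EG.
- subst G'; move=> /cpair_inj2 [].
  move=> /(proj1 (ct_inj G) _ _ (proj1 H1) _ _ (proj1 H2)) Et.
  move=> /(proj1 (ct_inj G) _ _ (proj2 H1) _ _ (proj2 H2)) Eu.
  have E1 := f_equal (@projT1 _ _) Et; move: E1 => /= E1; subst s'.
  by rewrite (inj_pair2 _ _ _ _ _ Et) (inj_pair2 _ _ _ _ _ Eu).
- subst G'; move=> /cpair_inj2 [] /(cr_inj _ _ (proj1 H1) (proj1 H2)) Er; subst r'.
  by move=> Et; rewrite (inj_pair2 _ _ _ _ _ (proj2 (ct_inj G) _ _ (proj2 H1) _ _ (proj2 H2) Et)).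
- subst G'; move=> /cpair_inj2 [].
  move=> E1 E2; rewrite (inj_pair2 _ _ _ _ _ (IH1 (proj1 H1) _ _ eq_refl (proj1 H2) E1)).
  by rewrite (inj_pair2 _ _ _ _ _ (IH2 (proj2 H1) _ _ eq_refl (proj2 H2) E2)).
- subst G'; move=> /cpair_inj2 [] /cs_inj Es; subst s'.
  by move=> E; rewrite (inj_pair2 _ _ _ _ _ (IH H1 _ _ eq_refl H2 E)).
Qed.

End Codes.

Section Coordinates.
Variables (L : lang) (M : structure L) (X : Type) (RX : Rep M X).

Lemma pm_cons s (G : list (sort L)) (f : X -> M s) (g : X -> env M G) :
  pm M f -> pm M g -> pm M (fun x => (f x, g x) : env M (s :: G)).
Proof. by move=> Hf Hg; have [r Hr] := pm_pair Hf Hg; exists r => x; exact: Hr. Qed.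

Lemma pm_lookup (G : list (sort L)) (f : X -> env M G) s (v : var G s) :
  pm M f -> pm M (fun x => lookup v (f x)).
Proof.
move=> [r Hr]; exists (fun t => var_cases (P := var (rctx M X)) (r s v)
  (fun t (w : var [] t) => match w with end) (s := t)) => x.
have := f_equal (lookup v) (Hr x); rewrite lookup_pull /= => <-.
by [].
Qed.

Lemma pm_pull (G D : list (sort L)) (f : X -> env M G) (r : ren D G) :
  pm M f -> pm M (fun x => pull r (f x)).
Proof. by move=> [r' Hr]; exists (fun s v => r' s (r s v)) => x; rewrite -(pull_comp r r') -(Hr x). Qed.

End Coordinates.

(** * Definability with parameters *)

Section Pdef.
Variables (L : lang) (M : structure L).

Lemma pdef_zd Y (RY : Rep M Y) (P : Y -> Prop) : zd M P -> pdef M P.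
Proof.
move=> HP; apply: (pdef_intro (M := M) (Q := fun y (_ : unit) => P y) (w := tt)) => //.
by apply: (zd_comp HP); pm_tac.
Qed.

Lemma pdef_ext Y (RY : Rep M Y) (P Q : Y -> Prop) : (forall y, P y <-> Q y) -> pdef M P -> pdef M Q.
Proof. by move=> H [D [S [e [H1 H2]]]]; exists D, S, e; split=> // y; rewrite -H. Qed.

Lemma pdef_not Y (RY : Rep M Y) (P : Y -> Prop) : pdef M P -> pdef M (fun y => ~ P y).
Proof.
move=> [H [Q [e [HQ HP]]]]; exists H, (fun t => ~ Q t), e; split; first exact: zd_not.
by move=> y; rewrite HP.
Qed.

Lemma pdef_and Y (RY : Rep M Y) (P P' : Y -> Prop) : pdef M P -> pdef M P' ->
  pdef M (fun y => P y /\ P' y).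
Proof.
move=> [H [Q [e [HQ HP]]]] [H' [Q' [e' [HQ' HP']]]].
apply: (pdef_intro (M := M) (Q := fun y w => Q (y, fst w) /\ Q' (y, snd w)) (w := (e, e'))).
- by apply: zd_and; [apply: (zd_comp HQ)|apply: (zd_comp HQ')]; pm_tac.
- by move=> y; rewrite HP HP'.
Qed.

Lemma pdef_all_list (I : Type) (l : list I) Y (RY : Rep M Y) (P : I -> Y -> Prop) :
  (forall i, In i l -> pdef M (P i)) -> pdef M (fun y => forall i, In i l -> P i y).
Proof.
elim: l => [|i l IH] H.
  by apply: (pdef_ext (P := fun _ => True)); [move=> y; split=> // _ i []|apply: pdef_zd; exact: zd_True].
apply: pdef_ext (pdef_and (H i (or_introl eq_refl)) (IH (fun j Hj => H j (or_intror Hj)))).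
move=> y; split=> [[Hi Hl] j [<- //|]|Hl]; first exact: Hl.
by split; [apply: Hl; left|move=> j Hj; apply: Hl; right].
Qed.

Lemma pdef_comp Y Z (RY : Rep M Y) (RZ : Rep M Z) (P : Z -> Prop) (f : Y -> Z) :
  pdef M P -> pm M f -> pdef M (fun y => P (f y)).
Proof.
move=> [H [Q [e [HQ HP]]]] Hf; exists H, (fun t => Q (f (fst t), snd t)), e; split=> [|y].
- apply: (zd_comp (f := fun t => (f (fst t), snd t)) HQ); apply: pm_pair; last by pm_tac.
  by apply: (pm_comp (f := fst)); pm_tac.
- exact: HP.
Qed.

Lemma pdef_inst Y Z (RY : Rep M Y) (RZ : Rep M Z) (P : Y * Z -> Prop) (z : Z) :
  pdef M P -> pdef M (fun y => P (y, z)).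
Proof.
move=> [H [Q [e [HQ HP]]]].
apply: (pdef_intro (M := M) (Q := fun y w => Q ((y, fst w), snd w)) (w := (z, e))).
- by apply: (zd_comp HQ); pm_tac.
- by move=> y; rewrite HP.
Qed.

Lemma pdef_ex Y Z (RY : Rep M Y) (RZ : Rep M Z) (P : Y * Z -> Prop) :
  pdef M P -> pdef M (fun y => exists z, P (y, z)).
Proof.
move=> [H [Q [e [HQ HP]]]].
apply: (pdef_intro (M := M) (Q := fun y w => exists z, Q ((y, z), w)) (w := e)).
- by zd_step; apply: (zd_comp HQ); pm_tac.
- by move=> y; split=> -[z Hz]; exists z; apply/HP.
Qed.

End Pdef.

(** * Compactness *)

Fixpoint coords (S : Type) (M : S -> Type) (G : list S) : env M G -> list {s : S & M s} :=
  match G with [] => fun _ => [] | s :: G' => fun x => existT M s (fst x) :: coords (snd x) end.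

Lemma env_all_coords (S : Type) (M : S -> Type) (B : {s : S & M s} -> Prop) (G : list S) (e : env M G) :
  (forall t, In t (coords e) -> B t) -> env_all B e.
Proof.
elim: G e => [|s G IH] e H //=; split; first by apply: H; left.
by apply: IH => t Ht; apply: H; right.
Qed.

Section Compactness.
Variables (L : lang) (M : structure L) (Phi : Type).
Variables (f0 : nat -> Phi) (g0 : Phi * Phi -> Phi).
Hypothesis f0_inj : injective f0.
Hypothesis g0_inj : injective g0.
Hypothesis PhiP : card_lt Phi (points M).
Hypothesis Msat : saturated M.

(** By induction on the number of variables. If no finite subfamily covers, the conditions on the
    first variable saying that it extends to a tuple outside finitely many [Q j] are finitely
    satisfiable, so some [x] realises them all; the induction hypothesis at this [x] gives a
    contradiction. *)
Let compact_env (G : list (sort L)) (J : Type) (Q : J -> env M G -> Prop) :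
  card_lt J (points M) -> (forall j, pdef M (Q j)) -> (forall x, exists j, Q j x) ->
  exists l : list J, forall x, exists j, In j l /\ Q j x.
Proof.
move=> HJ; elim: G Q => [|s G IH] Q HQ Hcov.
  have [j Hj] := Hcov tt; exists [j] => -[]; exists j; split=> //; by left.
apply: NNPP => Hn.
(* There is one formula for each finite list rather than for each index, because the existential
   quantifier over [e] does not commute with conjunction. *)
have Hl (l : list J) : exists q : pformula M s, forall x : M s,
    psat q x <-> exists e : env M G, forall j, In j l -> ~ Q j (x, e).
  have [H [S [e [[phi Hphi] HP]]]] : pdef M (fun x : M s => exists e : env M G, forall j, In j l -> ~ Q j (x, e)).
    apply: (pdef_ex (P := fun t : M s * env M G => forall j, In j l -> ~ Q j t)).
    apply: pdef_all_list => j _; apply: pdef_not.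
    by move: (HQ j) => [H [S [e [[phi Hphi] HP]]]]; exists H, S, e; split=> //; exists phi.
  exists (existT _ H (phi, e)) => x; rewrite HP Hphi.
  by rewrite /psat.
have [q Hq] := dep_choice Hl.
(* All parameters of all these formulas: they are few, since lists over the small [J] are few and
   each formula has finitely many parameters. *)
pose B t := exists l, In t (coords (snd (projT2 (q l)))).
have HB : card_lt {x | B x} (points M).
  exact: (small_union f0_inj g0_inj PhiP (B := fun l => coords (snd (projT2 (q l))))
    (small_list f0_inj g0_inj PhiP HJ)).
have [|m Hm|x Hx] := Msat HB (s := s) (p := fun q' => exists l, q' = q l).
- by move=> _ [l ->]; apply: env_all_coords => t Ht; exists l.
- have [l Hl'] : exists l : list J, forall q', In q' m -> exists l', q' = q l' /\ incl l' l.
    elim: m Hm => [|q' m IHm] Hm; first by exists [] => q' [].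
    have [|l Hl'] := IHm; first by move=> q'' Hq''; apply: Hm; right.
    have [l' El'] := Hm q' (or_introl eq_refl).
    exists (l' ++ l) => q'' [<-|Hq''].
      by exists l'; split=> //; exact: incl_appl (incl_refl _).
    by have [l'' [E Hi]] := Hl' q'' Hq''; exists l''; split=> //; exact: incl_appr.
  have [x [e Hxe]] : exists x e, forall j, In j l -> ~ Q j (x, e).
    apply: NNPP => H; apply: Hn; exists l => -[x e]; apply: NNPP => H'; apply: H.
    by exists x, e => j Hj Hqj; apply: H'; exists j.
  exists x => q' /Hl' [l' [-> Hi]]; apply/Hq; exists e => j Hj; apply: Hxe; exact: Hi.
have [|e|l Hl'] := IH (fun j e => Q j (x, e)).
- move=> j; apply: (pdef_ext (P := fun e : env M G => Q j (fst (x, e), snd (x, e)))) => //.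
  have HQj : pdef M (fun t : env M G * M s => Q j (snd t, fst t)).
    apply: (pdef_comp (RZ := Rep_env M (s :: G)) (f := fun t : env M G * M s => (snd t, fst t))); first exact: HQ.
    by apply: pm_cons; pm_tac.
  exact: (pdef_inst (P := fun t : env M G * M s => Q j (snd t, fst t)) x HQj).
- exact: (Hcov (x, e)).
have [e He] := proj1 (Hq l x) (Hx (q l) (ex_intro _ l eq_refl)).
by have [j [Hj Hqj]] := Hl' e; exact: He Hqj.
Qed.

Lemma compactness (Y : Type) (RY : Rep M Y) (J : Type) (Q : J -> Y -> Prop) :
  card_lt J (points M) -> (forall j, pdef M (Q j)) -> (forall x, exists j, Q j x) ->
  exists l : list J, forall x, exists j, In j l /\ Q j x.
Proof.
move=> HJ HQ Hcov.
have [||l Hl] := compact_env (Q := fun j e => Q j (rdec M e)) HJ.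
- move=> j; apply: (pdef_comp (f := rdec M)); first exact: HQ.
  by exists (fun s v => v) => e; rewrite rdecK pull_id.
- by move=> e; exact: Hcov.
exists l => y; have [j] := Hl (renc M y); rewrite rencK => Hj; by exists j.
Qed.

End Compactness.

(** * Partial elementary maps *)

Section Related.
Variables (L : lang) (M : structure L).

(* A partial map from [M] to [M] is given by its set of pairs. *)
Definition pairs : Type := {s : sort L & (M s * M s)%type}.
Definition pt s (x y : M s) : pairs := existT _ s (x, y).

Lemma pt_inj s (x y x' y' : M s) : pt x y = pt x' y' -> x = x' /\ y = y'.
Proof.
by move=> H; have E := inj_pair2 _ _ _ _ _ H; split; [exact: (f_equal fst E)|exact: (f_equal snd E)].
Qed.

Fixpoint related (R : pairs -> Prop) (G : list (sort L)) : env M G -> env M G -> Prop :=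
  match G with
  | [] => fun _ _ => True
  | s :: G' => fun x y => R (pt (fst x) (fst y)) /\ related R (snd x) (snd y)
  end.

Definition partial_elementary (R : pairs -> Prop) : Prop :=
  forall G (x y : env M G) (P : env M G -> Prop), related R x y -> zd M P -> P x -> P y.

Lemma related_app R G D (x x' : env M G) (y y' : env M D) :
  related R x x' -> related R y y' -> related R (env_app x y) (env_app x' y').
Proof.
elim: G x x' => [|s G IH] x x' //= [H1 H2] H3; split=> //; exact: IH.
Qed.

Lemma related_lookup R G (x y : env M G) : related R x y <->
  forall s (v : var G s), R (pt (lookup v x) (lookup v y)).
Proof.
split=> [H s v|].
- elim: v x y H => [t G'|t u G' v IH] x y /= [H1 H2] //; exact: IH.
- elim: G x y => [|s G IH] x y H //=; split; first exact: (H s (var0 s G)).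
  apply: IH => t v; exact: (H t (varS s v)).
Qed.

Lemma related_sub R R' G (x y : env M G) : (forall t, R t -> R' t) -> related R x y -> related R' x y.
Proof. by move=> H /related_lookup H'; apply/related_lookup => s v; apply: H. Qed.

Lemma partial_elementary_sub R R' : (forall t, R t -> R' t) -> partial_elementary R' -> partial_elementary R.
Proof. by move=> H H' G x y P Hxy; apply: H'; exact: related_sub Hxy. Qed.

Definition swap (t : pairs) : pairs := pt (snd (projT2 t)) (fst (projT2 t)).

Lemma partial_elementary_swap R R' : (forall t, R' t -> R (swap t)) ->
  partial_elementary R -> partial_elementary R'.
Proof.
move=> H HR G x y P Hxy HP Px; apply: NNPP => nPy.
apply: (HR G y x (fun z => ~ P z)) Px => //; last exact: zd_not.
apply/related_lookup => s v; move/related_lookup: Hxy => /(_ s v) /H.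
by [].
Qed.

(** The two predicates come from one formula, with parameters matched by [R]; a partial elementary
    map then transports the existence of a solution. *)
Definition transfers (R : pairs -> Prop) (Y : Type) {RY : Rep M Y} (P1 P2 : Y -> Prop) : Prop :=
  exists H (w1 w2 : env M H) (Q : Y * env M H -> Prop), related R w1 w2 /\ zd M Q /\
    (forall y, P1 y <-> Q (y, w1)) /\ (forall y, P2 y <-> Q (y, w2)).

Lemma transfers_list R (I : Type) (l : list I) Y (RY : Rep M Y) (P1 P2 : I -> Y -> Prop) :
  (forall i, transfers R (P1 i) (P2 i)) ->
  transfers R (fun y => forall i, In i l -> P1 i y) (fun y => forall i, In i l -> P2 i y).
Proof.
move=> H; elim: l => [|i l [G [w1 [w2 [Q [Hw [HQ [E1 E2]]]]]]]].
  exists [], tt, tt, (fun _ => True); do !split=> //; exact: zd_True.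
have [G' [w1' [w2' [Q' [Hw' [HQ' [E1' E2']]]]]]] := H i.
exists (G ++ G'), (env_app w1 w1'), (env_app w2 w2'),
  (fun t => Q (fst t, eleft (snd t)) /\ Q' (fst t, eright (snd t))).
split; first exact: related_app.
split.
  apply: zd_and.
  - apply: (zd_comp (f := fun t : Y * env M (G ++ G') => (fst t, eleft (snd t))) HQ).
    by apply: pm_pair; [pm_tac|apply: pm_pull; pm_tac].
  - apply: (zd_comp (f := fun t : Y * env M (G ++ G') => (fst t, eright (snd t))) HQ').
    by apply: pm_pair; [pm_tac|apply: pm_pull; pm_tac].
have X (P : I -> Y -> Prop) y : (forall j, In j (i :: l) -> P j y) <->
    (forall j, In j l -> P j y) /\ P i y.
  split=> [Hy|[H1 H2] j [<- //|]]; last exact: H1.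
  by split=> [j Hj|]; apply: Hy; [right|left].
by split=> y; rewrite X /= eleft_app eright_app ?E1 ?E1' ?E2 ?E2'.
Qed.

Lemma transfers_ex R Y (RY : Rep M Y) (P1 P2 : Y -> Prop) : partial_elementary R ->
  transfers R P1 P2 -> (exists y, P1 y) -> exists y, P2 y.
Proof.
move=> HR [G [w1 [w2 [Q [Hw [HQ [E1 E2]]]]]]] [y /E1 Hy].
have [|y' Hy'] := HR G w1 w2 (fun w => exists y, Q (y, w)) Hw _ (ex_intro _ y Hy).
  by zd_step; apply: (zd_comp (f := fun t => (snd t, fst t)) HQ); pm_tac.
by exists y'; apply/E2.
Qed.

End Related.

Section Extension.
Variables (L : lang) (U : structure L) (N : lang_ext L unit) (X : expansion U N).
Notation M := (expand X).

Definition old_pairs (t : pairs M) : Prop := exists s (u : U s), t = pt (s := inl s : sort (extend N)) (M := M) u u.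

Lemma related_old (R : pairs M -> Prop) G (u : env U G) : (forall t, old_pairs t -> R t) ->
  related (M := M) R (to_exp X u) (to_exp X u).
Proof.
move=> H; elim: G u => [|s G IH] u //=; split; last exact: IH.
by apply: H; exists s, (fst u).
Qed.

Section Family.
Variables (K : Type) (k : K -> pairs M).

Definition fam_ctx : list K -> list (sort (extend N)) := map (fun i => projT1 (k i)).
Fixpoint fam1 (l : list K) : env M (fam_ctx l) :=
  match l with [] => tt | i :: l' => (fst (projT2 (k i)), fam1 l') end.
Fixpoint fam2 (l : list K) : env M (fam_ctx l) :=
  match l with [] => tt | i :: l' => (snd (projT2 (k i)), fam2 l') end.

Lemma related_fam (R : pairs M -> Prop) l : (forall i, R (k i)) -> related R (fam1 l) (fam2 l).
Proof.
move=> H; elim: l => [|i l IH] //=; split=> //.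
by have := H i; rewrite /pt; case: (k i) => s [].
Qed.

(** The maps to be extended contain the identity of [U], which need not be small; smallness is asked
    of the remaining pairs, indexed by [K]. *)
Definition with_old (t : pairs M) : Prop := old_pairs t \/ exists i, t = k i.

(** Separates, up to a change of variables [f], the coordinates that lie in [U] from those in the
    family [k], so that stable embeddedness can be applied to the part in [U]. *)
Lemma related_split Gam (x y : env M Gam) : related with_old x y ->
  exists l G (u : env U G) (f : env M (fam_ctx l) * env U G -> env M Gam),
    pm M f /\ x = f (fam1 l, u) /\ y = f (fam2 l, u).
Proof.
elim: Gam x y => [|s Gam IH] x y /=.
  move=> _; exists [], [], tt, (fun _ => tt); split; first exact: pm_tt.
  by case: x; case: y.
case: x => a x; case: y => b y /= [H /IH [l [G [u [f [Hf [-> ->]]]]]]].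
case: H => [[s0 [c H]]|[i H]].
- have Es : inl s0 = s by exact: (f_equal (@projT1 _ _) (esym H)).
  subst s; have [-> ->] : (a, b) = (c, c) by exact: inj_pair2 H.
  exists l, (s0 :: G), (c, u).
  exists (fun t => (lookup (var0 s0 G) (snd t) : M (inl s0),
    f (fst t, pull (fun s v => varS s0 v) (snd t)))).
  have pull_tail e : pull (fun s v => varS s0 v) e = snd e.
    by apply: pull_eq.
  split; last by rewrite !pull_tail.
  apply: (pm_cons (s := inl s0 : sort (extend N))).
  + apply: (pm_comp (f := snd) (RZ := Rep_old X (Rep_car U s0)) (g := fun e : env U (s0 :: G) => lookup (var0 s0 G) e)); first by pm_tac.
    by apply: pm_old; apply: pm_lookup; exact: pm_id.
  + apply: (pm_comp (f := fun t => (fst t, pull (fun s v => varS s0 v) (snd t)))) Hf.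
    apply: pm_pair; first by pm_tac.
    apply: (pm_comp (f := snd) (g := fun e : env U (s0 :: G) => pull (fun s v => varS s0 v) e)); first by pm_tac.
    by apply: pm_old; apply: pm_pull; exact: pm_id.
- exists (i :: l), G, u.
  have Es : projT1 (k i) = s by rewrite -H.
  subst s; have [-> ->] : a = fst (projT2 (k i)) /\ b = snd (projT2 (k i)).
    apply: pt_inj; rewrite H; by case: (k i) => s [].
  exists (fun t : env M (projT1 (k i) :: fam_ctx l) * env U G =>
    (lookup (var0 _ _) (fst t), f (pull (fun s v => varS _ v) (fst t), snd t))).
  have pull_tail e : pull (fun s v => varS (projT1 (k i)) v) e = snd e :> env M (fam_ctx l).
    by apply: pull_eq.
  split; last by rewrite !pull_tail.
  apply: pm_cons.
  + by apply: pm_lookup; pm_tac.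
  + apply: (pm_comp (f := fun t : env M (projT1 (k i) :: fam_ctx l) * env U G =>
      (pull (fun s v => varS (projT1 (k i)) v) (fst t), snd t))) Hf.
    by apply: pm_pair; [apply: pm_pull; pm_tac|pm_tac].
Qed.

End Family.
End Extension.

(** * Homogeneity over [U] *)

Section Homogeneity.
Variables (L : lang) (U : structure L) (N : lang_ext L unit) (X : expansion U N).
Notation M := (expand X).
Notation Phi := (@formula L []).
Hypothesis HU : card_lt {G : list (sort L) & formula G} (points U).
Hypothesis HX : cover X.
Hypothesis Hfg : finitely_generated X.

Lemma small_Phi : card_lt Phi (points M).
Proof.
move=> [f Hf]; apply: HU.
exists (fun t : points U => existT _ [] (f (existT _ (inl (projT1 t)) (projT2 t)))) => -[s x] [s' x'] E.
have {}E := inj_pair2 _ _ _ _ _ E.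
have {}E : existT M (inl s) x = existT M (inl s') x' by exact: Hf.
have Es : s = s' by have := f_equal (@projT1 _ _) E; move=> /= [].
by subst s'; rewrite (inj_pair2 _ _ _ _ _ E).
Qed.

Let s_list := small_list (@cnat_inj L) (@cpair_inj L) small_Phi.
Let s_sum := small_sum (@cnat_inj L) (@cpair_inj L) small_Phi.
Let s_prod := small_prod (@cnat_inj L) (@cpair_inj L) small_Phi.
Let s_nat := small_nat (@cnat_inj L) small_Phi.

(** Up to equivalence every formula belongs to the generating sublanguage. The types [Fm G] of its
    formulas therefore account for all 0-definable predicates while being no larger than [Phi]. *)
Lemma small_formulas : exists (Fm : list (sort (extend N)) -> Type)
    (fm : forall G, Fm G -> env M G -> Prop) (c : forall G, Fm G -> Phi),
  (forall G i, zd M (@fm G i)) /\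
  (forall G (P : env M G -> Prop), zd M P -> exists i, forall x, P x <-> fm G i x) /\
  (forall G, injective (c G)).
Proof.
have [F [R [[lf Hlf] [[lr Hlr] H]]]] := Hfg.
have [c Hc] := card_formula_codes Hlf Hlr.
exists (fun G => {phi : formula G | formula_in F R phi}), (fun G i x => sat (proj1_sig i) x),
  (fun G i => c G (proj1_sig i)); split; [|split].
- by move=> G [phi Hphi] /=; exists phi.
- move=> G P [phi Hphi]; have [psi [Hin Hpsi]] := H G phi.
  by exists (exist _ psi Hin) => x; rewrite Hphi -Hpsi.
- move=> G [phi Hphi] [psi Hpsi] /= E.
  apply: eq_sig_hprop => [x u v|/=]; [exact: proof_irrelevance|exact: Hc].
Qed.

(** The family [C] may be large as a set of predicates; indexing its members by formulas of the
    generating sublanguage makes the cover small enough for compactness. *)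
Lemma zd_compactness (Y : Type) (RY : Rep M Y) (C : (Y -> Prop) -> Prop) :
  (forall P, C P -> zd M P) -> (forall y, exists P, C P /\ P y) ->
  exists l, (forall P, In P l -> C P) /\ forall y, exists P, In P l /\ P y.
Proof.
move=> HC Hcov.
have [Fm [fm [c [fm_zd [fm_all c_inj]]]]] := small_formulas.
pose J := {i : Fm (@rctx _ M Y RY) | exists P, C P /\ forall y, P y <-> fm _ i (@renc _ M Y RY y)}.
have HJ : card_lt J (points M).
  apply: (small_le (Y := Phi)); last exact: small_Phi.
  exists (fun i => c _ (proj1_sig i)) => -[i Hi] [j Hj] /= /c_inj E.
  by apply: eq_sig_hprop => // x u v; exact: proof_irrelevance.
have [||l Hl] := compactness (@cnat_inj L) (@cpair_inj L) small_Phi (proj1 HX)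
  (Q := fun (i : J) y => fm _ (proj1_sig i) (renc M y)) HJ.
- move=> i; apply: pdef_zd; have [phi Hphi] := fm_zd _ (proj1_sig i); by exists phi.
- move=> y; have [P [CP Py]] := Hcov y; have [phi Hphi] := HC P CP.
  have [|i Hi] := fm_all (rctx M Y) (fun e => sat phi e); first by exists phi.
  have HP z : P z <-> fm _ i (renc M z) by rewrite Hphi Hi.
  exists (exist _ i (ex_intro _ P (conj CP HP))) => /=.
  by apply/HP.
have [f Hf] := dep_choice (fun i : J => proj2_sig i).
exists (map f l); split=> [P /in_map_iff [i [<- _]]|y]; first exact: (proj1 (Hf i)).
have [i [Hi Hy]] := Hl y; exists (f i); split; first exact: in_map.
by apply: (proj2 (proj2 (Hf i) y)).
Qed.

Lemma trace_def (Y W : Type) (RY : Rep M Y) (RW : Rep U W) (P : Y * W -> Prop) (y : Y) : zd M P ->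
  exists (D : list (sort L)) (c : env U D) (Psi : W * env U D -> Prop),
    zd U Psi /\ forall w, P (y, w) <-> Psi (w, c).
Proof.
move=> HP; apply: (st_emb (proj1 (proj2 HX)) (RM := Rep_old X RW)).
apply: (pdef_intro (Q := fun w y => P (y, w)) (w := y)) => //.
by apply: (zd_comp (f := fun t => (snd t, fst t)) HP); pm_tac.
Qed.

Lemma zd_old_pair (W V : Type) (RW : Rep U W) (RV : Rep U V) (P : W * V -> Prop) :
  zd U P -> zd M P.
Proof. by move=> H; apply/(zd_compat (Compat_prod (Compat_old X RW) (Compat_old X RV))); exact: zd_old. Qed.

(* The type of [e] over [U] and the domain of the map is small, because its trace
   on [U] is given by definitions with parameters in [U]. *)
Lemma extend_map (K : Type) (k : K -> pairs M) s (e : M s) :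
  card_lt K (points M) -> partial_elementary (with_old k) ->
  exists e', partial_elementary (fun t => with_old k t \/ t = pt e e').
Proof.
move=> HK Hel.
have [Fm [fm [c [fm_zd [fm_all c_inj]]]]] := small_formulas.
(* An index is a formula with one variable for the new point, variables for finitely many members of
   the domain, and variables ranging over [U]. *)
pose J := {l : list K & {G : list (sort L) & Fm (s :: (fam_ctx k l ++ map inl G))}}.
have HJ : card_lt J (points M).
  apply: small_le (s_prod (s_list HK) (s_prod small_Phi small_Phi)).
  exists (fun j : J => (projT1 j, (clist (@csort L) (projT1 (projT2 j)), c _ (projT2 (projT2 j))))).
  move=> [l [G i]] [l' [G' i']] /= E.
  have E1 : l = l' := f_equal fst E.
  have E2 : clist (@csort L) G = clist (@csort L) G' := f_equal (fun t => fst (snd t)) E.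
  have E3 := f_equal (fun t => snd (snd t)) E; move: E3 => /= E3.
  have E4 := clist_inj (@csort_inj L) E2; subst l' G'.
  by rewrite (c_inj _ _ _ E3).
pose enc l G (t : M s * (env M (fam_ctx k l) * env U G)) :=
  @renc _ M _ (Rep_prod (Rep_car M s) (Rep_prod (Rep_env M (fam_ctx k l)) (Rep_old X (Rep_env U G)))) t.
pose P (j : J) (t : M s * (env M (fam_ctx k (projT1 j)) * env U (projT1 (projT2 j)))) : Prop :=
  fm _ (projT2 (projT2 j)) (enc _ _ t).
have HP j : zd M (P j).
  by have [phi Hphi] := fm_zd _ (projT2 (projT2 j)); exists phi => t; rewrite /P Hphi.
have Hdef (j : J) : exists D : {D : list (sort L) & (env U D * (env U (projT1 (projT2 j)) * env U D -> Prop))%type},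
    zd U (snd (projT2 D)) /\
    forall u, P j (e, (fam1 k (projT1 j), u)) <-> snd (projT2 D) (u, fst (projT2 D)).
  have [D [d [Psi [H1 H2]]]] := trace_def (P := fun t : (M s * env M (fam_ctx k (projT1 j))) * env U (projT1 (projT2 j)) =>
    P j (fst (fst t), (snd (fst t), snd t))) (e, fam1 k (projT1 j))
    ltac:(apply: (zd_comp (HP j)); pm_tac).
  by exists (existT _ D (d, Psi)).
have [D HD] := dep_choice Hdef.
(* [T j b x] says that formula [j] at [x] and [b] cuts out on [U] the same set as it does at [e] and
   the domain. With the images of the domain for [b], a common solution for all [j] is the required
   [e']. *)
pose T (j : J) (b : env M (fam_ctx k (projT1 j))) (x : M s) : Prop :=
  forall u, P j (x, (b, u)) <-> snd (projT2 (D j)) (u, fst (projT2 (D j))).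
have HT j : zd M (fun t : M s * (env M (fam_ctx k (projT1 j)) * env U (projT1 (D j))) =>
    forall u, P j (fst t, (fst (snd t), u)) <-> snd (projT2 (D j)) (u, snd (snd t))).
  zd_step; zd_step.
  - by apply: (zd_comp (HP j)); pm_tac.
  - have H := zd_old_pair (proj1 (HD j)).
    by apply: (zd_comp H); pm_tac.
have [[e' He']|Hno] := classic (exists e', forall j, T j (fam2 k (projT1 j)) e').
  exists e' => G x y Q Hxy HQ.
  pose k' (i : option K) := match i with Some i => k i | None => pt e e' end.
  have [|l [G' [u [f [Hf [-> ->]]]]]] := related_split (X := X) (k := k') (x := x) (y := y).
    apply: related_sub Hxy => t [[H|[i H]]|H]; [by left|right; by exists (Some i)|right; by exists None].
  have [l' [g [Hg [-> ->]]]] : exists l' (g : M s * env M (fam_ctx k l') -> env M (fam_ctx k' l)), pm M g /\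
      fam1 k' l = g (e, fam1 k l') /\ fam2 k' l = g (e', fam2 k l').
    elim: {f Hf} l => [|[i|] l [l' [g [Hg [E1 E2]]]]] /=.
    - by exists [], (fun _ => tt); split; first exact: pm_tt.
    - exists (i :: l'), (fun t : M s * env M (projT1 (k i) :: fam_ctx k l') =>
        (lookup (var0 (projT1 (k i)) (fam_ctx k l')) (snd t), g (fst t, pull (fun s v => varS (projT1 (k i)) v) (snd t)))).
      have pull_tail d : pull (fun s v => varS (projT1 (k i)) v) d = snd d :> env M (fam_ctx k l').
        by apply: pull_eq.
      split; last by rewrite !pull_tail E1 E2.
      apply: pm_cons; first by apply: pm_lookup; pm_tac.
      apply: (pm_comp (f := fun t : M s * env M (projT1 (k i) :: fam_ctx k l') =>
        (fst t, pull (fun s v => varS (projT1 (k i)) v) (snd t)))) Hg.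
      by apply: pm_pair; [pm_tac|apply: pm_pull; pm_tac].
    - exists l', (fun t => (fst t, g t)); split; last by rewrite E1 E2.
      by apply: pm_cons; pm_tac.
  have [i Hi] : exists i : Fm (s :: (fam_ctx k l' ++ map inl G')), forall t : M s * (env M (fam_ctx k l') * env U G'),
      Q (f (g (fst t, fst (snd t)), snd (snd t))) <-> fm _ i (enc _ _ t).
    have [phi Hphi] : zd M (fun t : M s * (env M (fam_ctx k l') * env U G') =>
        Q (f (g (fst t, fst (snd t)), snd (snd t)))).
      apply: (zd_comp (f := fun t => f (g (fst t, fst (snd t)), snd (snd t))) HQ).
      apply: (pm_comp (f := fun t => (g (fst t, fst (snd t)), snd (snd t)))) Hf.
      apply: pm_pair; last by pm_tac.
      by apply: (pm_comp (f := fun t => (fst t, fst (snd t)))) Hg; pm_tac.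
    have [|i Hi] := fm_all (s :: (fam_ctx k l' ++ map inl G')) (fun z => sat phi z); first by exists phi.
    by exists i => t; rewrite Hphi Hi.
  have Hj := He' (existT _ l' (existT _ G' i)).
  have H1 := Hi (e, (fam1 k l', u)); have H2 := Hi (e', (fam2 k l', u)).
  move: H1 H2 => /= -> ->.
  have := HD (existT _ l' (existT _ G' i)) => -[_ /(_ u) H3].
  have := Hj u; rewrite /P /= in H3 * => H4.
  by rewrite H4 -H3.
(* Without a common solution, compactness gives finitely many indices that already have none; but
   [e] solves the same conditions over the domain, and elementarity transports the existence of a
   solution. *)
exfalso.
have [||l Hl] := compactness (@cnat_inj L) (@cpair_inj L) small_Phi (proj1 HX)
  (RY := Rep_car M s) (Q := fun j x => ~ T j (fam2 k (projT1 j)) x) HJ.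
- move=> j; apply: pdef_not.
  exact: (pdef_intro (Q := fun x w => forall u, P j (x, (fst w, u)) <-> snd (projT2 (D j)) (u, snd w))
    (w := (fam2 k (projT1 j), fst (projT2 (D j)))) (HT j)).
- move=> x; apply: NNPP => H; apply: Hno; exists x => j; apply: NNPP => H'; apply: H; by exists j.
have [||x Hx] := transfers_ex (P1 := fun x => forall j, In j l -> T j (fam1 k (projT1 j)) x)
    (P2 := fun x => forall j, In j l -> T j (fam2 k (projT1 j)) x) Hel.
- apply: transfers_list => j.
  exists (fam_ctx k (projT1 j) ++ map inl (projT1 (D j))),
    (env_app (fam1 k (projT1 j)) (to_exp X (fst (projT2 (D j))))),
    (env_app (fam2 k (projT1 j)) (to_exp X (fst (projT2 (D j))))),
    (fun t => forall u, P j (fst t, (eleft (snd t), u)) <->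
       snd (projT2 (D j)) (u, of_exp (eright (snd t)))).
  split; [|split; [|split]].
  + apply: related_app; first by apply: related_fam => i; right; exists i.
    by apply: related_old => t Ht; left.
  + apply: (zd_comp (f := fun t : M s * env M (fam_ctx k (projT1 j) ++ map inl (projT1 (D j))) =>
      (fst t, (eleft (snd t), (of_exp (eright (snd t)) : env U (projT1 (D j)))))) (HT j)).
    apply: pm_pair; first by pm_tac.
    apply: pm_pair; first by apply: pm_pull; pm_tac.
    have [r Hr] : pm M (fun t : M s * env M (fam_ctx k (projT1 j) ++ map inl (projT1 (D j))) => eright (snd t)).
      by apply: pm_pull; pm_tac.
    exists r => t; rewrite -Hr /=; exact: (lift_unlift (j := inl) (M := M)).
  + by move=> x; rewrite /T /= eleft_app eright_app /of_exp /to_exp unlift_lift.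
  + by move=> x; rewrite /T /= eleft_app eright_app /of_exp /to_exp unlift_lift.
- by exists e => j _ u; rewrite (proj2 (HD j)).
by have [j [Hj]] := Hl x; apply; exact: Hx.
Qed.

Lemma extend_map_back (K : Type) (k : K -> pairs M) s (e : M s) :
  card_lt K (points M) -> partial_elementary (with_old k) ->
  exists e', partial_elementary (fun t => with_old k t \/ t = pt e' e).
Proof.
move=> HK Hel.
have Hold t : old_pairs (X := X) t -> old_pairs (X := X) (swap t).
  by move=> [s0 [u ->]]; exists s0, u.
have Hsw t : swap (swap t) = t :> pairs M by case: t => s0 [].
have [|e' He'] := extend_map (k := fun i => swap (k i)) e HK.
  apply: partial_elementary_swap Hel => t [/Hold H|[i ->]]; first by left.
  by right; exists i; rewrite Hsw.
exists e'; apply: partial_elementary_swap He' => t [[/Hold H|[i ->]]|->]; [by left; left| |by right].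
by left; right; exists i.
Qed.

(** * Back and forth along a well-order with small initial segments *)

Section BackAndForth.
Variables (K : Type) (k : K -> pairs M).
Hypothesis HK : card_lt K (points M).
Hypothesis Hk : partial_elementary (with_old k).

Variable lt : points M -> points M -> Prop.
Hypothesis lt_wf : well_founded lt.
Hypothesis lt_tot : forall x y, lt x y \/ x = y \/ lt y x.
Hypothesis lt_trans : forall x y z, lt x y -> lt y z -> lt x z.
Hypothesis lt_small : forall x, card_lt {y | lt y x} (points M).

Let val (b : points M) : Type := (M (projT1 b) * M (projT1 b))%type.

(* Stage [b] puts [b] in the domain and in the range. *)
Let new_pair (b : points M) (v : val b) (t : pairs M) : Prop :=
  t = pt (projT2 b) (fst v) \/ t = pt (snd v) (projT2 b).

Let before (b : points M) (rec : forall c, lt c b -> val c) (t : pairs M) : Prop :=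
  with_old k t \/ exists c (h : lt c b), new_pair (rec c h) t.

Let val_inhabited b : inhabited (val b).
Proof. by case: (car_inhabited M (projT1 b)) => x; exact: (inhabits (x, x)). Qed.

(** Choosing with [epsilon] lets the recursion be defined before any stage is known to be
    elementary; the specification is used afterwards, by induction. *)
Let step (b : points M) (rec : forall c, lt c b -> val c) : val b :=
  epsilon (val_inhabited b) (fun v => partial_elementary (fun t => before rec t \/ new_pair v t)).

Let F : forall b, val b := Fix lt_wf val step.

Let stage (b : points M) : pairs M -> Prop := before (b := b) (fun c _ => F c).

Let F_eq b : F b = step (fun c (_ : lt c b) => F c).
Proof.
apply: (Fix_eq lt_wf val step) => c f g H; congr step.
apply: functional_extensionality_dep => x; apply: functional_extensionality_dep => h; exact: H.
Qed.

(** The pairs added before [b], two for each earlier point, form a small family because initial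
    segments are small. The map is then extended twice, forwards and backwards. *)
Let stage_step b : partial_elementary (stage b) ->
  partial_elementary (fun t => stage b t \/ new_pair (F b) t).
Proof.
move=> Hb; rewrite F_eq; apply: (epsilon_spec (val_inhabited b)
  (fun v => partial_elementary (fun t => stage b t \/ new_pair v t))).
pose K1 := (K + {c | lt c b} * bool)%type.
pose k1 (i : K1) : pairs M := match i with
  | inl i => k i
  | inr (c, true) => pt (projT2 (proj1_sig c)) (fst (F (proj1_sig c)))
  | inr (c, false) => pt (snd (F (proj1_sig c))) (projT2 (proj1_sig c)) end.
have Hstage t : stage b t <-> with_old k1 t.
  split=> [[[H|[i ->]]|[c [h [->|->]]]]|[H|[[i|[[c h] []]] ->]]].
  - by left.
  - by right; exists (inl i).
  - by right; exists (inr (exist _ c h, true)).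
  - by right; exists (inr (exist _ c h, false)).
  - by left; left.
  - by left; right; exists i.
  - by right; exists c, h; left.
  - by right; exists c, h; right.
have bool_small : card_lt bool (points M).
  by apply: small_le s_nat; exists (fun b : bool => if b then 1 else 0) => -[] [].
have HK1 : card_lt K1 (points M) by apply: s_sum => //; exact: s_prod.
have [|e1 He1] := extend_map (k := k1) (projT2 b) HK1.
  by apply: partial_elementary_sub Hb => t /Hstage.
pose K2 := option K1; pose k2 (i : K2) := match i with Some i => k1 i | None => pt (projT2 b) e1 end.
have HK2 : card_lt K2 (points M).
  apply: small_le (s_list HK1).
  by exists (fun i => match i with Some i => [i] | None => [] end) => -[x|] [y|] // [->].
have [|e2 He2] := extend_map_back (k := k2) (projT2 b) HK2.
  apply: partial_elementary_sub He1 => t [H|[[i|] ->]]; [by left; left| |by right].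
  by left; right; exists i.
exists (e1, e2); apply: partial_elementary_sub He2 => t [/Hstage [H|[i ->]]|[->|->]].
- by left; left.
- by left; right; exists (Some i).
- by left; right; exists None.
- by right.
Qed.

Let stage_mono b c : lt b c -> forall t, stage b t \/ new_pair (F b) t -> stage c t.
Proof.
move=> Hbc t [[H|[d [h Ht]]]|Ht]; first by left.
- by right; exists d, (lt_trans h Hbc).
- by right; exists b, Hbc.
Qed.

(** A finite tuple meets finitely many stages, and the latest of them contains the others.
    Elementarity therefore passes to unions of stages. *)
Let finite_stage (B : points M -> Prop) G (x y : env M G) :
  related (fun t => with_old k t \/ exists c, B c /\ new_pair (F c) t) x y ->
  related (with_old k) x y \/
  exists c, B c /\ related (fun t => stage c t \/ new_pair (F c) t) x y.
Proof.
elim: G x y => [|s G IH] x y /=; first by left.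
move=> [H1 /IH H2].
have H1' : with_old k (pt (fst x) (fst y)) \/
    exists c, B c /\ (stage c (pt (fst x) (fst y)) \/ new_pair (F c) (pt (fst x) (fst y))).
  by case: H1 => [H|[c [Hc H]]]; [left|right; exists c; split=> //; right].
case: H1' => [H|[c [Hc H]]]; case: H2 => [H'|[d [Hd H']]].
- by left.
- right; exists d; do !split=> //; by left; left.
- right; exists c; do !split=> //; by apply: related_sub H' => t Ht; left; left.
- case: (lt_tot c d) => [Hcd|[Hcd|Hcd]].
  + right; exists d; do !split=> //; left; exact: stage_mono Hcd _ H.
  + by subst d; right; exists c.
  + right; exists c; do !split=> //; apply: related_sub H' => t Ht; left; exact: stage_mono Hcd _ Ht.
Qed.

Let stage_elementary b : partial_elementary (stage b).
Proof.
elim/(well_founded_ind lt_wf): b => b IH G x y P Hxy.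
have [|H|[c [Hc H]]] := finite_stage (B := fun c => lt c b) (x := x) (y := y).
- by apply: related_sub Hxy => t [H|[c [h H]]]; [left|right; exists c].
- exact: Hk.
- exact: (stage_step (IH c Hc)).
Qed.

Let total (t : pairs M) : Prop := with_old k t \/ exists c, new_pair (F c) t.

Let total_elementary : partial_elementary total.
Proof.
move=> G x y P Hxy.
have [|H|[c [Hc H]]] := finite_stage (B := fun c => True) (x := x) (y := y).
- by apply: related_sub Hxy => t [H|[c H]]; [left|right; exists c].
- exact: Hk.
- exact: (@stage_step c (@stage_elementary c) G x y P H).
Qed.

Let total_iff G (x y : env M G) (P : env M G -> Prop) : related total x y -> zd M P -> (P x <-> P y).
Proof.
move=> Hxy HP; split; first exact: total_elementary.
move=> Py; apply: NNPP => nPx.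
exact: (total_elementary (P := fun z => ~ P z) Hxy (zd_not HP) nPx).
Qed.

Lemma back_and_forth : exists sigma : forall s, M s -> M s, aut_over (X := X) sigma /\
  forall i, sigma _ (fst (projT2 (k i))) = snd (projT2 (k i)).
Proof.
have Hinj s (x x' y y' : M s) : total (pt x y) -> total (pt x' y') -> (x = x' <-> y = y').
  move=> H1 H2.
  have Heq : zd M (fun e : env M [s; s] => lookup (var0 s [s]) e = lookup (varS s (var0 s [])) e).
    by apply: zd_eq; apply: pm_lookup; exact: pm_id.
  exact: (total_iff (x := (x, (x', tt)) : env M [s; s]) (y := (y, (y', tt)) : env M [s; s])
    (conj H1 (conj H2 I)) Heq).
have Hf s (x : M s) : exists y, total (pt x y).
  by exists (fst (F (existT M s x))); right; exists (existT M s x); left.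
have [f Hf'] := dep_choice (fun s => dep_choice (Hf s)).
have [g Hg'] : exists g : forall s, M s -> M s, forall s y, total (pt (g s y) y).
  apply: (dep_choice (R := fun s (g : M s -> M s) => forall y, total (pt (g y) y))) => s.
  apply: (dep_choice (R := fun y x => total (pt x y))) => y.
  by exists (snd (F (existT M s y))); right; exists (existT M s y); right.
exists f; split; last first.
  move=> i; apply: (proj1 (Hinj _ (fst (projT2 (k i))) (fst (projT2 (k i))) _ _ (Hf' _ _) _)) => //.
  by left; right; exists i; case: (k i) => s [].
split; last first.
  move=> s u; apply: (proj1 (Hinj _ (u : M (inl s)) u _ _ (Hf' _ _) _)) => //.
  by left; left; exists s, u.
apply/automorphismP; split=> [s|G phi e].
  exists (g s) => x.
  - exact: (proj2 (Hinj _ _ _ _ _ (Hg' _ _) (Hf' _ _))).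
  - exact: (proj1 (Hinj _ _ _ _ _ (Hf' _ _) (Hg' _ _))).
apply: (total_iff (P := fun e => sat phi e)); last by exists phi.
by apply/related_lookup => s v; rewrite lookup_map; exact: Hf'.
Qed.

End BackAndForth.

(** The coordinates of [y] and [z] form a finite family of pairs, and the hypothesis says exactly
    that matching them while fixing [U] is elementary; back and forth makes this map total. *)
Theorem homogeneous (Y : Type) (RY : Rep M Y) (y z : Y) :
  (forall (G : list (sort L)) (P : Y * env U G -> Prop), zd M P -> forall u, P (y, u) -> P (z, u)) ->
  exists sigma, aut_over (X := X) sigma /\ maps_to (M := M) sigma y z.
Proof.
move=> H.
pose K := {s : sort (extend N) & var (@rctx _ M Y RY) s}.
pose k (i : K) := pt (M := M) (lookup (projT2 i) (@renc _ M Y RY y)) (lookup (projT2 i) (@renc _ M Y RY z)).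
have HK : card_lt K (points M).
  apply: small_le s_nat; exists (fun i => cvar (projT2 i)) => -[s v] [s' v'] /= E; exact: cvar_inj.
have Hk : partial_elementary (with_old k).
  move=> G x x' P Hx HP.
  have [l [D [u [f [Hf [-> ->]]]]]] := related_split Hx.
  have [g [Hg [-> ->]]] : exists g : Y -> env M (fam_ctx k l), pm M g /\ fam1 k l = g y /\ fam2 k l = g z.
    elim: {f Hf} l => [|[s v] l [g [Hg [E1 E2]]]] /=.
      by exists (fun _ => tt); split; first exact: pm_tt.
    exists (fun w => (lookup v (renc M w), g w)); split; last by rewrite E1 E2.
    apply: pm_cons => //; apply: pm_lookup.
    by exists (fun s v => v) => w; rewrite pull_id.
  apply: (H D (fun t => P (f (g (fst t), snd t)))).
  apply: (zd_comp (f := fun t => f (g (fst t), snd t)) HP).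
  apply: (pm_comp (f := fun t => (g (fst t), snd t))) Hf.
  apply: pm_pair; last by pm_tac.
  by apply: (pm_comp (f := fst)) Hg; pm_tac.
have [lt [wf [tot [tr sm]]]] := initial_order (points M).
have [sigma [Hs Hsk]] := back_and_forth HK Hk wf tot tr sm.
exists sigma; split=> //; apply: env_ext => s v.
by rewrite lookup_map; exact: (Hsk (existT _ s v)).
Qed.

End Homogeneity.

(** * Admissible identifications of a fibre *)

Section Shapes.
Variables (L : lang) (U : structure L) (N : lang_ext L unit) (X : expansion U N).
Notation M := (expand X).
Notation Phi := (@formula L []).
Hypothesis HU : card_lt {G : list (sort L) & formula G} (points U).
Variables (A : zset U) (p : newsort X -> A).
Hypothesis Xcover : one_analysable_cover p.
Hypothesis Xindep : independent_fibres p.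

Notation VA := (env U (zctx A)).

Let HX : cover X := proj1 Xcover.
Let Hfg : finitely_generated X := proj1 (proj2 Xcover).

Let s_Phi : card_lt Phi (points M) := small_Phi HU.

Definition pv (x : newsort X) : VA := zval (p x).

Lemma zval_inj (B : zset U) (a b : B) : zval a = zval b -> a = b.
Proof. by move=> H; apply: eq_sig_hprop => // x u v; exact: proof_irrelevance. Qed.

Lemma pvE x a : pv x = zval a <-> p x = a.
Proof. by split=> [/zval_inj|<-]. Qed.

Lemma to_exp_inj G (e e' : env U G) : to_exp X e = to_exp X e' -> e = e'.
Proof. by move=> H; rewrite -(unlift_lift (j := inl) (M := M) e) -/(to_exp X e) H; exact: unlift_lift. Qed.

Lemma zd_pv : zd M (fun t : newsort X * VA => pv (fst t) = snd t).
Proof.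
have [_ [_ [[phi Hphi] _]]] := Xcover.
exists phi => -[x v]; rewrite -(Hphi (x, to_exp X v)); split=> [/= <-|[y [<- /to_exp_inj ->]] //].
by exists x.
Qed.

Lemma aut_pv sigma x : aut_over (X := X) sigma -> pv (sigma (inr tt) x) = pv x.
Proof.
move=> Hs.
have Hm : maps_to (M := M) sigma (x, pv x) (sigma (inr tt) x : newsort X, pv x).
  by apply: maps_to_pair => //; exact: (maps_to_old (Compat_old X (Rep_env U (zctx A)))).
exact: (proj1 (zd_aut Hs zd_pv Hm) eq_refl).
Qed.

(** Independence lifts any choice of automorphisms of the fibres: take [sigma] on the fibre at [a]
    and the identity on all others. *)
Lemma aut_local sigma a : aut_over (X := X) sigma -> exists tau, aut_over (X := X) tau /\
  (forall x, p x = a -> tau (inr tt) x = sigma (inr tt) x) /\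
  (forall x, p x <> a -> tau (inr tt) x = x).
Proof.
move=> Hs.
pose rho b : forall s, M s -> M s :=
  if excluded_middle_informative (b = a) is left _ then sigma else fun s x => x.
have Hrho b : aut_over (X := X) (rho b).
  by rewrite /rho; case: excluded_middle_informative => // _; exact: aut_over_id.
have Hp b (x : fibre p b) : p (rho b (inr tt) (proj1_sig x)) = b.
  by apply/pvE; rewrite aut_pv //; apply/pvE; exact: (proj2_sig x).
pose g b : aut_fibre p b := exist _ (fun x => exist _ _ (Hp b x))
  (ex_intro _ (rho b) (conj (Hrho b) (fun x => eq_refl))).
have [tau [Ht Hr]] := proj1 Xindep g.
exists tau; split=> //; split=> x Hx.
- have := Hr a (exist _ x Hx); rewrite /= /rho.
  by case: excluded_middle_informative.
- have := Hr (p x) (exist _ x eq_refl); rewrite /= /rho.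
  by case: excluded_middle_informative.
Qed.

Section OneShape.
Variables (H Y : Type) (RH : Rep M H) (RY : Rep M Y).
Variable chi : newsort X -> Y -> H -> Prop.
Hypothesis chi_zd : zd M (fun t : newsort X * Y * H => chi (fst (fst t)) (snd (fst t)) (snd t)).

(** This makes [chi], with parameter [b], the graph of a function [f_b] from the fibre at [v] to
    [Y], injective but not necessarily onto; its image is what becomes a set of points of the
    groupoid. *)
Definition inj_at (v : VA) (b : H) : Prop :=
  (forall x, pv x = v -> exists y, chi x y b) /\
  (forall x y y', pv x = v -> chi x y b -> chi x y' b -> y = y') /\
  (forall x x' y, pv x = v -> pv x' = v -> chi x y b -> chi x' y b -> x = x').

Definition conj_at (v : VA) (b z : H) : Prop :=
  inj_at v b /\ inj_at v z /\ exists sigma, aut_over (X := X) sigma /\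
    forall x y, pv x = v -> (chi x y b <-> chi (sigma (inr tt) x) y z).

Lemma zd_inj_at : zd M (fun t : VA * H => inj_at (fst t) (snd t)).
Proof.
rewrite /inj_at; do ?zd_step.
all: try by [apply: (zd2 (P := fun x v => pv x = v) zd_pv); pm_tac].
all: by apply: (zd3 (P := chi) chi_zd); pm_tac.
Qed.

(* The graph of [f_z^-1 f_b] on the fibre at [v], extended by the identity. *)
Definition graph_at (t : VA * H * H) (x x' : newsort X) : Prop :=
  (pv x = fst (fst t) /\ pv x' = fst (fst t) /\ exists y, chi x y (snd (fst t)) /\ chi x' y (snd t)) \/
  (pv x <> fst (fst t) /\ x = x').

(** The graph is extended to all sorts by the identity of [U]. It stays a relation, since the
    condition of being an automorphism has to be written down before it is known to be a
    function. *)
Definition graph_pairs (t : VA * H * H) (q : pairs M) : Prop :=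
  match q with
  | existT _ s xy =>
    match s return (M s * M s)%type -> Prop with
    | inl s => fun xy => fst xy = snd xy
    | inr tt => fun xy => graph_at t (fst xy) (snd xy)
    end xy
  end.

Lemma zd_graph_at : zd M (fun t : (VA * H * H) * (newsort X * newsort X) =>
  graph_at (fst t) (fst (snd t)) (snd (snd t))).
Proof.
rewrite /graph_at; do ?zd_step.
all: try by [apply: (zd2 (P := fun x v => pv x = v) zd_pv); pm_tac].
all: by apply: (zd3 (P := chi) chi_zd); pm_tac.
Qed.

Lemma zd_graph_pairs s : zd M (fun t : (VA * H * H) * (M s * M s) => graph_pairs (fst t) (existT _ s (snd t))).
Proof.
case: s => [s|[]] /=.
  have Hz : zd M (fun t : (VA * H * H) * (M (inl s) * M (inl s)) => fst (snd t) = snd (snd t)).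
    by zd_step.
  exact: Hz.
exact: zd_graph_at.
Qed.

Lemma zd_related G : zd M (fun t : (VA * H * H) * (env M G * env M G) =>
  related (graph_pairs (fst t)) (fst (snd t)) (snd (snd t))).
Proof.
elim: G => [|s G IH].
  by apply: (zd_iff_ext (P := fun _ => True)); last exact: zd_True.
have tl Z (RZ : Rep M Z) (f : Z -> env M (s :: G)) : pm M f -> pm M (fun z => snd (f z) : env M G).
  by move=> /(pm_pull (fun s' v => varS s v)) [r Hr]; exists r => z; rewrite -Hr /=; apply: esym; apply: pull_eq.
have hd Z (RZ : Rep M Z) (f : Z -> env M (s :: G)) : pm M f -> pm M (fun z => fst (f z) : M s).
  exact: (pm_lookup (var0 s G)).
apply: zd_and.
- apply: (zd_comp (f := fun t : (VA * H * H) * (env M (s :: G) * env M (s :: G)) =>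
    (fst t, (fst (fst (snd t)) : M s, fst (snd (snd t)) : M s))) (zd_graph_pairs s)).
  by apply: pm_pair; [pm_tac|apply: pm_pair; apply: hd; pm_tac].
- apply: (zd_comp (f := fun t : (VA * H * H) * (env M (s :: G) * env M (s :: G)) =>
    (fst t, (snd (fst (snd t)) : env M G, snd (snd (snd t)) : env M G))) IH).
  by apply: pm_pair; [pm_tac|apply: pm_pair; apply: tl; pm_tac].
Qed.

Definition preserves_f (t : VA * H * H) (f : fsym (extend N)) : Prop :=
  forall w w' r r', related (graph_pairs t) w w' -> graph_pairs t (pt (M := M) r r') ->
    (@fint _ M f w = r <-> @fint _ M f w' = r').
Definition preserves_r (t : VA * H * H) (q : rsym (extend N)) : Prop :=
  forall w w', related (graph_pairs t) w w' -> (@rint _ M q w <-> @rint _ M q w').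

Lemma zd_preserves_f f : zd M (fun t => preserves_f t f).
Proof.
rewrite /preserves_f; zd_step; zd_step; zd_step; zd_step; zd_step; last zd_step.
- apply: (zd_comp (f := fun t : _ * env M (farity f) * env M (farity f) * M (fres f) * M (fres f) =>
    (fst (fst (fst (fst t))), (snd (fst (fst (fst t))), snd (fst (fst t))))) (zd_related (farity f))).
  by pm_tac.
- apply: (zd_comp (f := fun t : _ * env M (farity f) * env M (farity f) * M (fres f) * M (fres f) =>
    (fst (fst (fst (fst t))), (snd (fst t), snd t))) (zd_graph_pairs (fres f))).
  by pm_tac.
- apply: zd_iff.
  + apply: (zd_comp (f := fun t : _ * env M (farity f) * env M (farity f) * M (fres f) * M (fres f) =>
      (snd (fst (fst (fst t))), snd (fst t))) (zd_fint M f)); pm_tac.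
  + apply: (zd_comp (f := fun t : _ * env M (farity f) * env M (farity f) * M (fres f) * M (fres f) =>
      (snd (fst (fst t)), snd t)) (zd_fint M f)); pm_tac.
Qed.

Lemma zd_preserves_r q : zd M (fun t => preserves_r t q).
Proof.
rewrite /preserves_r; zd_step; zd_step; zd_step.
- by apply: (zd_comp (f := fun t : _ * env M (rarity q) * env M (rarity q) =>
    (fst (fst t), (snd (fst t), snd t))) (zd_related (rarity q))); pm_tac.
- by apply: zd_iff; apply: (zd_comp (zd_rint M q)); pm_tac.
Qed.

Lemma chi_aut sigma x y b b' : aut_over (X := X) sigma -> maps_to (M := M) sigma b b' ->
  (forall y : Y, maps_to (M := M) sigma y y) -> (chi x y b <-> chi (sigma (inr tt) x) y b').
Proof.
move=> Hs Hb Hy.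
exact: (zd_aut (y := (x, y, b)) (y' := (sigma (inr tt) x : newsort X, y, b')) Hs chi_zd
  (maps_to_pair (maps_to_pair (erefl : maps_to (M := M) sigma x (sigma (inr tt) x : newsort X)) (Hy y)) Hb)).
Qed.

(** The relation is single-valued and injective by [inj_at], total and onto by assumption, hence a
    bijection that is the identity on [U]. The symbols of [L] are preserved automatically, and the
    generating new symbols suffice because every formula is equivalent to one of the sublanguage. *)
Let aut_of_graph a b z (F : fsym (extend N) -> Prop) (R : rsym (extend N) -> Prop) :
  (forall (G : list (sort (extend N))) (phi : formula G), exists psi : formula G,
     formula_in F R psi /\ forall x : env M G, sat phi x <-> sat psi x) ->
  let t := (zval a, b, z) in
  inj_at (zval a) b -> inj_at (zval a) z ->
  (forall x, exists x', graph_at t x x') -> (forall x', exists x, graph_at t x x') ->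
  (forall g, F (inr g) -> preserves_f t (inr g)) -> (forall q, R (inr q) -> preserves_r t (inr q)) ->
  exists sigma, aut_over (X := X) sigma /\
    forall x y, pv x = zval a -> (chi x y b <-> chi (sigma (inr tt) x) y z).
Proof.
move=> Hin t [b1 [b2 b3]] [z1 [z2 z3]] Htot Hsur Hf Hr.
have gfun s (x y y' : M s) : graph_pairs t (pt x y) -> graph_pairs t (pt x y') -> y = y'.
  case: s x y y' => [s|[]] x y y' /=; first by move=> <- <-.
  move=> [[/= Hx [Hy [w [w1 w2]]]]|[/= Hx <-]] [[/= Hx' [Hy' [w' [w1' w2']]]]|[/= Hx' <-]] //.
  have E : w = w' by exact: b2 w1 w1'.
  by subst w'; exact: z3 w2 w2'.
have ginj s (x x' y : M s) : graph_pairs t (pt x y) -> graph_pairs t (pt x' y) -> x = x'.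
  case: s x x' y => [s|[]] x x' y /=; first by move=> -> ->.
  move=> [[/= Hx [Hy [w [w1 w2]]]]|[/= Hx E]] [[/= Hx' [Hy' [w' [w1' w2']]]]|[/= Hx' E']]; try by subst.
  have E : w = w' by exact: z2 w2 w2'.
  by subst w'; exact: b3 w1 w1'.
have Hf1 s (x : M s) : exists y, graph_pairs t (pt x y).
  by case: s x => [s|[]] x; [exists x|exact: Htot].
have Hg1 s (y : M s) : exists x, graph_pairs t (pt x y).
  by case: s y => [s|[]] y; [exists y|exact: Hsur].
have [f Hf2] := dep_choice (fun s => dep_choice (Hf1 s)).
have [g Hg2] := dep_choice (fun s => dep_choice (Hg1 s)).
have fold s (u : U s) : f (inl s) u = u by exact: (esym (Hf2 (inl s) u)).
have unl G (w : env M (map inl G)) :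
    unlift (j := inl) (M := M) (env_map f w) = unlift (j := inl) (M := M) w.
  by elim: G w => [|s G IH] w //=; rewrite IH fold.
have frel G (w : env M G) : related (graph_pairs t) w (env_map f w).
  by apply/related_lookup => s v; rewrite lookup_map; exact: Hf2.
have fbij s : bijective (f s).
  exists (g s) => x.
  - exact: ginj (Hg2 _ _) (Hf2 _ _).
  - exact: gfun (Hf2 _ _) (Hg2 _ _).
exists f; split; last first.
  move=> x y Hx; case: (Hf2 (inr tt) x) => [[/= _ [Hfx [w [w1 w2]]]]|[/= //]].
  split=> H1; first by rewrite (b2 x y w Hx H1 w1).
  by rewrite (z2 _ y w Hfx H1 w2).
split=> //; apply/automorphismP; split=> // G phi e.
have [psi [Hpsi E]] := Hin G phi; rewrite !E.
apply: (sat_map (F := F) (R := R)) => //.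
- move=> [h|h] v Fh; first by rewrite /= unl fold.
  by apply: esym; apply: (proj1 (Hf h Fh v (env_map f v) (fint v) (f _ (fint v)) (frel _ v) (Hf2 _ _))).
- move=> [h|h] v Rh; first by rewrite /= unl.
  exact: (Hr h Rh v (env_map f v) (frel _ v)).
Qed.

Lemma zd_conj_at : exists Th : VA * H * H -> Prop, zd M Th /\
  forall a b z, Th (zval a, b, z) <-> conj_at (zval a) b z.
Proof.
have [F [R [[lf Hlf] [[lr Hlr] Hin]]]] := Hfg.
exists (fun t => (inj_at (fst (fst t)) (snd (fst t)) /\ inj_at (fst (fst t)) (snd t)) /\
  ((forall x, exists x', graph_at t x x') /\ (forall x', exists x, graph_at t x x')) /\
  (forall g, In g lf -> preserves_f t (inr g)) /\ (forall q, In q lr -> preserves_r t (inr q))).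
split.
  apply: zd_and; last apply: zd_and; last apply: zd_and.
  - by apply: zd_and; apply: (zd2 (P := inj_at) zd_inj_at); pm_tac.
  - apply: zd_and; zd_step; zd_step.
    + by apply: (zd_comp (f := fun t => (fst (fst t), (snd (fst t), snd t))) zd_graph_at); pm_tac.
    + by apply: (zd_comp (f := fun t => (fst (fst t), (snd t, snd (fst t)))) zd_graph_at); pm_tac.
  - by apply: zd_all_list => g _; exact: zd_preserves_f.
  - by apply: zd_all_list => q _; exact: zd_preserves_r.
move=> a b z; split=> /=.
  move=> [[Hb Hz] [[Htot Hsur] [Hf Hr]]]; do !split=> //.
  apply: (aut_of_graph Hin) => //.
  - by move=> g Fg; apply: Hf; exact: Hlf.
  - by move=> q Rq; apply: Hr; exact: Hlr.
move=> [Hb [Hz [sigma [Hs Hchi]]]].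
have [b1 [b2 b3]] := Hb; have [z1 [z2 z3]] := Hz.
(* The given [sigma] may move other fibres. Once localised at [a], it has [graph_at] as its graph on
   the new sort, and the conditions hold because it is an automorphism. *)
have [tau [Ht [Hin_t Hout_t]]] := aut_local a Hs.
have Hg x x' : graph_at (zval a, b, z) x x' <-> x' = tau (inr tt) x.
  split.
  - move=> [[/= Hx [Hx' [y [y1 y2]]]]|[/= Hx <-]]; last by rewrite Hout_t // => /pvE.
    rewrite Hin_t; last exact/pvE.
    apply: (z3 _ _ y Hx'); [by rewrite aut_pv|exact: y2|exact/Hchi].
  - move=> ->; case: (classic (p x = a)) => [/pvE Hx|Hx].
    + left; rewrite /= aut_pv //; do !split=> //.
      have [y Hy] := b1 x Hx; exists y; split=> //.
      by rewrite Hin_t; [exact/Hchi|exact/pvE].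
    + by right; rewrite Hout_t //; split=> // /pvE.
have Hgp s (x y : M s) : graph_pairs (zval a, b, z) (pt x y) <-> y = tau s x.
  case: s x y => [s|[]] x y; last exact: Hg.
  by rewrite (proj2 Ht) /=; split=> ->.
have Hrel G (w w' : env M G) : related (graph_pairs (zval a, b, z)) w w' -> w' = env_map tau w.
  by move=> /related_lookup Hw; apply: env_ext => s v; rewrite lookup_map; exact/Hgp.
have [_ [tauf taur]] := proj1 Ht.
have [k [_ [Hk1 Hk2]]] := aut_over_inv Ht.
split; first by [].
split; split.
- by move=> x; exists (tau (inr tt) x); exact/Hg.
- by move=> x'; exists (k (inr tt) x'); apply/Hg; rewrite Hk2.
- move=> g _ w w' r r' /Hrel -> /Hgp ->; rewrite -tauf; split=> [->|E] //.
  by rewrite -[LHS](Hk1 _ _) E Hk1.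
- by move=> q _ w w' /Hrel ->; exact: taur.
Qed.

(* By homogeneity the type of [b] over [U] implies conjugacy to [b]; compactness
   leaves a single formula with parameters in [U]. *)
Lemma isolate a (b : H) : (forall (sigma : forall s, M s -> M s) (y : Y), aut_over (X := X) sigma -> maps_to (M := M) sigma y y) ->
  inj_at (zval a) b ->
  exists (D : list (sort L)) (kappa : H * env U D -> Prop) (u : env U D), zd M kappa /\
    kappa (b, u) /\ forall z, kappa (z, u) -> conj_at (zval a) b z.
Proof.
move=> HY Hb.
have [Fm [fm [c [fm_zd [fm_all c_inj]]]]] := small_formulas Hfg.
pose J := {G : list (sort L) & Fm (@rctx _ M H RH ++ map inl G)}.
have HJ : card_lt (option J) (points M).
  apply: (small_le (Y := list (Phi * Phi))).
    exists (fun j => match j with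
      | Some j => [(clist (@csort L) (projT1 j), c _ (projT2 j))] | None => [] end).
    move=> [[G i]|] [[G' i']|] //= E.
    have E2 : clist (@csort L) G = clist (@csort L) G' by case: E.
    have E1 := clist_inj (@csort_inj L) E2; subst G'.
    have E3 : c _ i = c _ i' := f_equal (fun l => match l with (_, x) :: _ => x | _ => c _ i end) E.
    by rewrite (c_inj _ _ _ E3).
  apply: (small_list (@cnat_inj L) (@cpair_inj L) s_Phi).
  exact: (small_prod (@cnat_inj L) (@cpair_inj L) s_Phi).
pose P (j : J) (t : H * env U (projT1 j)) : Prop :=
  fm _ (projT2 j) (@renc _ M _ (Rep_prod RH (Rep_old X (Rep_env U (projT1 j)))) t).
have HP j : zd M (P j).
  by have [phi Hphi] := fm_zd _ (projT2 j); exists phi => t; rewrite /P Hphi.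
have Hdef (j : J) : exists D : {D : list (sort L) & (env U D * (env U (projT1 j) * env U D -> Prop))%type},
    zd U (snd (projT2 D)) /\
    forall u, P j (b, u) <-> snd (projT2 D) (u, fst (projT2 D)).
  by have [D [d [Psi [H1 H2]]]] := trace_def HX b (HP j); exists (existT _ D (d, Psi)).
have [D HD] := dep_choice Hdef.
pose T (j : J) (z : H) (d : env U (projT1 (D j))) : Prop :=
  forall u, P j (z, u) <-> snd (projT2 (D j)) (u, d).
have HT j : zd M (fun t : H * env U (projT1 (D j)) => T j (fst t) (snd t)).
  rewrite /T; zd_step; zd_step.
  - by apply: (zd_comp (HP j)); pm_tac.
  - by apply: (zd_comp (zd_old_pair X (proj1 (HD j)))); pm_tac.
have [Th [HTh ThE]] := zd_conj_at.
(* [Some j] covers the [z] that fail the [j]-th condition in the type of [b] over [U], and [None]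
   covers the conjugates of [b]. By homogeneity nothing is left uncovered. *)
pose Q (j : option J) (z : H) : Prop := match j with
  | Some j => ~ T j z (fst (projT2 (D j))) | None => Th (zval a, b, z) end.
have [||l Hl] := compactness (@cnat_inj L) (@cpair_inj L) s_Phi (proj1 HX) (Q := Q) HJ.
- move=> [j|].
  + apply: pdef_not; apply: (pdef_intro (Q := fun z d => T j z d) (w := fst (projT2 (D j)))) => //.
  + apply: (pdef_intro (Q := fun z w => Th (fst w, snd w, z)) (w := (zval a, b))) => //.
    by apply: (zd_comp HTh); pm_tac.
- move=> z; apply: NNPP => Hn.
  have HTz j : T j z (fst (projT2 (D j))).
    by apply: NNPP => Hj; apply: Hn; exists (Some j).
  apply: Hn; exists None; apply/ThE.
  have [|sigma [Hs Hbz]] := homogeneous HU HX Hfg (y := b) (z := z).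
    move=> G S [phi Hphi] u.
    have [|i Hi] := fm_all (@rctx _ M H RH ++ map inl G) (fun e => sat phi e); first by exists phi.
    have HS t : S t <-> P (existT _ G i) t by rewrite Hphi Hi.
    by rewrite !HS => H1; apply/HTz/(proj2 (HD (existT _ G i))).
  have Hz : inj_at (zval a) z.
    have Hm : maps_to (M := M) sigma (zval a, b) (zval a, z).
      by apply: maps_to_pair => //; exact: (maps_to_old (Compat_old X (Rep_env U (zctx A)))).
    exact: (proj1 (zd_aut Hs zd_inj_at Hm) Hb).
  do !split=> //; exists sigma; split=> // x y _.
  by apply: chi_aut => // y'; exact: HY.
(* [kappa] is the conjunction of the finitely many conditions retained, and [u] collects the
   parameters of their definitions in [U]. *)
have [E [kappa [u [Hk HkE]]]] : exists (E : list (sort L)) (kappa : H * env U E -> Prop) (u : env U E),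
    zd M kappa /\ forall z, kappa (z, u) <-> forall j, In (Some j) l -> T j z (fst (projT2 (D j))).
  elim: {Hl} l => [|j l [E [kappa [u [Hk HkE]]]]].
    by exists [], (fun _ => True), tt; split; first exact: zd_True.
  case: j => [j|]; last first.
    exists E, kappa, u; split=> // z; rewrite HkE; split=> Hz j Hj; first by case: Hj => // /Hz.
    by apply: Hz; right.
  pose W := (env U E * env U (projT1 (D j)))%type.
  exists (rctx U W), (fun t => kappa (fst t, fst (rdec U (X := W) (snd t))) /\
    T j (fst t) (snd (rdec U (X := W) (snd t)))), (renc U (u, fst (projT2 (D j)))).
  have Hdec : pm M (fun t : H * env U (rctx U W) => rdec U (X := W) (snd t)).
    apply: (pm_comp (f := snd) (RY := Rep_old X (Rep_env U (rctx U W))) (g := rdec U (X := W))); first by pm_tac.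
    have [H1 H2] : Compat (X := X) (Rep_prod (Rep_env U E) (Rep_env U (projT1 (D j)))) _ := Compat_prod (Compat_old X _) (Compat_old X _).
    apply: (pm_comp (f := rdec U (X := W)) (g := fun w => w)) H1.
    apply: pm_old; exists (fun s v => v) => e; rewrite rdecK pull_id; reflexivity.
  split.
    apply: zd_and.
    - apply: (zd_comp (f := fun t : H * env U (rctx U W) => (fst t, fst (rdec U (X := W) (snd t)))) Hk).
      by apply: pm_pair; [pm_tac|apply: pm_fst].
    - apply: (zd_comp (f := fun t : H * env U (rctx U W) => (fst t, snd (rdec U (X := W) (snd t)))) (HT j)).
      by apply: pm_pair; [pm_tac|apply: pm_snd].
  move=> z; rewrite [rdec U _](rencK (N := U) (X := W)) /= HkE; split=> [[H1 H2] i [[<-]|Hi]|Hz] //; first exact: H1.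
  by split=> [i Hi|]; apply: Hz; [right|left].
exists E, kappa, u; split=> //; split.
- by apply/HkE => j _ v; rewrite (proj2 (HD j)).
- move=> z /HkE Hz; have [[j|] [Hj Hq]] := Hl z; last exact/ThE.
  by case: Hq; exact: Hz.
Qed.
End OneShape.

(** One [chi] and one [kappa] serve all fibres over [P]; only the parameters [u] and [b] vary with
    [a]. Coordinates of [Y] and [C] are kept in both structures because case distinctions form
    products of these types. *)
Definition good (P : VA -> Prop) : Prop :=
  exists (H Y C : Type) (RH : Rep M H) (RUY : Rep U Y) (RMY : Rep M Y)
    (RUC : Rep U C) (RMC : Rep M C) (chi : newsort X -> Y -> H -> Prop) (kappa : VA -> H -> C -> Prop),
    Compat RUY RMY /\ Compat RUC RMC /\
    zd M (fun t : newsort X * Y * H => chi (fst (fst t)) (snd (fst t)) (snd t)) /\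
    zd M (fun t : VA * H * C => kappa (fst (fst t)) (snd (fst t)) (snd t)) /\
    forall a, P (zval a) -> exists u b, inj_at chi (zval a) b /\ kappa (zval a) b u /\
      forall z, kappa (zval a) z u -> conj_at chi (zval a) b z.

(** Internality at [a] gives [chi0] and isolation gives [kappa]. That the same formulas work at [v]
    is a 0-definable condition on [v], since conjugacy is expressed by [Th]. *)
Lemma good_local a : exists P, zd M P /\ good P /\ P (zval a).
Proof.
have [D [Q [h [_ [hbij [H [phi [b Hphi]]]]]]]] := proj2 (proj2 (proj2 (proj2 Xcover))) a.
pose Y := env U D.
pose chi0 (x : newsort X) (y : Y) (b' : env M H) : Prop :=
  sat (M := M) phi (env_app (G := inr tt :: map inl D) (x, to_exp X y) b').
have chi_zd : zd M (fun t : newsort X * Y * env M H => chi0 (fst (fst t)) (snd (fst t)) (snd t)).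
  by exists phi => -[[x y] b'].
have chiE x y : chi0 x y b <-> exists t : {x | p x = a}, x = proj1_sig t /\ y = proj1_sig (h t).
  rewrite /chi0 -Hphi; split=> [[t [-> /to_exp_inj ->]]|[t [-> ->]]]; by exists t.
have Hinj : inj_at chi0 (zval a) b.
  have hinj : injective h by case: hbij => k hk _; exact: can_inj hk.
  have sigE (t t' : {x | p x = a}) : proj1_sig t = proj1_sig t' -> t = t'.
    by move=> E; apply: eq_sig_hprop => // x u v; exact: proof_irrelevance.
  split; [|split].
  - move=> x /pvE Hx; exists (proj1_sig (h (exist _ x Hx))); apply/chiE.
    by exists (exist _ x Hx).
  - by move=> x y y' _ /chiE [t [E ->]] /chiE [t' [E' ->]]; rewrite (sigE t t') // -E -E'.
  - move=> x x' y _ _ /chiE [t [-> E]] /chiE [t' [-> E']].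
    have -> : t = t'; last by [].
    apply: hinj; apply: eq_sig_hprop => [z u v|]; [exact: proof_irrelevance|by rewrite -E -E'].
have [|E [kappa [u [Hk [Hkb Hkz]]]]] := isolate chi_zd _ Hinj.
  by move=> sigma y Hs; exact: (maps_to_old (Compat_old X (Rep_env U D))).
have [Th [HTh ThE]] := zd_conj_at chi_zd.
exists (fun v => exists u b, inj_at chi0 v b /\ kappa (b, u) /\ forall z, kappa (z, u) -> Th (v, b, z)).
split; [|split].
- zd_step; zd_step; apply: zd_and; last apply: zd_and.
  + by apply: (zd2 (P := inj_at chi0) (zd_inj_at chi_zd)); pm_tac.
  + by apply: (zd_comp Hk); pm_tac.
  + by zd_step; zd_step; [apply: (zd_comp Hk)|apply: (zd_comp HTh)]; pm_tac.
- exists (env M H), Y, (env U E), _, _, _, _, _, chi0, (fun v z u => kappa (z, u)).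
  split; [exact: Compat_old|split; [exact: Compat_old|split; [exact: chi_zd|split]]].
    by apply: (zd_comp Hk); pm_tac.
  move=> a' [u' [b' [H1 [H2 H3]]]]; exists u', b'; split; first exact: H1.
  by split; first exact: H2; move=> z Hz; apply/ThE; exact: H3.
- exists u, b; split; first exact: Hinj.
  by split; first exact: Hkb; move=> z Hz; apply/ThE; exact: Hkz.
Qed.

(** The first formulas are used on [P1] and the second ones off it. The coordinate of the values
    that is not in use takes a default stored in the parameter [b]; [kap] makes it agree with the
    one recorded in [u], so that all realisations share it. *)
Lemma good_union (P1 P2 : VA -> Prop) : zd M P1 -> good P1 -> good P2 -> good (fun v => P1 v \/ P2 v).
Proof.
move=> HP1 [H1 [Y1 [C1 [RH1 [RUY1 [RMY1 [RUC1 [RMC1 [chi1 [kap1 [HY1 [HC1 [Hchi1 [Hkap1 G1]]]]]]]]]]]]]].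
move=> [H2 [Y2 [C2 [RH2 [RUY2 [RMY2 [RUC2 [RMC2 [chi2 [kap2 [HY2 [HC2 [Hchi2 [Hkap2 G2]]]]]]]]]]]]]].
pose chi (x : newsort X) (y : Y1 * Y2) (b : (H1 * H2) * (Y1 * Y2)) : Prop :=
  (P1 (pv x) /\ chi1 x (fst y) (fst (fst b)) /\ snd y = snd (snd b)) \/
  (~ P1 (pv x) /\ chi2 x (snd y) (snd (fst b)) /\ fst y = fst (snd b)).
pose kap (v : VA) (b : (H1 * H2) * (Y1 * Y2)) (u : (C1 * C2) * (Y1 * Y2)) : Prop :=
  snd b = snd u /\ (P1 v -> kap1 v (fst (fst b)) (fst (fst u))) /\
  (~ P1 v -> kap2 v (snd (fst b)) (snd (fst u))).
exists ((H1 * H2) * (Y1 * Y2))%type, (Y1 * Y2)%type, ((C1 * C2) * (Y1 * Y2))%type,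
  _, _, _, _, _, chi, kap.
split; first exact: (Compat_prod HY1 HY2).
split; first exact: (Compat_prod (Compat_prod HC1 HC2) (Compat_prod HY1 HY2)).
split; [|split].
- have HPp : zd M (fun x : newsort X => P1 (pv x)).
    apply: (zd_iff_ext (P := fun x => exists v, pv x = v /\ P1 v)).
      by move=> x; split=> [[v [-> ]]|]; last by exists (pv x).
    zd_step; apply: zd_and; first by apply: (zd2 (P := fun x v => pv x = v) zd_pv); pm_tac.
    by apply: (zd_comp HP1); pm_tac.
  rewrite /chi; apply: zd_or; apply: zd_and.
  + by apply: (zd_comp HPp); pm_tac.
  + by apply: zd_and; [apply: (zd3 (P := chi1) Hchi1)|zd_step]; pm_tac.
  + by apply: zd_not; apply: (zd_comp HPp); pm_tac.
  + by apply: zd_and; [apply: (zd3 (P := chi2) Hchi2)|zd_step]; pm_tac.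
- rewrite /kap; apply: zd_and; [by zd_step|apply: zd_and; apply: zd_imp].
  + by apply: (zd_comp HP1); pm_tac.
  + by apply: (zd3 (P := kap1) Hkap1); pm_tac.
  + by apply: zd_not; apply: (zd_comp HP1); pm_tac.
  + by apply: (zd3 (P := kap2) Hkap2); pm_tac.
- move=> a Ha.
  have [b10] := Rep_inhabited RH1; have [b20] := Rep_inhabited RH2.
  have [y1] := Rep_inhabited RMY1; have [y2] := Rep_inhabited RMY2.
  have [u10] := Rep_inhabited RUC1; have [u20] := Rep_inhabited RUC2.
  case: (classic (P1 (zval a))) => [HPa|HPa].
  + have [u1 [b1 [Hb [Hk Hz]]]] := G1 a HPa.
    have chiE x y b : pv x = zval a -> (chi x y b <-> chi1 x (fst y) (fst (fst b)) /\ snd y = snd (snd b)).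
      move=> Hx; rewrite /chi Hx; split=> [[[] //|[] //]|H]; by left.
    have Hinj b : inj_at chi1 (zval a) (fst (fst b)) -> inj_at chi (zval a) b.
      move=> [I1 [I2 I3]]; split; [|split].
      * move=> x Hx; have [y Hy] := I1 x Hx; exists (y, snd (snd b)); exact/chiE.
      * move=> x [y y'] [w w'] Hx /(chiE _ _ _ Hx) /= [Hy ->] /(chiE _ _ _ Hx) /= [Hw ->].
        by rewrite (I2 x y w).
      * move=> x x' y Hx Hx' /(chiE _ _ _ Hx) [Hy _] /(chiE _ _ _ Hx') [Hy' _]; exact: I3 Hy Hy'.
    exists ((u1, u20), (y1, y2)), ((b1, b20), (y1, y2)); split; [exact: Hinj|split=> //].
    move=> [[z1 z2] w] [/= Ew [Hkz _]].
    have [_ [Hz1 [sigma [Hs Hsc]]]] := Hz z1 (Hkz HPa).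
    split; [exact: Hinj|split; [exact: Hinj|exists sigma; split=> //]].
    move=> x y Hx; rewrite !chiE ?aut_pv //= Ew; split=> -[Hc E]; split=> //; exact/Hsc.
  + have [u1 [b1 [Hb [Hk Hz]]]] : exists u b, inj_at chi2 (zval a) b /\ kap2 (zval a) b u /\
        forall z, kap2 (zval a) z u -> conj_at chi2 (zval a) b z.
      by apply: G2; case: Ha.
    have chiE x y b : pv x = zval a -> (chi x y b <-> chi2 x (snd y) (snd (fst b)) /\ fst y = fst (snd b)).
      move=> Hx; rewrite /chi Hx; split=> [[[] //|[] //]|H]; by right.
    have Hinj b : inj_at chi2 (zval a) (snd (fst b)) -> inj_at chi (zval a) b.
      move=> [I1 [I2 I3]]; split; [|split].
      * move=> x Hx; have [y Hy] := I1 x Hx; exists (fst (snd b), y); exact/chiE.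
      * move=> x [y y'] [w w'] Hx /(chiE _ _ _ Hx) /= [Hy ->] /(chiE _ _ _ Hx) /= [Hw ->].
        by rewrite (I2 x y' w').
      * move=> x x' y Hx Hx' /(chiE _ _ _ Hx) [Hy _] /(chiE _ _ _ Hx') [Hy' _]; exact: I3 Hy Hy'.
    exists ((u10, u1), (y1, y2)), ((b10, b1), (y1, y2)); split; [exact: Hinj|split=> //].
    move=> [[z1 z2] w] [/= Ew [_ Hkz]].
    have [_ [Hz1 [sigma [Hs Hsc]]]] := Hz z2 (Hkz HPa).
    split; [exact: Hinj|split; [exact: Hinj|exists sigma; split=> //]].
    move=> x y Hx; rewrite !chiE ?aut_pv //= Ew; split=> -[Hc E]; split=> //; exact/Hsc.
Qed.

Lemma good_all : exists P, good P /\ forall a, P (zval a).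
Proof.
have [||l [Hl Hcov]] := zd_compactness HU HX Hfg (C := fun Q => exists P, zd M P /\ good P /\ forall x, Q x <-> P (pv x)).
- move=> Q [P [HP [_ E]]].
  apply: (zd_iff_ext (P := fun x => exists v, pv x = v /\ P v)).
    by move=> x; rewrite E; split=> [[v [-> ]]|]; last by exists (pv x).
  zd_step; apply: zd_and; first by apply: (zd2 (P := fun x v => pv x = v) zd_pv); pm_tac.
  by apply: (zd_comp HP); pm_tac.
- move=> x; have [P [HP [G Px]]] := good_local (p x).
  by exists (fun x => P (pv x)); split=> //; exists P.
have [P [HP [G E]]] : exists P, zd M P /\ good P /\ forall Q x, In Q l -> Q x -> P (pv x).
  elim: l Hl {Hcov} => [|Q l IH] Hl.
    (* The empty set is good for any formulas; those of an arbitrary fibre are taken. *)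
    exists (fun _ => False); split; first exact: zd_False.
    split=> //.
    have [Q [_ [[H [Y [C [RH [RUY [RMY [RUC [RMC [chi [kappa [c1 [c2 [z1 [z2 _]]]]]]]]]]]]]] _]]] :=
      good_local (p (epsilon (ncar_inhabited X tt) (fun _ => True))).
    by exists H, Y, C, RH, RUY, RMY, RUC, RMC, chi, kappa.
  have [|P [HP [G E]]] := IH; first by move=> Q' H; apply: Hl; right.
  have [P' [HP' [G' E']]] := Hl Q (or_introl eq_refl).
  exists (fun v => P' v \/ P v); split; first exact: zd_or.
  split; first exact: good_union.
  by move=> Q' x [<-|HQ'] Hx; [left; exact/E'|right; exact: E Hx].
exists P; split=> // a.
have [x Hx] := proj1 (proj2 (proj2 (proj2 Xcover))) a.
have [Q [HQ Qx]] := Hcov x.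
by have := E Q x HQ Qx; rewrite /pv Hx.
Qed.

(** Only the coordinates change from [good_all]: those of [Y] and [C] are brought to the form
    inherited from [U]. *)
Lemma uniform_shape : exists (H Y C : Type) (RH : Rep M H) (RY : Rep U Y) (RC : Rep U C)
    (chi : newsort X -> Y -> H -> Prop) (kappa : VA -> H -> C -> Prop),
  zd M (fun t : newsort X * Y * H => chi (fst (fst t)) (snd (fst t)) (snd t)) /\
  zd M (fun t : VA * H * C => kappa (fst (fst t)) (snd (fst t)) (snd t)) /\
  forall a, exists u b, inj_at chi (zval a) b /\ kappa (zval a) b u /\
    forall z, kappa (zval a) z u -> conj_at chi (zval a) b z.
Proof.
have [P [[H [Y [C [RH [RUY [RMY [RUC [RMC [chi [kappa [[HY _] [[HC _] [Hchi [Hkap G]]]]]]]]]]]]]] HP]] := good_all.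
exists H, Y, C, RH, RUY, RUC, chi, kappa; split; [|split=> [|a]; last exact: G].
- clear -HY Hchi.
  have H1 : @pm _ M (newsort X * Y * H) Y
      (Rep_prod (Rep_prod (Rep_new X) (Rep_old X RUY)) RH) RMY (fun t => snd (fst t)).
    apply: (pm_comp (RY := Rep_old X RUY) (f := fun t : newsort X * Y * H => snd (fst t)) (g := fun y => y)) HY.
    by apply: (pm_snd (RZ := Rep_old X RUY)); apply: (pm_fst (RY := Rep_prod _ (Rep_old X RUY))); exact: pm_id.
  apply: (zd3 (R2 := RMY) (P := chi) (f2 := fun t : newsort X * Y * H => snd (fst t)) Hchi) => //.
  + by apply: (pm_fst (RZ := Rep_old X RUY)); apply: (pm_fst (RY := Rep_prod _ (Rep_old X RUY))); exact: pm_id.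
  + by apply: (pm_snd (RY := Rep_prod _ (Rep_old X RUY))); exact: pm_id.
- clear -HC Hkap.
  have H1 : @pm _ M (VA * H * C) C (Rep_prod (Rep_prod _ RH) (Rep_old X RUC)) RMC (fun t => snd t).
    apply: (pm_comp (RY := Rep_old X RUC) (f := fun t : VA * H * C => snd t) (g := fun y => y)) HC.
    by apply: (pm_snd (RZ := Rep_old X RUC)); exact: pm_id.
  apply: (zd3 (R3 := RMC) (P := kappa) (f3 := fun t : VA * H * C => snd t) Hkap) => //.
  + by apply: pm_fst; apply: (pm_fst (RZ := Rep_old X RUC)); exact: pm_id.
  + by apply: pm_snd; apply: (pm_fst (RZ := Rep_old X RUC)); exact: pm_id.
Qed.

End Shapes.

(** * Groupoids from torsors *)

(* The elements of [Phi i] are bijections from a fibre of [sp] to the points over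
   [i], and form a torsor under [Gam]; the morphisms from [i] to [j] are the
   composites [h' h^-1] with [h] in [Phi i] and [h'] in [Phi j]. *)
Section Torsor.
Variables (L : lang) (N : structure L) (A : Type) (GA : list (sort L)) (cA : A -> env N GA).
Variables (S : Type) (sp : S -> A) (Gam : (S -> S) -> Prop).
Variables (TO TM TP : Type) (bs : TO -> A) (sr tg : TM -> TO) (ov : TP -> TO).
Variables (ac : TM -> TP -> TP -> Prop) (Phi : TO -> (S -> TP -> Prop) -> Prop).

Record torsor : Prop := Torsor {
  sp_surj : forall a, exists x, sp x = a;
  bs_surj : forall a, exists i, bs i = a;
  gam_sp : forall g x, Gam g -> sp (g x) = sp x;
  phi_ex : forall i, exists h, Phi i h;
  phi_over : forall i h x q, Phi i h -> h x q -> sp x = bs i /\ ov q = i;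
  phi_fun : forall i h x, Phi i h -> sp x = bs i -> exists! q, h x q;
  phi_bij : forall i h q, Phi i h -> ov q = i -> exists! x, h x q;
  phi_gam : forall i h k, Phi i h -> Phi i k ->
    exists g, Gam g /\ forall x q, sp x = bs i -> (h x q <-> k (g x) q);
  gam_phi : forall i k g, Phi i k -> Gam g ->
    exists h, Phi i h /\ forall x q, sp x = bs i -> (h x q <-> k (g x) q);
  mor_phi : forall m, bs (sr m) = bs (tg m) /\ exists h h', Phi (sr m) h /\ Phi (tg m) h' /\
    forall q q', ac m q q' <-> exists x, h x q /\ h' x q';
  phi_mor : forall i j h h', bs i = bs j -> Phi i h -> Phi j h' ->
    exists m, sr m = i /\ tg m = j /\ forall q q', ac m q q' <-> exists x, h x q /\ h' x q';
  mor_ext : forall m n, sr m = sr n -> tg m = tg n -> (forall q q', ac m q q' <-> ac n q q') -> m = n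
}.

Hypothesis HT : torsor.

Lemma torsor_base_ends m : bs (sr m) = bs (tg m).
Proof. exact: (proj1 (mor_phi HT m)). Qed.

Lemma torsor_ends_surj i j : bs i = bs j -> exists m, sr m = i /\ tg m = j.
Proof.
move=> E; have [h Hh] := phi_ex HT i; have [k Hk] := phi_ex HT j.
by have [m [H1 [H2 _]]] := phi_mor HT E Hh Hk; exists m.
Qed.

Lemma torsor_over_surj i : exists q, ov q = i.
Proof.
have [h Hh] := phi_ex HT i; have [x Hx] := sp_surj HT (bs i).
have [q [Hq _]] := phi_fun HT Hh Hx; exists q; exact: (proj2 (phi_over HT Hh Hq)).
Qed.

Lemma torsor_act_over m q q' : ac m q q' -> ov q = sr m /\ ov q' = tg m.
Proof.
have [_ [h [h' [Hh [Hh' E]]]]] := mor_phi HT m.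
by move=> /E [x [/(phi_over HT Hh) [_ ->] /(phi_over HT Hh') [_ ->]]].
Qed.

Lemma torsor_act_fun m q : ov q = sr m -> exists! q', ac m q q'.
Proof.
have [Eb [h [h' [Hh [Hh' E]]]]] := mor_phi HT m.
move=> Hq; have [x [Hx Hx']] := phi_bij HT Hh Hq.
have [Hb _] := phi_over HT Hh Hx; rewrite Eb in Hb.
have [q' [Hq' Hq'']] := phi_fun HT Hh' Hb.
exists q'; split; first by apply/E; exists x.
by move=> r /E [y [/Hx' <- /Hq'' ->]].
Qed.

Lemma torsor_act_bij m q : ov q = tg m -> exists! q', ac m q' q.
Proof.
have [Eb [h [h' [Hh [Hh' E]]]]] := mor_phi HT m.
move=> Hq; have [x [Hx Hx']] := phi_bij HT Hh' Hq.
have [Hb _] := phi_over HT Hh' Hx; rewrite -Eb in Hb.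
have [q' [Hq' Hq'']] := phi_fun HT Hh Hb.
exists q'; split; first by apply/E; exists x.
by move=> r /E [y [H /Hx' Ey]]; subst y; exact: Hq''.
Qed.

(** The bijections [h'] and [k] at the middle object differ by an element [g] of the group.
    Precomposing [k'] with [g] gives [l] at the target, and the composite of the two morphisms is
    [l h^-1]. *)
Lemma torsor_comp m n : tg m = sr n -> exists r, sr r = sr m /\ tg r = tg n /\
  forall q q', ac r q q' <-> exists q'', ac m q q'' /\ ac n q'' q'.
Proof.
have [Eb [h [h' [Hh [Hh' E]]]]] := mor_phi HT m.
have [Eb2 [k [k' [Hk [Hk' E2]]]]] := mor_phi HT n.
move=> Hmn; rewrite Hmn in Hh' Eb.
have [g [Hg Eg]] := phi_gam HT Hh' Hk.
have [l [Hl El]] := gam_phi HT Hk' Hg.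
have [|r [Hr1 [Hr2 Hr]]] := phi_mor HT (i := sr m) (j := tg n) _ Hh Hl; first by rewrite Eb.
exists r; do 2 split=> //; move=> q q'; rewrite Hr; split.
- move=> [x [Hx Hx']]; have [Hb _] := phi_over HT Hh Hx.
  rewrite El in Hx'; last by rewrite Hb Eb Eb2.
  have [|w [Hw _]] := phi_fun HT Hh' (x := x); first by rewrite Hb.
  exists w; split; [by apply/E; exists x|apply/E2; exists (g x); split=> //].
  by apply/Eg => //; rewrite Hb.
- move=> [w [/E [x [Hx Hw]] /E2 [y [Hy Hy']]]]; exists x; split=> //.
  have [Hb _] := phi_over HT Hh Hx.
  apply/El; first by rewrite Hb Eb Eb2.
  have Hgx : k (g x) w by apply/Eg => //; rewrite Hb.
  have [z [_ Hz]] := phi_bij HT Hk (proj2 (phi_over HT Hk Hy)).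
  by rewrite -(Hz _ Hgx) (Hz _ Hy).
Qed.

Lemma torsor_inv m : exists n, sr n = tg m /\ tg n = sr m /\ forall q q', ac n q' q <-> ac m q q'.
Proof.
have [Eb [h [h' [Hh [Hh' E]]]]] := mor_phi HT m.
have [n [H1 [H2 H3]]] := phi_mor HT (esym Eb) Hh' Hh.
by exists n; do 2 split=> //; move=> q q'; rewrite H3 E; split=> -[x [? ?]]; exists x.
Qed.

Variables (ZO ZM ZP : zset N).
Variables (kO : TO -> ZO) (uO : ZO -> TO) (kM : TM -> ZM) (uM : ZM -> TM) (kP : TP -> ZP) (uP : ZP -> TP).
Hypotheses (kOK : cancel kO uO) (uOK : cancel uO kO) (kMK : cancel kM uM) (uMK : cancel uM kM).
Hypotheses (kPK : cancel kP uP) (uPK : cancel uP kP).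
Hypothesis d_base : zero_definable (image (fun i : TO => env_app (zval (kO i)) (cA (bs i)))).
Hypothesis d_ends : zero_definable
  (image (fun m => env_app (zval (kM m)) (env_app (zval (kO (sr m))) (zval (kO (tg m)))))).
Hypothesis d_over : zero_definable (image (fun q => env_app (zval (kP q)) (zval (kO (ov q))))).
Hypothesis d_act : zero_definable (fun z => exists m q q', ac m q q' /\
  z = env_app (zval (kM m)) (env_app (zval (kP q)) (zval (kP q')))).

(** The torsor lives on abstract types, and [kO], [kM], [kP] carry it to 0-definable sets. They are
    identities for the family in [U] and codings by classes for the family in [(U')^eq]. *)
Definition torsor_groupoid : groupoid_family cA.
Proof.
refine (@GroupoidFamily L N A GA cA ZO ZM ZP (fun i => bs (uO i)) (fun m => kO (sr (uM m)))
  (fun m => kO (tg (uM m))) (fun q => kO (ov (uP q))) (fun m q q' => ac (uM m) (uP q) (uP q'))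
  _ _ _ _ _ _ _ _ _ _ _ _ _ _).
- case: d_base => phi H; exists phi => z; rewrite -H; split=> [[i ->]|[i ->]].
  + by exists (uO i); rewrite uOK.
  + by exists (kO i); rewrite kOK.
- case: d_ends => phi H; exists phi => z; rewrite -H; split=> [[m ->]|[m ->]].
  + by exists (uM m); rewrite uMK.
  + by exists (kM m); rewrite kMK.
- case: d_over => phi H; exists phi => z; rewrite -H; split=> [[q ->]|[q ->]].
  + by exists (uP q); rewrite uPK.
  + by exists (kP q); rewrite kPK.
- case: d_act => phi H; exists phi => z; rewrite -H; split=> [[m [q [q' [Ha ->]]]]|[m [q [q' [Ha ->]]]]].
  + by exists (uM m), (uP q), (uP q'); rewrite uMK !uPK.
  + by exists (kM m), (kP q), (kP q'); rewrite kMK !kPK.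
- by move=> a; have [i Hi] := bs_surj HT a; exists (kO i); rewrite kOK.
- by move=> m; rewrite !kOK; exact: torsor_base_ends.
- move=> i j /torsor_ends_surj [m [H1 H2]]; exists (kM m); rewrite kMK H1 H2; by split.
- by move=> i; have [q Hq] := torsor_over_surj (uO i); exists (kP q); rewrite kPK Hq uOK.
- by move=> m q q' /torsor_act_over [-> ->].
- move=> m q /(f_equal uO); rewrite !kOK => /torsor_act_fun [q' [H1 H2]].
  by exists (kP q'); split=> [|r /H2 ->]; rewrite ?kPK.
- move=> m q /(f_equal uO); rewrite !kOK => /torsor_act_bij [q' [H1 H2]].
  by exists (kP q'); split=> [|r /H2 ->]; rewrite ?kPK.
- move=> m n /(f_equal uO); rewrite !kOK => H1 /(f_equal uO); rewrite !kOK => H2 H3.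
  rewrite -(uMK m) -(uMK n); congr kM; apply: (mor_ext HT) => // q q'.
  by have := H3 (kP q) (kP q'); rewrite !kPK.
- move=> m n /(f_equal uO); rewrite !kOK => /torsor_comp [r [H1 [H2 H3]]].
  exists (kM r); rewrite kMK H1 H2; do 2 split=> //; move=> q q'; rewrite H3.
  split=> [[w Hw]|[w Hw]]; first by exists (kP w); rewrite kPK.
  by exists (uP w).
- move=> m; have [n [H1 [H2 H3]]] := torsor_inv (uM m).
  exists (kM n); rewrite kMK H1 H2; do 2 split=> //; move=> q q'; exact: H3.
Defined.

(** A finite list that determines the action of group elements on the fibre is carried by some [h0]
    to the points over [i]. A morphism [h' h^-1] from [i] to itself, where [h] and [h'] differ from
    [h0] by [g] and [g'], fixes [h0 x] exactly when [g x = g' x]. *)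
Lemma torsor_faithful : (forall a, exists l, (forall x, In x l -> sp x = a) /\
    forall g g', Gam g -> Gam g' -> (forall x, In x l -> g x = g' x) -> forall x, sp x = a -> g x = g' x) ->
  finitely_faithful torsor_groupoid.
Proof.
move=> Hfin i; have [l [Hl Hg]] := Hfin (bs (uO i)).
have [h0 H0] := phi_ex HT (uO i).
have [l' [Hl1 Hl2]] : exists l' : list ZP, (forall q, In q l' -> kO (ov (uP q)) = i) /\
    forall x, In x l -> exists q, In q l' /\ h0 x (uP q).
  elim: l Hl {Hg} => [|x l IH] Hl; first by exists [].
  have [|l' [H1 H2]] := IH; first by move=> y Hy; apply: Hl; right.
  have [q [Hq _]] := phi_fun HT H0 (Hl x (or_introl erefl)).
  exists (kP q :: l'); split=> [r [<-|/H1] //|y [<-|/H2 [r [Hr1 Hr2]]]].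
  - by rewrite kPK (proj2 (phi_over HT H0 Hq)) uOK.
  - by exists (kP q); split; [left|rewrite kPK].
  - by exists r; split; [right|].
exists l'; split=> //= m /(f_equal uO); rewrite kOK => Hs /(f_equal uO); rewrite kOK => Ht Hfix q /(f_equal uO).
rewrite kOK => Hq.
have [_ [h [h' [Hh [Hh' E]]]]] := mor_phi HT (uM m).
rewrite Hs in Hh; rewrite Ht in Hh'.
have [g [Gg Eg]] := phi_gam HT H0 Hh; have [g' [Gg' Eg']] := phi_gam HT H0 Hh'.
have key x r : h0 x r -> (ac (uM m) r r <-> g x = g' x).
  move=> Hx; have [Hb Ho] := phi_over HT H0 Hx.
  have K : h (g x) r by apply/Eg.
  have K' : h' (g' x) r by apply/Eg'.
  rewrite E; split=> [[y [Hy Hy']]|Exy]; last by exists (g x); split=> //; rewrite Exy.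
  have [z [_ Hz]] := phi_bij HT Hh Ho; have [z' [_ Hz']] := phi_bij HT Hh' Ho.
  by rewrite -(Hz _ K) -(Hz' _ K') (Hz _ Hy) (Hz' _ Hy').
have [x [Hx _]] := phi_bij HT H0 Hq.
apply/(key x) => //; apply: Hg => // [y Hy|]; last exact: (proj1 (phi_over HT H0 Hx)).
by have [r [Hr1 Hr2]] := Hl2 y Hy; apply/(key y (uP r)) => //; exact: Hfix.
Qed.

End Torsor.

(** * Zero-definable sets from predicates *)

Section ZsetOf.
Variables (L : lang) (N : structure L) (T : Type) (RT : Rep N T) (P : T -> Prop) (HP : zd N P).

Lemma zset_of_def : zero_definable (fun e : env N (rctx N T) => P (rdec N e)).
Proof. by have [phi Hphi] := HP; exists phi => e; rewrite Hphi rdecK. Qed.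

Definition zset_of : zset N := ZSet zset_of_def.

(* [tval] and [zmk] are defined by choice so that they do not reduce. *)
Lemma tval_ex (z : zset_of) : exists t, P t /\ zval z = renc N t.
Proof. by exists (rdec N (zval z)); split; [exact: (proj2_sig z)|rewrite rdecK]. Qed.

Definition tval (z : zset_of) : T :=
  proj1_sig (constructive_indefinite_description _ (tval_ex z)).

Lemma tvalP (z : zset_of) : P (tval z).
Proof. exact: (proj1 (proj2_sig (constructive_indefinite_description _ (tval_ex z)))). Qed.

Lemma zval_tval (z : zset_of) : zval z = renc N (tval z).
Proof. exact: (proj2 (proj2_sig (constructive_indefinite_description _ (tval_ex z)))). Qed.

Lemma tval_inj (z z' : zset_of) : tval z = tval z' -> z = z'.
Proof. by move=> E; apply: zval_inj; rewrite !zval_tval E. Qed.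

Lemma zset_mk (t : T) : P t -> exists z : zset_of, tval z = t.
Proof.
move=> Ht; have Ht' : P (rdec N (renc N t)) by rewrite rencK.
exists (exist _ (renc N t) Ht'); apply: renc_inj; exact: esym (zval_tval _).
Qed.

Definition zmk (t : T) (Ht : P t) : zset_of :=
  proj1_sig (constructive_indefinite_description _ (zset_mk Ht)).

Lemma tval_mk (t : T) (Ht : P t) : tval (zmk Ht) = t.
Proof. exact: (proj2_sig (constructive_indefinite_description _ (zset_mk Ht))). Qed.

End ZsetOf.

Lemma zero_definable_rep (L : lang) (N : structure L) (T : Type) (RT : Rep N T)
    (P : env N (rctx N T) -> Prop) : zd N (fun t => P (renc N t)) -> zero_definable P.
Proof. by move=> [phi Hphi]; exists phi => z; rewrite -(rdecK z) -Hphi. Qed.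

Lemma zero_definable_image2 (L : lang) (N : structure L) (T1 T2 I : Type) (R1 : Rep N T1) (R2 : Rep N T2)
    (f : I -> env N (rctx N T1)) (g : I -> env N (rctx N T2)) (P : T1 * T2 -> Prop) :
  zd N P -> (forall t1 t2, P (t1, t2) <-> exists i, renc N t1 = f i /\ renc N t2 = g i) ->
  zero_definable (image (fun i => env_app (f i) (g i))).
Proof.
move=> HP E; apply: (zero_definable_rep (RT := Rep_prod R1 R2)); apply: zd_iff_ext HP => -[t1 t2].
rewrite E; split=> [[i [E1 E2]]|[i /env_app_inj [E1 E2]]]; exists i => //.
exact: (f_equal2 (@env_app _ N _ _) E1 E2).
Qed.

Lemma zero_definable_image3 (L : lang) (N : structure L) (T1 T2 T3 I : Type)
    (R1 : Rep N T1) (R2 : Rep N T2) (R3 : Rep N T3) (f : I -> env N (rctx N T1))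
    (g : I -> env N (rctx N T2)) (h : I -> env N (rctx N T3)) (P : T1 * (T2 * T3) -> Prop) :
  zd N P -> (forall t1 t2 t3, P (t1, (t2, t3)) <->
    exists i, renc N t1 = f i /\ renc N t2 = g i /\ renc N t3 = h i) ->
  zero_definable (image (fun i => env_app (f i) (env_app (g i) (h i)))).
Proof.
move=> HP E.
apply: (zero_definable_image2 (R2 := Rep_prod R2 R3) (g := fun i => env_app (g i) (h i)) HP) => t1 [t2 t3].
rewrite E; split=> [[i [E1 [E2 E3]]]|[i [E1 /env_app_inj [E2 E3]]]]; exists i => //.
split=> //; exact: (f_equal2 (@env_app _ N _ _) E2 E3).
Qed.

Lemma zero_definable_rel3 (L : lang) (N : structure L) (T1 T2 T3 I1 I2 I3 : Type)
    (R1 : Rep N T1) (R2 : Rep N T2) (R3 : Rep N T3) (f : I1 -> env N (rctx N T1))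
    (g : I2 -> env N (rctx N T2)) (h : I3 -> env N (rctx N T3)) (Q : I1 -> I2 -> I3 -> Prop)
    (P : T1 * (T2 * T3) -> Prop) :
  zd N P -> (forall t1 t2 t3, P (t1, (t2, t3)) <->
    exists i j k, Q i j k /\ renc N t1 = f i /\ renc N t2 = g j /\ renc N t3 = h k) ->
  zero_definable (fun z => exists i j k, Q i j k /\ z = env_app (f i) (env_app (g j) (h k))).
Proof.
move=> HP E.
pose I := {t : I1 * I2 * I3 | Q (fst (fst t)) (snd (fst t)) (snd t)}.
have [|phi Hphi] := zero_definable_image3 (f := fun t : I => f (fst (fst (proj1_sig t))))
  (g := fun t : I => g (snd (fst (proj1_sig t)))) (h := fun t : I => h (snd (proj1_sig t))) HP.
  move=> t1 t2 t3; rewrite E; split=> [[i [j [k [Hq Ht]]]]|[[[[i j] k] Hq] Ht]]; last by exists i, j, k.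
  by exists (exist _ (i, j, k) Hq).
exists phi => z; rewrite -Hphi; split=> [[i [j [k [Hq ->]]]]|[[[[i j] k] Hq] ->]]; last by exists i, j, k.
by exists (exist _ (i, j, k) Hq).
Qed.

(** * Uniform definitions and elimination of imaginaries *)

Section Uniform.
Variables (L : lang) (U : structure L) (N : lang_ext L unit) (X : expansion U N).
Notation M := (expand X).
Hypothesis HU : card_lt {G : list (sort L) & formula G} (points U).
Hypothesis HX : cover X.
Hypothesis Hfg : finitely_generated X.

(** If every sort had a single element, sending it to a formula that determines its sort would
    inject the points of [U] into the formulas. The two elements serve to code disjoint unions. *)
Lemma two_elements : exists (s : sort L) (x y : U s), x <> y.
Proof.
apply: NNPP => Hn; apply: HU.
exists (fun t : points U => existT _ [] (@csort L (projT1 t))) => -[s x] [s' y] E.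
have {}E := csort_inj (inj_pair2 _ _ _ _ _ E); move: E => /= E; subst s'.
by congr existT; apply: NNPP => H; apply: Hn; exists s, x, y.
Qed.

(** Elimination of imaginaries is applied to the relation of defining the same subset of [W] through
    [Psi], so that the function obtained sends [e] to a canonical parameter of that subset. *)
Lemma elim_code (T : theory L) (Tei : elim_imaginaries T) (UT : models T U) (W E : Type)
    (RW : Rep U W) (RE : Rep U E) (Psi : W * E -> Prop) : zd U Psi ->
  exists (K : list (sort L)) (f : E -> env U K), zd U (fun t : E * env U K => f (fst t) = snd t) /\
    forall e e', f e = f e' <-> forall w, Psi (w, e) <-> Psi (w, e').
Proof.
move=> [psi Hpsi].
pose GW := @rctx _ U W RW; pose GE := @rctx _ U E RE.
pose r1 : ren (GW ++ GE) (GW ++ (GE ++ GE)) :=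
  ren_split (fun s v => vleft _ v) (fun s v => vright GW (vleft GE v)).
pose r2 : ren (GW ++ GE) (GW ++ (GE ++ GE)) :=
  ren_split (fun s v => vleft _ v) (fun s v => vright GW (vright GE v)).
pose phi : formula (GE ++ GE) := all_ctx (D := GW) (fiff (fren psi r1) (fren psi r2)).
have Hphi (M0 : structure L) (x y : env M0 GE) : rel_of phi x y <->
    forall d : env M0 GW, sat psi (env_app d x) <-> sat psi (env_app d y).
  have pull_l d : pull (fun s v => vright GW (vleft GE v)) (env_app d (env_app x y)) = x.
    by apply: pull_eq => s v; rewrite lookup_vright lookup_vleft.
  have pull_r d : pull (fun s v => vright GW (vright GE v)) (env_app d (env_app x y)) = y.
    by apply: pull_eq => s v; rewrite !lookup_vright.
  rewrite /rel_of /phi sat_all_ctx; split=> H d; move: (H d); rewrite sat_fiff !sat_ren !pull_split.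
  - by rewrite -/(eleft _) eleft_app pull_l pull_r.
  - by rewrite -/(eleft _) eleft_app pull_l pull_r.
have [|D [psi' H]] := Tei GE phi.
  move=> M0 _; split.
  - by move=> x; apply/Hphi.
  - by move=> x y /Hphi Hxy; apply/Hphi => d; rewrite Hxy.
  - by move=> x y z /Hphi Hxy /Hphi Hyz; apply/Hphi => d; rewrite Hxy.
have [f [Hf1 Hf2]] := H U UT.
exists D, (fun e => f (renc U e)); split.
  by exists psi' => -[e k] /=; rewrite -Hf1.
move=> e e'; rewrite -Hf2 Hphi; split=> H' w; first by rewrite !Hpsi; exact: H'.
by move: (H' (rdec U w)); rewrite !Hpsi /= rdecK.
Qed.

(** Each trace is definable in [U] by stable embeddedness, and by compactness finitely many formulas
    suffice for all [y]. They are merged with a pair of elements of the sort [s0] as a switch: equal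
    selects the first formula, distinct the second. *)
Lemma uniform_trace (Y W : Type) (RY : Rep M Y) (RW : Rep U W) (RMW : Rep M W) (HC : Compat RW RMW)
    (Q : Y * W -> Prop) : zd M Q ->
  exists (E : Type) (RE : Rep U E) (Psi : W * E -> Prop), zd U Psi /\
    forall y, exists e, forall w, Q (y, w) <-> Psi (w, e).
Proof.
move=> HQ.
have HQ' : @zd _ M _ (Rep_prod RY (Rep_old X RW)) Q.
  case: HC => H1 H2; apply: (zd_iff_ext (P := fun t => Q (fst t, snd t))); first by case.
  apply: (zd_comp (f := fun t => (fst t, snd t)) HQ).
  apply: (pm_pair (RY := RY)); first by apply: (pm_fst (RZ := Rep_old X RW)); exact: pm_id.
  by apply: (pm_comp (RY := Rep_old X RW) (f := snd) (g := fun y => y)) H1; apply: (pm_snd (RZ := Rep_old X RW)); exact: pm_id.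
move: HQ' => {HC RMW} {}HQ.
pose covers (E : Type) (RE : Rep U E) (Psi : W * E -> Prop) y := exists e, forall w, Q (y, w) <-> Psi (w, e).
pose C (P : Y -> Prop) : Prop := exists (E : Type) (RE : Rep U E) (Psi : W * E -> Prop),
  @zd _ U _ (Rep_prod RW RE) Psi /\ forall y, P y <-> covers E RE Psi y.
have [||l [Hl Hcov]] := zd_compactness HU HX Hfg (RY := RY) (C := C).
- move=> P [E [RE [Psi [HPsi HP]]]]; apply: zd_iff_ext (fun y => iff_sym (HP y)) _.
  rewrite /covers; zd_step; zd_step; apply: zd_iff.
  + by apply: (zd_comp HQ); pm_tac.
  + by apply: (zd_comp (zd_old_pair X HPsi)); pm_tac.
- move=> y; have [D [c [Psi [HPsi E]]]] := trace_def HX y HQ.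
  exists (covers (env U D) _ Psi); split; last by exists c.
  by exists (env U D), _, Psi.
have [s0 [a [b Hab]]] := two_elements.
have [E [RE [Psi [HPsi HE]]]] : exists (E : Type) (RE : Rep U E) (Psi : W * E -> Prop),
    zd U Psi /\ forall P y, In P l -> P y -> covers E RE Psi y.
  elim: l Hl {Hcov} => [|P l IH] Hl.
    by exists unit, _, (fun _ => True); split; first exact: zd_True.
  have [|E1 [RE1 [Psi1 [H1 C1]]]] := IH; first by move=> P' HP'; apply: Hl; right.
  have [E2 [RE2 [Psi2 [H2 C2]]]] := Hl P (or_introl eq_refl).
  have [e10] := Rep_inhabited RE1; have [e20] := Rep_inhabited RE2.
  exists (E1 * E2 * (U s0 * U s0))%type, _, (fun t =>
    (fst (snd (snd t)) = snd (snd (snd t)) /\ Psi1 (fst t, fst (fst (snd t)))) \/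
    (fst (snd (snd t)) <> snd (snd (snd t)) /\ Psi2 (fst t, snd (fst (snd t))))).
  split.
    apply: zd_or; apply: zd_and.
    + by zd_step.
    + by apply: (zd_comp H1); pm_tac.
    + by apply: zd_not; zd_step.
    + by apply: (zd_comp H2); pm_tac.
  move=> P' y [<-|HP'] Hy.
    move/C2: Hy => [e He]; exists (e10, e, (a, b)) => w /=; rewrite He.
    by split=> [H|[[]|[]]] //; right.
  have [e He] := C1 P' y HP' Hy; exists (e, e20, (a, a)) => w /=; rewrite He.
  by split=> [H|[[]|[[]]]] //; left.
exists E, RE, Psi; split=> // y; have [P [HP Py]] := Hcov y; exact: HE HP Py.
Qed.

End Uniform.

(** * Definability in the imaginary sorts, read on representatives *)

Section Coded.
Variables (L : lang) (M : structure L).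
Notation Meq := (expand (eq_expansion M)).

(** [d r t] says that [r] in [M] represents [t], which may have many representatives, and [k t] is
    the name of [t] in [M^eq]. Since passing from representatives to names is 0-definable, maps and
    relations need only be described in [M]. *)
Definition coded (T R E : Type) (RR : Rep M R) (RE : Rep Meq E) (d : R -> T -> Prop)
    (k : T -> env Meq (rctx Meq E)) : Prop :=
  (forall t, exists r, d r t) /\
  zd Meq (fun q : R * E => exists t, d (fst q) t /\ renc Meq (snd q) = k t).

Arguments coded {T R E} RR RE d k.

Lemma coded_val (T R : Type) (RR : Rep M R) (v : T -> R) : zd M (fun r => exists t, r = v t) ->
  coded RR (Rep_old (eq_expansion M) RR) (fun r t => r = v t) (fun t => renc Meq (v t)).
Proof.
move=> Hv; split=> [t|]; first by exists (v t).
apply: (zd_iff_ext (P := fun q : R * R => (exists t, fst q = v t) /\ fst q = snd q)).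
  move=> [r e] /=; split=> [[[t ->] <-]|[t [-> H]]]; first by exists t.
  by split; [exists t|symmetry; apply: (renc_inj (RX := Rep_old (eq_expansion M) RR)) H].
by apply: zd_and; [apply: (zd_comp (zd_old (eq_expansion M) Hv)); pm_tac|zd_step].
Qed.

Variables (T1 R1 E1 T2 R2 E2 T3 R3 E3 : Type).
Variables (RR1 : Rep M R1) (RE1 : Rep Meq E1) (d1 : R1 -> T1 -> Prop) (k1 : T1 -> env Meq (rctx Meq E1)).
Variables (RR2 : Rep M R2) (RE2 : Rep Meq E2) (d2 : R2 -> T2 -> Prop) (k2 : T2 -> env Meq (rctx Meq E2)).
Variables (RR3 : Rep M R3) (RE3 : Rep Meq E3) (d3 : R3 -> T3 -> Prop) (k3 : T3 -> env Meq (rctx Meq E3)).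
Hypotheses (C1 : coded RR1 RE1 d1 k1) (C2 : coded RR2 RE2 d2 k2) (C3 : coded RR3 RE3 d3 k3).

Lemma coded_graph (g : T1 -> T2) (B : R1 * R2 -> Prop) : zd M B ->
  (forall r1 r2 t1 t2, d1 r1 t1 -> d2 r2 t2 -> (B (r1, r2) <-> g t1 = t2)) ->
  zero_definable (image (fun t => env_app (k1 t) (k2 (g t)))).
Proof.
move=> HB E; have [S1 D1] := C1; have [S2 D2] := C2.
apply: (zero_definable_image2 (R1 := RE1) (R2 := RE2) (f := k1) (g := fun t => k2 (g t)) (P := fun t =>
  exists r1 r2, (exists t1, d1 r1 t1 /\ renc Meq (fst t) = k1 t1) /\
    (exists t2, d2 r2 t2 /\ renc Meq (snd t) = k2 t2) /\ B (r1, r2))).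
  zd_step; zd_step; apply: zd_and.
    by apply: (zd2 (P := fun r e => exists t1, d1 r t1 /\ renc Meq e = k1 t1) D1); pm_tac.
  apply: zd_and; first by apply: (zd2 (P := fun r e => exists t2, d2 r t2 /\ renc Meq e = k2 t2) D2); pm_tac.
  by apply: (zd_comp (zd_up (Compat_prod (Compat_old _ RR1) (Compat_old _ RR2)) HB)); pm_tac.
move=> e1 e2; split=> [[r1 [r2 [[t1 [H1 K1]] [[t2 [H2 K2]] Hb]]]]|[t [K1 K2]]].
  by exists t1; split=> //; rewrite (proj1 (E _ _ _ _ H1 H2) Hb).
have [r1 H1] := S1 t; have [r2 H2] := S2 (g t).
by exists r1, r2; split; [exists t|split; [exists (g t)|apply/(E _ _ _ _ H1 H2)]].
Qed.

Lemma coded_rel3 (Q : T1 -> T2 -> T3 -> Prop) (B : R1 * (R2 * R3) -> Prop) : zd M B ->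
  (forall r1 r2 r3 t1 t2 t3, d1 r1 t1 -> d2 r2 t2 -> d3 r3 t3 -> (B (r1, (r2, r3)) <-> Q t1 t2 t3)) ->
  zero_definable (fun z => exists t1 t2 t3, Q t1 t2 t3 /\ z = env_app (k1 t1) (env_app (k2 t2) (k3 t3))).
Proof.
move=> HB E; have [S1 D1] := C1; have [S2 D2] := C2; have [S3 D3] := C3.
apply: (zero_definable_rel3 (R1 := RE1) (R2 := RE2) (R3 := RE3) (f := k1) (g := k2) (h := k3) (P := fun t =>
  exists r1 r2 r3, (exists t1, d1 r1 t1 /\ renc Meq (fst t) = k1 t1) /\
    (exists t2, d2 r2 t2 /\ renc Meq (fst (snd t)) = k2 t2) /\
    (exists t3, d3 r3 t3 /\ renc Meq (snd (snd t)) = k3 t3) /\ B (r1, (r2, r3)))).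
  zd_step; zd_step; zd_step; apply: zd_and.
    by apply: (zd2 (P := fun r e => exists t1, d1 r t1 /\ renc Meq e = k1 t1) D1); pm_tac.
  apply: zd_and; first by apply: (zd2 (P := fun r e => exists t2, d2 r t2 /\ renc Meq e = k2 t2) D2); pm_tac.
  apply: zd_and; first by apply: (zd2 (P := fun r e => exists t3, d3 r t3 /\ renc Meq e = k3 t3) D3); pm_tac.
  apply: (zd_comp (zd_up (Compat_prod (Compat_old _ RR1) (Compat_prod (Compat_old _ RR2) (Compat_old _ RR3))) HB)).
  by pm_tac.
move=> e1 e2 e3; split=> [[r1 [r2 [r3 [[t1 [H1 K1]] [[t2 [H2 K2]] [[t3 [H3 K3]] Hb]]]]]]|
    [t1 [t2 [t3 [Hq [K1 [K2 K3]]]]]]].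
  by exists t1, t2, t3; split=> //; apply/(E _ _ _ _ _ _ H1 H2 H3).
have [r1 H1] := S1 t1; have [r2 H2] := S2 t2; have [r3 H3] := S3 t3.
exists r1, r2, r3; split; first by exists t1.
split; first by exists t2.
by split; [exists t3|apply/(E _ _ _ _ _ _ H1 H2 H3)].
Qed.

Lemma coded_graph2 (g : T1 -> T2) (h : T1 -> T3) (B : R1 * (R2 * R3) -> Prop) : zd M B ->
  (forall r1 r2 r3 t1 t2 t3, d1 r1 t1 -> d2 r2 t2 -> d3 r3 t3 ->
    (B (r1, (r2, r3)) <-> g t1 = t2 /\ h t1 = t3)) ->
  zero_definable (image (fun t => env_app (k1 t) (env_app (k2 (g t)) (k3 (h t))))).
Proof.
move=> HB /(coded_rel3 HB) [phi Hphi]; exists phi => z; rewrite -Hphi.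
by split=> [[t ->]|[t [_ [_ [[<- <-] ->]]]]]; [exists t, (g t), (h t)|exists t].
Qed.

End Coded.
Arguments coded {L M T R E} RR RE d k.

Section EqCode.
Variables (L : lang) (M : structure L) (T R : Type) (RR : Rep M R) (d : R -> T -> Prop).
Hypothesis d_fun : forall r t t', d r t -> d r t' -> t = t'.
Hypothesis d_surj : forall t, exists r, d r t.
Hypothesis d_zd : zd M (fun q : R * R => exists t, d (fst q) t /\ d (snd q) t).
Notation Meq := (eq_structure M).

(** [T] is the quotient of the set of representatives by the relation of representing the same
    element, hence a set of classes in a single imaginary sort. *)
Lemma eq_code : exists (Z : zset Meq) (k : T -> Z) (u : Z -> T), cancel k u /\ cancel u k /\
  coded RR (Rep_env Meq (zctx Z)) d (fun t => zval (k t)).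
Proof.
have Ddef : zd M (fun r : R => exists t, d r t).
  apply: (zd_iff_ext (P := fun r => exists t, d r t /\ d r t)).
    by move=> r; split=> [[t [H _]]|[t H]]; exists t.
  by apply: (zd_comp (f := fun r => (r, r)) d_zd); pm_tac.
(* An imaginary sort needs an equivalence relation on a whole product of sorts, so the tuples that
   represent nothing form one extra class, which [Z] leaves out. *)
pose E0 (r r' : R) : Prop := (exists t, d r t /\ d r' t) \/ (~ (exists t, d r t) /\ ~ exists t, d r' t).
have [phi Hphi] : zd M (fun q : R * R => E0 (fst q) (snd q)).
  rewrite /E0; apply: zd_or; first exact: d_zd.
  by apply: zd_and; apply: zd_not; apply: (zd_comp Ddef); pm_tac.
have E0E r r' : rel_of (M := M) phi (renc M r) (renc M r') <-> E0 r r' by exact: iff_sym (Hphi (r, r')).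
have Heq : Equivalence (rel_of (M := M) phi).
  have H (P : env M (rctx M R) -> Prop) : (forall r, P (renc M r)) -> forall e, P e.
    by move=> HP e; rewrite -(rdecK e).
  split.
  - apply: (H) => r; apply/E0E; case: (classic (exists t, d r t)) => [[t Ht]|Hn]; [left|by right].
    by exists t.
  - apply: (H) => r; apply: (H) => r' /E0E [[t [H1 H2]]|[H1 H2]]; apply/E0E; [left; by exists t|by right].
  - apply: (H) => r; apply: (H) => r'; apply: (H) => r'' /E0E Ha /E0E Hb; apply/E0E.
    case: Ha => [[t [H1 H2]]|[H1 H2]]; case: Hb => [[t' [H3 H4]]|[H3 H4]].
    + by left; exists t; rewrite {2}(d_fun H2 H3).
    + by case: H3; exists t.
    + by case: H2; exists t'.
    + by right.
pose E : eqsort M := EqSort Heq.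
have projE r r' : @eproj L M E (renc M r) = @eproj L M E (renc M r') <-> E0 r r'.
  split=> [H|/E0E H].
    have := f_equal (@proj1_sig _ _) H => /= Hr; apply/E0E.
    by rewrite Hr; exact: (proj2 (E0E r' r') (proj1 (E0E r' r') (Equivalence_Reflexive _))).
  apply: eq_sig_hprop => [x a b|/=]; first exact: proof_irrelevance.
  apply: functional_extensionality => e; apply: propositional_extensionality.
  split=> He; first exact: (Equivalence_Transitive _ _ _ (Equivalence_Symmetric _ _ H) He).
  exact: (Equivalence_Transitive _ _ _ H He).
pose cl (r : R) : Meq (inr E) := @eproj L M E (renc M r).
have Hcl : zd (expand (eq_expansion M)) (fun q : R * Meq (inr E) => cl (fst q) = snd q).
  have [psi Hpsi] := zd_fint Meq (inr E : fsym (extend (eq_ext M))).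
  exists psi => -[r c]; rewrite -(Hpsi (to_exp (eq_expansion M) (renc M r), c)) /=.
  by rewrite /to_exp unlift_lift.
have [chi Hchi] : zd (expand (eq_expansion M)) (fun c : Meq (inr E) => exists r, (exists t, d r t) /\ cl r = c).
  zd_step; apply: zd_and; last by apply: (zd_comp (f := fun t => (snd t, fst t)) Hcl); pm_tac.
  by apply: (zd_comp (zd_old (eq_expansion M) Ddef)); pm_tac.
have Hz : zero_definable (fun e : env Meq [inr E : sort (extend (eq_ext M))] => exists r, (exists t, d r t) /\ cl r = fst e).
  by exists chi => -[c []]; exact: (Hchi c).
pose Z : zset Meq := ZSet Hz.
have [rho Hrho] := dep_choice d_surj.
pose k (t : T) : Z := exist _ (cl (rho t), tt) (ex_intro _ (rho t) (conj (ex_intro _ t (Hrho t)) erefl)).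
have kE r t : d r t -> zval (k t) = (cl r, tt).
  move=> Hr; rewrite /zval /=; congr pair; apply/projE; left; exists t; split=> //; exact: Hrho.
have k_inj t t' : zval (k t) = zval (k t') -> t = t'.
  move=> H; have {}H : cl (rho t) = cl (rho t').
    exact: (f_equal (fun e : env Meq [inr E : sort (extend (eq_ext M))] => fst e) H).
  move/projE: H => [[w [H1 H2]]|[[]]]; last by exists t.
  by rewrite (d_fun (Hrho t) H1) (d_fun (Hrho t') H2).
have k_surj (z : Z) : exists t, k t = z.
  case: (proj2_sig z) => r [[t Ht] Hc]; exists t; apply: zval_inj; rewrite (kE r) //.
  by move: Hc; rewrite /zval; case: (proj1_sig z) => c [] /= ->.
have [u Hu] := dep_choice k_surj.
exists Z, k, u; split; [|split=> //; split=> //].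
  by move=> t; apply: k_inj; rewrite Hu.
apply: (zd_iff_ext (P := fun q : R * env Meq (zctx Z) => (exists t, d (fst q) t) /\ cl (fst q) = fst (snd q))).
  move=> [r [c []]] /=; split=> [[[t Ht] <-]|[t [Ht Hc]]].
  - by exists t; split=> //; exact: esym (kE r t Ht).
  - split; first by exists t.
    exact: esym (f_equal (fun e : env Meq [inr E : sort (extend (eq_ext M))] => fst e)
      (eq_trans Hc (kE r t Ht))).
apply: zd_and; first by apply: (zd_comp (zd_old (eq_expansion M) Ddef)); pm_tac.
apply: (zd_comp (f := fun q : R * env Meq (zctx Z) => (fst q, lookup (var0 _ _) (snd q) : Meq (inr E))) Hcl).
by apply: pm_pair; [pm_tac|apply: pm_lookup; pm_tac].
Qed.

End EqCode.

(** * The two families of groupoids *)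

Section Families.
Variables (L : lang) (U : structure L) (N : lang_ext L unit) (X : expansion U N).
Notation M := (expand X).
Variables (A : zset U) (p : newsort X -> A).
Hypothesis Xcover : one_analysable_cover p.
Hypothesis Xindep : independent_fibres p.
Notation VA := (env U (zctx A)).

(* An automorphism over [U] that fixes the coordinates of [b] in a fibre can be
   replaced by one that fixes [b], hence fixes the fibre if [b] identifies it
   with a subset of [U]. *)
Fixpoint fibre_coords (a : A) (G : list (sort (extend N))) : env M G -> list (newsort X) :=
  match G with
  | [] => fun _ => []
  | s :: G' => fun e =>
      match s return M s -> list (newsort X) -> list (newsort X) with
      | inl _ => fun _ l => l
      | inr tt => fun x l => if excluded_middle_informative (p x = a) is left _ then x :: l else l
      end (fst e) (fibre_coords a (snd e))
  end.

Lemma fibre_coords_over a G (e : env M G) x : In x (fibre_coords a e) -> p x = a.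
Proof.
elim: G e => [|[s|[]] G IH] e //=; first exact: IH.
by case: excluded_middle_informative => [E|_]; [case=> [<-|/IH]|exact: IH].
Qed.

Lemma fibre_coords_fix (tau : forall s, M s -> M s) a G (e : env M G) :
  (forall (s : sort L) (x : U s), tau (inl s) x = x) ->
  (forall x : newsort X, p x <> a -> tau (inr tt) x = x) -> (forall x, In x (fibre_coords a e) -> tau (inr tt) x = x) ->
  env_map tau e = e.
Proof.
move=> H1 H2; elim: G e => [|s G IH]; first by case.
case: s => [s|[]] [x e] /= H3; first by rewrite H1 IH.
move: H3; case: excluded_middle_informative => [E|E] H3.
- by rewrite (H3 x) ?IH //; [move=> y Hy; apply: H3; right|left].
- by rewrite H2 ?IH.
Qed.

Variables (H Y C E : Type) (RH : Rep M H) (RY : Rep U Y) (RC : Rep U C) (RE : Rep U E).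
Variables (chi : newsort X -> Y -> H -> Prop) (kappa : VA -> H -> C -> Prop).
Hypothesis chi_zd : zd M (fun t : newsort X * Y * H => chi (fst (fst t)) (snd (fst t)) (snd t)).
Hypothesis kappa_zd : zd M (fun t : VA * H * C => kappa (fst (fst t)) (snd (fst t)) (snd t)).
Hypothesis shape : forall a, exists u b, inj_at p chi (zval a) b /\ kappa (zval a) b u /\
  forall z, kappa (zval a) z u -> conj_at p chi (zval a) b z.
Variable Th : VA * H * H -> Prop.
Hypothesis Th_zd : zd M Th.
Hypothesis ThE : forall a b z, Th (zval a, b, z) <-> conj_at p chi (zval a) b z.
Variables (Psi : (Y * Y) * E -> Prop) (K : list (sort L)) (cod : E -> env U K).
Hypothesis Psi_zd : zd U Psi.
Hypothesis Psi_trace : forall v z z', exists e, forall y y',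
  (exists x, pv p x = v /\ chi x y z /\ chi x y' z') <-> Psi ((y, y'), e).
Hypothesis cod_zd : zd U (fun t : E * env U K => cod (fst t) = snd t).
Hypothesis codP : forall e e', cod e = cod e' <-> forall w, Psi (w, e) <-> Psi (w, e').

Lemma chi_move sigma x y b b' : aut_over (X := X) sigma -> maps_to (M := M) sigma b b' ->
  (chi x y b <-> chi (sigma (inr tt) x) y b').
Proof.
move=> Hs Hb; apply: (chi_aut chi_zd x y Hs Hb) => y'.
exact: (maps_to_old (Compat_old X RY)).
Qed.

Lemma inj_at_move sigma v b b' : aut_over (X := X) sigma -> maps_to (M := M) sigma b b' ->
  inj_at p chi v b -> inj_at p chi v b'.
Proof.
move=> Hs Hb.
have Hm : maps_to (M := M) sigma (v, b) (v, b').
  by apply: maps_to_pair => //; exact: (maps_to_old (Compat_old X (Rep_env U (zctx A)))).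
exact: (proj1 (zd_aut Hs (zd_inj_at Xcover chi_zd) Hm)).
Qed.

Lemma conj_move sigma v b b' : aut_over (X := X) sigma -> maps_to (M := M) sigma b b' ->
  inj_at p chi v b -> conj_at p chi v b b'.
Proof.
move=> Hs Hb Hi; split=> //; split; first exact: (inj_at_move Hs Hb Hi).
by exists sigma; split=> // x y _; exact: chi_move.
Qed.

Lemma fibre_fix a b : inj_at p chi (zval a) b -> exists l, (forall x, In x l -> p x = a) /\
  forall sigma, aut_over (X := X) sigma -> (forall x, In x l -> sigma (inr tt) x = x) ->
    forall x, p x = a -> sigma (inr tt) x = x.
Proof.
move=> [I1 [I2 I3]]; exists (fibre_coords a (renc M b)); split; first exact: fibre_coords_over.
move=> sigma Hs Hl x Hx; have [tau [Ht [T1 T2]]] := aut_local Xcover Xindep a Hs.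
have Hb : maps_to (M := M) tau b b.
  apply: (fibre_coords_fix (a := a)) => // [s y|y Hy]; first exact: (proj2 Ht).
  by rewrite T1; [exact: Hl|exact: fibre_coords_over Hy].
have Hv : pv p x = zval a by apply/pvE.
have [y Hy] := I1 x Hv; rewrite -T1 //; apply: (I3 _ _ y) => //; first by rewrite (aut_pv Xcover).
by apply/(chi_move x y Ht Hb).
Qed.

Lemma conj_sym v b z : conj_at p chi v b z -> conj_at p chi v z b.
Proof.
move=> [Hb [Hz [sigma [Hs Hc]]]]; have [k [Hk [H1 H2]]] := aut_over_inv Hs.
do 2 split=> //; exists k; split=> // x y Hx.
by rewrite Hc ?H2 // (aut_pv Xcover).
Qed.

Lemma conj_trans v b z w : conj_at p chi v b z -> conj_at p chi v z w -> conj_at p chi v b w.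
Proof.
move=> [Hb [Hz [sigma [Hs Hc]]]] [_ [Hw [tau [Ht Hc']]]].
do 2 split=> //; exists (fun s x => tau s (sigma s x)); split; first exact: aut_over_comp.
by move=> x y Hx; rewrite Hc // Hc' // (aut_pv Xcover).
Qed.

(* An object [(v, u)] is a formula isolating, over [U], the conjugacy class of an
   identification of the fibre at [v]; [ident] is that class. *)
Definition ident (i : VA * C) (z : H) : Prop :=
  exists b, kappa (fst i) b (snd i) /\ Th (fst i, b, z).

Definition is_ob (i : VA * C) : Prop :=
  zmem (z := A) (fst i) /\ exists b, inj_at p chi (fst i) b /\ kappa (fst i) b (snd i) /\
    forall z, kappa (fst i) z (snd i) -> Th (fst i, b, z).

(** The second coordinates over an object form the image of one of its identifications; all of them
    have the same image, because conjugation does not move the values in [Y]. Keeping the object as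
    a coordinate makes the sets of points disjoint. *)
Definition is_pt (q : (VA * C) * Y) : Prop :=
  is_ob (fst q) /\ exists z x, ident (fst q) z /\ pv p x = fst (fst q) /\ chi x (snd q) z.

(** The last coordinate is the canonical parameter of the graph of [f_z' f_z^-1], a subset of the
    square of [Y]; pairs [z], [z'] with the same graph give the same morphism. *)
Definition is_mor (m : ((VA * C) * (VA * C)) * env U K) : Prop :=
  is_ob (fst (fst m)) /\ is_ob (snd (fst m)) /\ fst (fst (fst m)) = fst (snd (fst m)) /\
  exists e z z', cod e = snd m /\ ident (fst (fst m)) z /\ ident (snd (fst m)) z' /\
    forall y y', (exists x, pv p x = fst (fst (fst m)) /\ chi x y z /\ chi x y' z') <-> Psi ((y, y'), e).

Lemma ident_zdM : zd M (fun t : (VA * C) * H => ident (fst t) (snd t)).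
Proof.
rewrite /ident; zd_step; apply: zd_and; first by apply: (zd3 (P := kappa) kappa_zd); pm_tac.
by apply: (zd_comp Th_zd); pm_tac.
Qed.

Lemma is_ob_zdM : zd M is_ob.
Proof.
rewrite /is_ob; apply: zd_and.
  have HA : zd U (fun v : VA => zmem (z := A) v) by case: (zmem_def A) => phi Hphi; exists phi.
  by apply: (zd_comp (zd_old X HA)); pm_tac.
zd_step; apply: zd_and; first by apply: (zd2 (P := inj_at p chi) (zd_inj_at Xcover chi_zd)); pm_tac.
apply: zd_and; first by apply: (zd3 (P := kappa) kappa_zd); pm_tac.
by zd_step; apply: zd_imp; [apply: (zd3 (P := kappa) kappa_zd)|apply: (zd_comp Th_zd)]; pm_tac.
Qed.

Lemma is_pt_zdM : zd M is_pt.
Proof.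
rewrite /is_pt; apply: zd_and; first by apply: (zd_comp is_ob_zdM); pm_tac.
zd_step; zd_step; apply: zd_and; first by apply: (zd2 (P := ident) ident_zdM); pm_tac.
apply: zd_and; first by apply: (zd2 (P := fun x v => pv p x = v) (zd_pv Xcover)); pm_tac.
by apply: (zd3 (P := chi) chi_zd); pm_tac.
Qed.

Lemma Psi_zdM : zd M Psi.
Proof.
apply/(zd_compat (Compat_prod (Compat_prod (Compat_old X RY) (Compat_old X RY)) (Compat_old X RE))).
exact: zd_old.
Qed.

Lemma cod_zdM : zd M (fun t : E * env U K => cod (fst t) = snd t).
Proof. exact: zd_old_pair cod_zd. Qed.

Lemma is_mor_zdM : zd M is_mor.
Proof.
rewrite /is_mor; apply: zd_and; first by apply: (zd_comp is_ob_zdM); pm_tac.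
apply: zd_and; first by apply: (zd_comp is_ob_zdM); pm_tac.
apply: zd_and; first by zd_step.
zd_step; zd_step; zd_step; apply: zd_and; first by apply: (zd2 (P := fun e k => cod e = k) cod_zdM); pm_tac.
apply: zd_and; first by apply: (zd2 (P := ident) ident_zdM); pm_tac.
apply: zd_and; first by apply: (zd2 (P := ident) ident_zdM); pm_tac.
zd_step; zd_step; apply: zd_iff; last by apply: (zd_comp Psi_zdM); pm_tac.
zd_step; apply: zd_and; first by apply: (zd2 (P := fun x v => pv p x = v) (zd_pv Xcover)); pm_tac.
by apply: zd_and; apply: (zd3 (P := chi) chi_zd); pm_tac.
Qed.

Let NN := proj2 (proj2 (proj1 Xcover)).

Let cOb := Compat_prod (Compat_old X (Rep_env U (zctx A))) (Compat_old X RC).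

(** The conditions on objects speak of [U'], but objects are tuples of [U], so the absence of new
    0-definable sets brings the definition down to [U]. Points and morphisms are treated alike. *)
Lemma is_ob_zd : zd U is_ob.
Proof. exact: (no_new NN cOb is_ob_zdM). Qed.

Lemma is_pt_zd : zd U is_pt.
Proof. exact: (no_new NN (Compat_prod cOb (Compat_old X RY)) is_pt_zdM). Qed.

Lemma is_mor_zd : zd U is_mor.
Proof.
exact: (no_new NN (Compat_prod (Compat_prod cOb cOb) (Compat_old X (Rep_env U K))) is_mor_zdM).
Qed.

Definition FO : zset U := zset_of is_ob_zd.
Definition FP : zset U := zset_of is_pt_zd.
Definition FM : zset U := zset_of is_mor_zd.

Definition obase (i : FO) : A := exist _ (fst (tval i)) (proj1 (tvalP i)).
Definition pover (q : FP) : FO := zmk is_ob_zd (proj1 (tvalP q)).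
Definition msrc (m : FM) : FO := zmk is_ob_zd (proj1 (tvalP m)).
Definition mtgt (m : FM) : FO := zmk is_ob_zd (proj1 (proj2 (tvalP m))).
Definition mact (m : FM) (q q' : FP) : Prop :=
  pover q = msrc m /\ pover q' = mtgt m /\
  exists e, cod e = snd (tval m) /\ Psi ((snd (tval q), snd (tval q')), e).
Definition idents (i : FO) (h : newsort X -> FP -> Prop) : Prop :=
  exists z, ident (tval i) z /\
    forall x q, h x q <-> p x = obase i /\ pover q = i /\ chi x (snd (tval q)) z.
Definition auts (g : newsort X -> newsort X) : Prop :=
  exists sigma, aut_over (X := X) sigma /\ forall x, g x = sigma (inr tt) x.

Lemma ident_inj (i : FO) z : ident (tval i) z -> inj_at p chi (zval (obase i)) z.
Proof. by move=> [b [_ Hb]]; have [_ []] : conj_at p chi (zval (obase i)) b z by apply/ThE. Qed.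

Lemma ident_ex (i : FO) : exists z, ident (tval i) z.
Proof. by have [_ [b [Hb [Hk Hz]]]] := tvalP i; exists b, b; split=> //; exact: Hz. Qed.

(** The two parameters may come from different realisations of [kappa]; both of these are conjugate
    to the realisation [b0] that witnesses isolation. *)
Lemma ident_conj (i : FO) z z' : ident (tval i) z -> ident (tval i) z' ->
  conj_at p chi (zval (obase i)) z z'.
Proof.
move=> [b [Hb /(ThE (obase i)) Hz]] [b' [Hb' /(ThE (obase i)) Hz']].
have [_ [b0 [_ [_ H0]]]] := tvalP i.
have /(ThE (obase i)) E1 := H0 b Hb; have /(ThE (obase i)) E2 := H0 b' Hb'.
exact: conj_trans (conj_trans (conj_sym Hz) (conj_sym E1)) (conj_trans E2 Hz').
Qed.

Lemma conj_ident (i : FO) z z' : ident (tval i) z ->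
  conj_at p chi (zval (obase i)) z z' -> ident (tval i) z'.
Proof.
move=> [b [Hb /(ThE (obase i)) Hz]] Hz'; exists b; split=> //.
by apply/(ThE (obase i)); exact: conj_trans Hz Hz'.
Qed.

Lemma tval_pover q : tval (pover q) = fst (tval q). Proof. exact: tval_mk. Qed.
Lemma tval_msrc m : tval (msrc m) = fst (fst (tval m)). Proof. exact: tval_mk. Qed.
Lemma tval_mtgt m : tval (mtgt m) = snd (fst (tval m)). Proof. exact: tval_mk. Qed.

Lemma obase_eq (i j : FO) : fst (tval i) = fst (tval j) -> obase i = obase j.
Proof. by move=> E0; apply: zval_inj. Qed.

Lemma pt_mk (i : FO) z x y : ident (tval i) z -> p x = obase i -> chi x y z ->
  exists q : FP, pover q = i /\ snd (tval q) = y.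
Proof.
move=> Hz Hx Hc.
have [|q Hq] := @zset_mk _ _ _ _ _ is_pt_zd (tval i, y).
  split; first exact: tvalP.
  by exists z, x; do !split=> //; apply/(pvE p _ (obase i)).
by exists q; rewrite Hq; split=> //; apply: tval_inj; rewrite tval_pover Hq.
Qed.

Lemma pt_ident (q : FP) : exists z x, ident (tval (pover q)) z /\ p x = obase (pover q) /\
  chi x (snd (tval q)) z.
Proof.
have [_ [z [x [Hz [Hx Hc]]]]] := tvalP q.
exists z, x; rewrite tval_pover; do !split=> //.
by apply: zval_inj; rewrite -[LHS]/(pv p x) Hx -tval_pover.
Qed.

Lemma pt_eq (q q' : FP) : pover q = pover q' -> snd (tval q) = snd (tval q') -> q = q'.
Proof.
move=> /(f_equal (@tval _ _ _ _ _ _)) E1 E2; apply: tval_inj; rewrite !tval_pover in E1.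
by rewrite [tval q]surjective_pairing [tval q']surjective_pairing E1 E2.
Qed.

Lemma torsor_F : torsor p auts obase msrc mtgt pover mact idents.
Proof.
split.
- exact: (proj1 (proj2 (proj2 (proj2 Xcover)))).
- move=> a; have [u [b [Hb [Hk Hz]]]] := shape a.
  have [|i Hi] := @zset_mk _ _ _ _ _ is_ob_zd (zval a, u).
    split; first exact: (proj2_sig a).
    by exists b; split=> //; split=> // z /Hz /ThE.
  by exists i; apply: zval_inj; rewrite -[LHS]/(fst (tval i)) Hi.
- by move=> g x [sigma [Hs ->]]; apply/pvE; rewrite (aut_pv Xcover).
- move=> i; have [z Hz] := ident_ex i.
  by exists (fun x q => p x = obase i /\ pover q = i /\ chi x (snd (tval q)) z), z.
- by move=> i h x q [z [Hz E0]] /E0 [H1 [H2 _]].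
- move=> i h x [z [Hz E0]] Hx; have [I1 [I2 _]] := ident_inj Hz.
  have [|y Hy] := I1 x; first exact/pvE.
  have [q [Hq Eq]] := pt_mk Hz Hx Hy.
  exists q; split; first by apply/E0; rewrite Eq.
  move=> q' /E0 [_ [Hq' Hy']]; apply: pt_eq; first by rewrite Hq Hq'.
  by rewrite Eq; apply: I2 Hy Hy'; exact/pvE.
(* The point [q] was obtained from some identification [z']; an automorphism conjugating [z'] to [z]
   carries the preimage of [q] under the one to its preimage under the other. *)
- move=> i h q [z [Hz E0]] Hq; have [I1 [I2 I3]] := ident_inj Hz.
  have [z' [x' [Hz' [Hx' Hc']]]] := pt_ident q; rewrite Hq in Hz' Hx'.
  have [_ [_ [sigma [Hs Hc]]]] := ident_conj Hz' Hz.
  have Hsx : p (sigma (inr tt) x') = obase i by apply/pvE; rewrite (aut_pv Xcover) //; exact/pvE.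
  have Hch : chi (sigma (inr tt) x') (snd (tval q)) z by apply/Hc => //; exact/pvE.
  exists (sigma (inr tt) x'); split; first by apply/E0.
  by move=> x /E0 [Hx [_ Hcx]]; apply: I3 Hch Hcx; exact/pvE.
- move=> i h k [z [Hz E0]] [z' [Hz' E1]].
  have [_ [_ [sigma [Hs Hc]]]] := ident_conj Hz Hz'.
  exists (sigma (inr tt)); split; first by exists sigma.
  move=> x q Hx; rewrite E0 E1.
  have -> : p (sigma (inr tt) x) = p x by apply/pvE; rewrite (aut_pv Xcover).
  by rewrite Hc //; exact/pvE.
(* Precomposing [f_z] with [sigma] gives [f_z'], where [z'] is the image of [z] under the inverse of
   [sigma]. *)
- move=> i k g [z [Hz E0]] [sigma [Hs Hg]].
  have [tau [Ht [H1 H2]]] := aut_over_inv Hs.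
  have [z' Hz'] := maps_to_ex tau RH z.
  exists (fun x q => p x = obase i /\ pover q = i /\ chi x (snd (tval q)) z'); split.
    exists z'; split=> //; apply: (conj_ident Hz); apply: conj_move Ht Hz' _; exact: ident_inj.
  move=> x q Hx; rewrite E0 Hg.
  have -> : p (sigma (inr tt) x) = p x by apply/pvE; rewrite (aut_pv Xcover).
  by rewrite (chi_move (sigma (inr tt) x) (snd (tval q)) Ht Hz') H1.
- move=> m; have [Hm1 [Hm2 [Hb [e [z [z' [He [Hz [Hz' Hpsi]]]]]]]]] := tvalP m.
  have Hbm : obase (msrc m) = obase (mtgt m).
    by apply: obase_eq; exact: (eq_trans (f_equal fst (tval_msrc m)) (eq_trans Hb (f_equal fst (esym (tval_mtgt m))))).
  split; first exact: Hbm.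
  have {}Hbm x : p x = obase (msrc m) -> p x = obase (mtgt m) by move=> ->.
  exists (fun x q => p x = obase (msrc m) /\ pover q = msrc m /\ chi x (snd (tval q)) z),
    (fun x q => p x = obase (mtgt m) /\ pover q = mtgt m /\ chi x (snd (tval q)) z').
  split; first by exists z; split; [rewrite tval_msrc; exact: Hz|move=> x q; exact: iff_refl].
  split; first by exists z'; split; [rewrite tval_mtgt; exact: Hz'|move=> x q; exact: iff_refl].
  have Hbv x : pv p x = fst (fst (fst (tval m))) <-> p x = obase (msrc m).
    by rewrite -tval_msrc; exact: (pvE p _ (obase (msrc m))).
  move=> q q'; split.
  + move=> [H1 [H2 [e' [He' HP]]]].
    have : Psi ((snd (tval q), snd (tval q')), e).
      exact: (proj2 (proj1 (codP e e') (eq_trans He (esym He')) _) HP).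
    by move=> /Hpsi [x [/Hbv Hx [Hc Hc']]]; exists x; do !split=> //; exact: Hbm.
  + move=> [x [[Hx [H1 Hc]] [_ [H2 Hc']]]]; do 2 split=> //; exists e; split=> //.
    by apply/Hpsi; exists x; split; first exact/Hbv.
(* [Psi_trace] supplies a parameter [e] for the graph of [f_z' f_z^-1], and its code completes the
   morphism. *)
- move=> i j h h' Hb [z [Hz E0]] [z' [Hz' E1]].
  have [e He] := Psi_trace (fst (tval i)) z z'.
  have Hij : fst (tval i) = fst (tval j) by have := f_equal (fun a : A => zval a) Hb.
  have [|m Hm] := @zset_mk _ _ _ _ _ is_mor_zd ((tval i, tval j), cod e).
    do 2 (split; first exact: tvalP); split=> //.
    by exists e, z, z'.
  have Hs : msrc m = i by apply: tval_inj; rewrite tval_msrc Hm.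
  have Ht : mtgt m = j by apply: tval_inj; rewrite tval_mtgt Hm.
  exists m; do 2 split=> //; move=> q q'; rewrite /mact Hs Ht Hm /=; split.
  + move=> [H1 [H2 [e' [He' HP]]]].
    have : Psi ((snd (tval q), snd (tval q')), e) by exact: (proj2 (proj1 (codP e e') (esym He') _) HP).
    move=> /He [x [/(pvE p _ (obase i)) Hx [Hc Hc']]]; exists x; split; [exact/E0|apply/E1].
    by rewrite -Hb.
  + move=> [x [/E0 [Hx [H1 Hc]] /E1 [_ [H2 Hc']]]]; do 2 split=> //; exists e; split=> //.
    by apply/He; exists x; split; first exact/(pvE p _ (obase i)).
(* Every pair in the graph of a morphism is a pair of values of actual points, so equal actions give
   equal graphs, and [codP] makes the codes equal. *)
- have Hkey m n : msrc m = msrc n -> mtgt m = mtgt n -> (forall q q', mact m q q' <-> mact n q q') ->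
      forall e e', cod e = snd (tval m) -> cod e' = snd (tval n) -> forall w, Psi (w, e) -> Psi (w, e').
    move=> Hs Ht Ha e e' He He' [y y'] HP.
    have [_ [_ [Hb [e0 [z [z' [He0 [Hz [Hz' Hpsi]]]]]]]]] := tvalP m.
    rewrite -tval_msrc in Hb Hz Hpsi; rewrite -tval_mtgt in Hb Hz'.
    have : Psi ((y, y'), e0) by exact: (proj2 (proj1 (codP e0 e) (eq_trans He0 (esym He)) _) HP).
    move=> /Hpsi [x [/(pvE p _ (obase (msrc m))) Hx [Hc Hc']]].
    have [q [Hq Eq]] := pt_mk Hz Hx Hc.
    have [q' [Hq' Eq']] := pt_mk Hz' (eq_trans Hx (obase_eq Hb)) Hc'.
    have : mact m q q' by do 2 split=> //; exists e; rewrite Eq Eq'.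
    move=> /Ha [_ [_ [e1 [He1]]]]; rewrite Eq Eq' => HP1.
    exact: (proj1 (proj1 (codP e1 e') (eq_trans He1 (esym He')) _) HP1).
  move=> m n Hs Ht Ha.
  have [_ [_ [_ [e [_ [_ [He _]]]]]]] := tvalP m.
  have [_ [_ [_ [e' [_ [_ [He' _]]]]]]] := tvalP n.
  have Ek : snd (tval m) = snd (tval n).
    rewrite -He -He'; apply/codP => w; split; first exact: (Hkey m n Hs Ht Ha e e' He He').
    apply: (Hkey n m (esym Hs) (esym Ht) _ e' e He' He) => q q'; exact: iff_sym (Ha q q').
  apply: tval_inj; rewrite [tval m]surjective_pairing [tval n]surjective_pairing Ek.
  congr pair; rewrite [fst (tval m)]surjective_pairing [fst (tval n)]surjective_pairing.
  by rewrite -!tval_msrc -!tval_mtgt Hs Ht.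
Qed.

Notation OT := (VA * C)%type.
Notation rOT := (Rep_prod (Rep_env U (zctx A)) RC).

Notation rMT := (Rep_prod (Rep_prod rOT rOT) (Rep_env U K)).
Notation rPT := (Rep_prod rOT RY).

Lemma renc_zval (T : Type) (RT : Rep U T) (P : T -> Prop) (HP : zd U P) (z : zset_of HP) (t : T) :
  renc U t = zval z <-> t = tval z.
Proof. by rewrite zval_tval; split=> [H0|->] //; exact: renc_inj H0. Qed.

Lemma ob_renc (i : FO) o : renc U o = zval i <-> o = tval i. Proof. exact: renc_zval. Qed.
Lemma pt_renc (q : FP) r : renc U r = zval q <-> r = tval q. Proof. exact: renc_zval. Qed.
Lemma mor_renc (m : FM) r : renc U r = zval m <-> r = tval m. Proof. exact: renc_zval. Qed.

Lemma F_base : zero_definable (image (fun i : FO => env_app (zval i) (zval (obase i)))).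
Proof.
apply: (zero_definable_image2 (R1 := rOT) (R2 := Rep_env U (zctx A)) (f := fun i : FO => zval i)
  (P := fun t => is_ob (fst t) /\ fst (fst t) = snd t)).
  by apply: zd_and; [apply: (zd_comp is_ob_zd); pm_tac|zd_step].
move=> o v; split=> [[Ho Ev]|[i [Eo Ev]]].
  by have [i Hi] := zset_mk is_ob_zd Ho; exists i; rewrite ob_renc Hi /zval /= Hi.
by rewrite (proj1 (ob_renc _ _) Eo); split; [exact: tvalP|exact: esym Ev].
Qed.

Lemma F_ends : zero_definable (image (fun m : FM =>
  env_app (zval m) (env_app (zval (msrc m)) (zval (mtgt m))))).
Proof.
apply: (zero_definable_image3 (R1 := rMT) (R2 := rOT) (R3 := rOT) (f := fun m : FM => zval m)
  (P := fun t => is_mor (fst t) /\ fst (fst t) = snd t)).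
  by apply: zd_and; [apply: (zd_comp is_mor_zd); pm_tac|zd_step].
move=> m o o'; split=> [[Hm Em]|[m0 [E1 [E2 E3]]]].
  have [m0 Hm0] := zset_mk is_mor_zd Hm; exists m0.
  rewrite mor_renc !ob_renc tval_msrc tval_mtgt Hm0.
  by split=> //; move: Em => /= ->.
rewrite (proj1 (mor_renc _ _) E1) (proj1 (ob_renc _ _) E2) (proj1 (ob_renc _ _) E3); split; first exact: tvalP.
by rewrite tval_msrc tval_mtgt; exact: surjective_pairing.
Qed.

Lemma F_over : zero_definable (image (fun q : FP => env_app (zval q) (zval (pover q)))).
Proof.
apply: (zero_definable_image2 (R1 := rPT) (R2 := rOT) (f := fun q : FP => zval q)
  (P := fun t => is_pt (fst t) /\ fst (fst t) = snd t)).
  by apply: zd_and; [apply: (zd_comp is_pt_zd); pm_tac|zd_step].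
move=> q o; split=> [[Hq Eq]|[q0 [E1 E2]]].
  have [q0 Hq0] := zset_mk is_pt_zd Hq; exists q0.
  rewrite pt_renc ob_renc tval_pover Hq0.
  by split=> //; exact: esym Eq.
by rewrite (proj1 (pt_renc _ _) E1) (proj1 (ob_renc _ _) E2) tval_pover; split; first exact: tvalP.
Qed.

Definition acts (m : OT * OT * env U K) (q q' : OT * Y) : Prop :=
  is_mor m /\ is_pt q /\ is_pt q' /\ fst q = fst (fst m) /\ fst q' = snd (fst m) /\
  exists e, cod e = snd m /\ Psi ((snd q, snd q'), e).

Lemma actsE (m : FM) (q q' : FP) : acts (tval m) (tval q) (tval q') <-> mact m q q'.
Proof.
rewrite /acts /mact -!tval_pover -tval_msrc -tval_mtgt.
split=> [[_ [_ [_ [/tval_inj E1 [/tval_inj E2 E3]]]]]|[-> [-> E3]]] //.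
do !(split; first by [exact: tvalP|]); by [].
Qed.

Lemma acts_zd : zd U (fun t : (OT * OT * env U K) * ((OT * Y) * (OT * Y)) => acts (fst t) (fst (snd t)) (snd (snd t))).
Proof.
rewrite /acts; apply: zd_and; first by apply: (zd_comp is_mor_zd); pm_tac.
apply: zd_and; first by apply: (zd_comp is_pt_zd); pm_tac.
apply: zd_and; first by apply: (zd_comp is_pt_zd); pm_tac.
apply: zd_and; first by zd_step.
apply: zd_and; first by zd_step.
zd_step; apply: zd_and; first by apply: (zd2 (P := fun e k => cod e = k) cod_zd); pm_tac.
by apply: (zd_comp Psi_zd); pm_tac.
Qed.

Lemma F_act : zero_definable (fun z => exists (m : FM) (q q' : FP), mact m q q' /\
  z = env_app (zval m) (env_app (zval q) (zval q'))).
Proof.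
apply: (zero_definable_rel3 (R1 := rMT) (R2 := rPT) (R3 := rPT) (f := fun m : FM => zval m)
  (g := fun q : FP => zval q) (h := fun q : FP => zval q) acts_zd) => m q q'.
split=> [Ha|[m0 [q0 [q0' [Ha [E1 [E2 E3]]]]]]]; last first.
  by rewrite (proj1 (mor_renc _ _) E1) (proj1 (pt_renc _ _) E2) (proj1 (pt_renc _ _) E3); exact/actsE.
have [m0 Em] := zset_mk is_mor_zd (proj1 Ha).
have [q0 Eq] := zset_mk is_pt_zd (proj1 (proj2 Ha)).
have [q0' Eq'] := zset_mk is_pt_zd (proj1 (proj2 (proj2 Ha))).
exists m0, q0, q0'; split; first by apply/actsE; rewrite Em Eq Eq'.
by rewrite mor_renc !pt_renc.
Qed.

Definition FG : groupoid_family (M := U) (zval (X := A)) :=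
  torsor_groupoid torsor_F (kO := fun i : FO => i) (uO := fun i => i) (kM := fun m : FM => m) (uM := fun m => m)
    (kP := fun q : FP => q) (uP := fun q => q) (fun _ => erefl) (fun _ => erefl) (fun _ => erefl)
    (fun _ => erefl) (fun _ => erefl) (fun _ => erefl) F_base F_ends F_over F_act.

(** * Adding the fibres as objects *)

Definition ob' : Type := (FO + A)%type.
Definition pt' : Type := (FP + newsort X)%type.
Definition base' (i : ob') : A := match i with inl i => obase i | inr a => a end.
Definition over' (q : pt') : ob' := match q with inl q => inl (pover q) | inr x => inr (p x) end.
(** At the new object [S_a] the torsor consists of the restrictions of the automorphisms over [U].
    Morphisms from [S_a] to an old object are thus the maps [f_z sigma^-1], and those from [S_a] to
    itself are again such restrictions. *)
Definition idents' (i : ob') (h : newsort X -> pt' -> Prop) : Prop :=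
  match i with
  | inl i => exists h0, idents i h0 /\ forall x q, h x q <-> exists q0, q = inl q0 /\ h0 x q0
  | inr a => exists sigma, aut_over (X := X) sigma /\
      forall x q, h x q <-> p x = a /\ q = inr (sigma (inr tt) x)
  end.
(** Morphisms are recorded extensionally, as relations on points, so that distinct ones with the
    same ends act differently by construction; their description by parameters comes later. *)
Definition mor' : Type :=
  {m : (ob' * ob') * (pt' -> pt' -> Prop) | base' (fst (fst m)) = base' (snd (fst m)) /\
    exists h h', idents' (fst (fst m)) h /\ idents' (snd (fst m)) h' /\
      forall q q', snd m q q' <-> exists x, h x q /\ h' x q'}.
Definition src' (m : mor') : ob' := fst (fst (proj1_sig m)).
Definition tgt' (m : mor') : ob' := snd (fst (proj1_sig m)).
Definition act' (m : mor') : pt' -> pt' -> Prop := snd (proj1_sig m).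

Lemma mor'_ext (m n : mor') : src' m = src' n -> tgt' m = tgt' n ->
  (forall q q', act' m q q' <-> act' n q q') -> m = n.
Proof.
move=> Hs Ht Ha; apply: eq_sig_hprop => [x u v|]; first exact: proof_irrelevance.
move: Hs Ht Ha; rewrite /src' /tgt' /act'; case: (proj1_sig m) => [[i j] R]; case: (proj1_sig n) => [[i' j'] R'] /=.
move=> -> -> H0; congr pair; apply: functional_extensionality => q; apply: functional_extensionality => q'.
exact: propositional_extensionality.
Qed.

Lemma aut_p sigma x : aut_over (X := X) sigma -> p (sigma (inr tt) x) = p x.
Proof. by move=> Hs; apply/pvE; rewrite (aut_pv Xcover). Qed.

Lemma torsor_F' : torsor p auts base' src' tgt' over' act' idents'.
Proof.
have TF := torsor_F; split.
- exact: (sp_surj TF).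
- by move=> a; exists (inr a).
- exact: (gam_sp TF).
- move=> [i|a]; last first.
    by exists (fun x q => p x = a /\ q = inr x), (fun s x => x); split; first exact: aut_over_id.
  have [h Hh] := phi_ex TF i; exists (fun x q => exists q0, q = inl q0 /\ h x q0), h; by split.
- move=> [i|a] h x q /=.
    move=> [h0 [Hh0 E0]] /E0 [q0 [-> Hq0]]; have [-> E1] := phi_over TF Hh0 Hq0; by rewrite /= E1.
  by move=> [sigma [Hs E0]] /E0 [<- ->] /=; rewrite aut_p.
- move=> [i|a] h x /=.
    move=> [h0 [Hh0 E0]] Hx; have [q [Hq Hu]] := phi_fun TF Hh0 Hx.
    exists (inl q); split; first by apply/E0; exists q.
    by move=> q' /E0 [q0 [-> /Hu ->]].
  move=> [sigma [Hs E0]] Hx; exists (inr (sigma (inr tt) x)); split; first exact/E0.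
  by move=> q' /E0 [_ ->].
- move=> [i|a] h [q|x] //=.
  + move=> [h0 [Hh0 E0]] [Hq]; have [x [Hx Hu]] := phi_bij TF Hh0 Hq.
    exists x; split; first by apply/E0; exists q.
    by move=> x' /E0 [q0 [[<-] /Hu]].
  + move=> [sigma [Hs E0]] [Hx]; have [k [Hk [K1 K2]]] := aut_over_inv Hs.
    exists (k (inr tt) x); split; first by apply/E0; rewrite (aut_p x Hk) K2.
    move=> x' /E0 [_ [E1]]; rewrite E1; exact: (K1 (inr tt) x').
- move=> [i|a] h k /=.
    move=> [h0 [Hh0 E0]] [k0 [Hk0 E1]]; have [g [Hg Hc]] := phi_gam TF Hh0 Hk0.
    exists g; split=> // x q Hx; rewrite E0 E1.
    by split=> -[q0 [-> Hq]]; exists q0; split=> //; apply/Hc.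
  move=> [sigma [Hs E0]] [tau [Ht E1]]; have [k0 [Hk [K1 K2]]] := aut_over_inv Ht.
  exists (fun x => k0 (inr tt) (sigma (inr tt) x)); split.
    by exists (fun s x => k0 s (sigma s x)); split; first exact: aut_over_comp.
  by move=> x q Hx; rewrite E0 E1 K2 (aut_p _ Hk) (aut_p _ Hs).
- move=> [i|a] k g /=.
    move=> [k0 [Hk0 E0]] Hg; have [h [Hh Hc]] := gam_phi TF Hk0 Hg.
    exists (fun x q => exists q0, q = inl q0 /\ h x q0); split; first by exists h.
    move=> x q Hx; rewrite E0.
    by split=> -[q0 [-> Hq]]; exists q0; split=> //; apply/Hc.
  move=> [sigma [Hs E0]] [tau [Ht Eg]].
  exists (fun x q => p x = a /\ q = inr (sigma (inr tt) (tau (inr tt) x))); split.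
    by exists (fun s x => sigma s (tau s x)); split; first exact: aut_over_comp.
  by move=> x q Hx; rewrite E0 Eg (aut_p _ Ht).
- by move=> [[[i j] R] [H1 H2]].
- move=> i j h h' Hb Hh Hh'.
  exists (exist _ (i, j, fun q q' => exists x, h x q /\ h' x q') (conj Hb
    (ex_intro _ h (ex_intro _ h' (conj Hh (conj Hh' (fun q q' => iff_refl _))))))).
  by [].
- exact: mor'_ext.
Qed.

(** * Coordinates for the extended groupoids *)

Variables (s0 : sort L) (c0 c1 : U s0).
Hypothesis c01 : c0 <> c1.

(* The first two coordinates agree on the old part and differ on the new part. *)
Notation flag := (U s0 * U s0)%type.
Notation RO := (flag * (OT * VA))%type.
Notation RP := (flag * ((OT * Y) * newsort X))%type.
Notation RM := ((RO * RO) * ((H * H) * (H * H)))%type.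

Definition isold (f : flag) : Prop := fst f = snd f.

(** The coordinate of the kind not in use is arbitrary, so an object has many codes; they are
    identified in [(U')^eq]. *)
Definition codes_ob (r : RO) (i : ob') : Prop :=
  match i with
  | inl i => isold (fst r) /\ fst (snd r) = tval i
  | inr a => ~ isold (fst r) /\ snd (snd r) = zval a
  end.

Definition codes_pt (r : RP) (q : pt') : Prop :=
  match q with
  | inl q => isold (fst r) /\ fst (snd r) = tval q
  | inr x => ~ isold (fst r) /\ snd (snd r) = x
  end.

(** At a new object, an automorphism of [S_a] is represented by a pair of conjugate parameters, as
    [f_(snd w)^-1 f_(fst w)]; at an old object only the first parameter matters. *)
Definition wit (i : ob') (w : H * H) (x : newsort X) (q : pt') : Prop :=
  match i with
  | inl i => exists q0, q = inl q0 /\ p x = obase i /\ pover q0 = i /\ chi x (snd (tval q0)) (fst w)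
  | inr a => exists x', q = inr x' /\ p x = a /\ p x' = a /\
      exists y, chi x y (fst w) /\ chi x' y (snd w)
  end.

Definition valid (i : ob') (w : H * H) : Prop :=
  match i with
  | inl i => ident (tval i) (fst w)
  | inr a => Th (zval a, fst w, snd w)
  end.

(** At a new object, [sigma] is represented by an identification [b] of the fibre together with its
    image under [sigma]. Conversely, an automorphism that witnesses the conjugacy of a valid pair
    has [wit] as its graph on the fibre. *)
Lemma idents'E i h : idents' i h <-> exists w, valid i w /\ forall x q, h x q <-> wit i w x q.
Proof.
case: i => [i|a] /=; split.
- move=> [h0 [[z [Hz E0]] E1]]; exists (z, z); split=> // x q; rewrite E1.
  by split=> -[q0 [-> Hq]]; exists q0; split=> //; apply/E0.
- move=> [[z z'] [Hz E0]]; exists (fun x q => p x = obase i /\ pover q = i /\ chi x (snd (tval q)) z).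
  by split; first by exists z.
- move=> [sigma [Hs E0]]; have [u [b [Hb _]]] := shape a.
  have [b' Hb'] := maps_to_ex (M := M) sigma RH b; exists (b, b'); split.
    by apply/ThE; exact: conj_move Hs Hb' Hb.
  have [I1 [I2 I3]] := inj_at_move Hs Hb' Hb.
  have [J1 _] := Hb.
  move=> x q; rewrite E0; split=> [[Hx ->]|[x' [-> [Hx [Hx' [y [Hy Hy']]]]]]].
    exists (sigma (inr tt) x); rewrite (aut_p x Hs); do 3 split=> //.
    have [|y Hy] := J1 x; first exact/pvE.
    by exists y; split=> //; apply/(chi_move _ _ Hs Hb').
  split=> //; congr inr; apply: (I3 _ _ y) => //; first exact/pvE.
    by apply/pvE; rewrite aut_p.
  by apply/(chi_move _ _ Hs Hb').
- move=> [[b z] [/ThE [[I1 [I2 I3]] [[J1 [J2 J3]] [sigma [Hs Hc]]]] E0]]; exists sigma; split=> // x q.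
  rewrite E0; split=> [[x' [-> [Hx [Hx' [y [Hy Hy']]]]]]|[Hx ->]].
    split=> //; congr inr; apply: (J3 _ _ y) => //; [exact/pvE|by apply/pvE; rewrite aut_p|].
    by apply/Hc => //; exact/pvE.
  have [|y Hy] := I1 x; first exact/pvE.
  exists (sigma (inr tt) x); rewrite (aut_p x Hs); do 3 split=> //; exists y; split=> //.
  by apply/Hc => //; exact/pvE.
Qed.

Definition codes_mor (r : RM) (m : mor') : Prop :=
  codes_ob (fst (fst r)) (src' m) /\ codes_ob (snd (fst r)) (tgt' m) /\
  valid (src' m) (fst (snd r)) /\ valid (tgt' m) (snd (snd r)) /\
  forall q q', act' m q q' <-> exists x, wit (src' m) (fst (snd r)) x q /\ wit (tgt' m) (snd (snd r)) x q'.

Lemma codes_ob_fun r i j : codes_ob r i -> codes_ob r j -> i = j.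
Proof.
case: i => [i|a]; case: j => [j|b] [H1 H2] [H3 H4] //.
- by congr inl; apply: tval_inj; rewrite -H2.
- by congr inr; apply: zval_inj; rewrite -H2.
Qed.

Lemma codes_pt_fun r i j : codes_pt r i -> codes_pt r j -> i = j.
Proof.
case: i => [i|a]; case: j => [j|b] [H1 H2] [H3 H4] //.
- by congr inl; apply: tval_inj; rewrite -H2.
- by rewrite -H2 -H4.
Qed.

Lemma codes_mor_fun r m n : codes_mor r m -> codes_mor r n -> m = n.
Proof.
move=> [H1 [H2 [_ [_ H3]]]] [G1 [G2 [_ [_ G3]]]].
have E1 := codes_ob_fun H1 G1; have E2 := codes_ob_fun H2 G2.
by apply: mor'_ext => // q q'; rewrite H3 G3 E1 E2.
Qed.

Lemma codes_ob_ex i : exists r, codes_ob r i.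
Proof.
case: i => [i|a]; first by exists ((c0, c0), (tval i, zval (obase i))).
have [x Hx] := sp_surj torsor_F a; have [i _] := bs_surj torsor_F a.
by exists ((c0, c1), (tval i, zval a)).
Qed.

Lemma codes_pt_ex q : exists r, codes_pt r q.
Proof.
case: q => [q|x].
  have [z [x _]] := pt_ident q; by exists ((c0, c0), (tval q, x)).
have [i _] := bs_surj torsor_F (p x); have [q _] := torsor_over_surj torsor_F i.
by exists ((c0, c1), (tval q, x)).
Qed.

Lemma codes_mor_ex m : exists r, codes_mor r m.
Proof.
have [ro Hro] := codes_ob_ex (src' m); have [ro' Hro'] := codes_ob_ex (tgt' m).
have [_ [h [h' [/idents'E [w [Hw E0]] [/idents'E [w' [Hw' E1]] E2]]]]] := proj2_sig m.
exists ((ro, ro'), (w, w')); do 4 split=> //; move=> q q'.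
by rewrite [act' m q q']E2; split=> -[x [Hx Hx']]; exists x; split; try exact/E0; exact/E1.
Qed.

(** * The structure of the extended groupoids, expressed on codes *)

Definition ob_code (r : RO) : Prop :=
  (isold (fst r) /\ is_ob (fst (snd r))) \/ (~ isold (fst r) /\ zmem (z := A) (snd (snd r))).

Definition ob_eq (r r' : RO) : Prop := ob_code r /\
  ((isold (fst r) /\ isold (fst r') /\ fst (snd r) = fst (snd r')) \/
   (~ isold (fst r) /\ ~ isold (fst r') /\ snd (snd r) = snd (snd r'))).

Definition pt_code (r : RP) : Prop := ~ isold (fst r) \/ is_pt (fst (snd r)).

Definition pt_code_eq (r r' : RP) : Prop := pt_code r /\
  ((isold (fst r) /\ isold (fst r') /\ fst (snd r) = fst (snd r')) \/
   (~ isold (fst r) /\ ~ isold (fst r') /\ snd (snd r) = snd (snd r'))).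

Definition base_code (r : RO) (v : VA) : Prop := ob_code r /\
  ((isold (fst r) /\ fst (fst (snd r)) = v) \/ (~ isold (fst r) /\ snd (snd r) = v)).

Definition over_code (q : RP) (r : RO) : Prop := pt_code q /\
  ((isold (fst q) /\ isold (fst r) /\ fst (fst (snd q)) = fst (snd r)) \/
   (~ isold (fst q) /\ ~ isold (fst r) /\ pv p (snd (snd q)) = snd (snd r))).

Definition valid_code (r : RO) (w : H * H) : Prop := ob_code r /\
  ((isold (fst r) /\ ident (fst (snd r)) (fst w)) \/
   (~ isold (fst r) /\ Th (snd (snd r), fst w, snd w))).

(** Through [over_code] it also forces [q] to code a point. Hence [act_code] fails on tuples that
    code nothing, and [mor_eq] may quantify over all of [RP]. *)
Definition wit_code (r : RO) (w : H * H) (x : newsort X) (q : RP) : Prop :=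
  base_code r (pv p x) /\ over_code q r /\
  ((isold (fst r) /\ chi x (snd (fst (snd q))) (fst w)) \/
   (~ isold (fst r) /\ exists y, chi x y (fst w) /\ chi (snd (snd q)) y (snd w))).

Definition mor_code (r : RM) : Prop :=
  valid_code (fst (fst r)) (fst (snd r)) /\ valid_code (snd (fst r)) (snd (snd r)) /\
  exists v, base_code (fst (fst r)) v /\ base_code (snd (fst r)) v.

Definition act_code (r : RM) (q q' : RP) : Prop :=
  exists x, wit_code (fst (fst r)) (fst (snd r)) x q /\ wit_code (snd (fst r)) (snd (snd r)) x q'.

Definition mor_eq (r r' : RM) : Prop := mor_code r /\ mor_code r' /\
  ob_eq (fst (fst r)) (fst (fst r')) /\ ob_eq (snd (fst r)) (snd (fst r')) /\
  forall q q', act_code r q q' <-> act_code r' q q'.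

Lemma ob_codeE r : ob_code r <-> exists i, codes_ob r i.
Proof.
split=> [[[Hf Ho]|[Hf Hv]]|[[i|a] [Hf E0]]].
- by have [i Hi] := zset_mk is_ob_zd Ho; exists (inl i); rewrite /= Hi.
- by exists (inr (exist _ _ Hv)).
- by left; rewrite E0; split=> //; exact: tvalP.
- by right; rewrite E0; split=> //; exact: (proj2_sig a).
Qed.

Lemma pt_codeE r : pt_code r <-> exists q, codes_pt r q.
Proof.
split=> [Hr|[[q|x] [Hf E0]]].
- case: (classic (isold (fst r))) => Hf; last by exists (inr (snd (snd r))).
  by case: Hr => // Hq; have [q Eq] := zset_mk is_pt_zd Hq; exists (inl q); rewrite /= Eq.
- by right; rewrite E0; exact: tvalP.
- by left.
Qed.

Lemma ob_eqE r r' i : codes_ob r i -> (ob_eq r r' <-> codes_ob r' i).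
Proof.
move=> Hi; have Hr : ob_code r by apply/ob_codeE; exists i.
case: i Hi => [i|a] [Hf E0]; rewrite /ob_eq /= -E0; split.
- by move=> [_ [[_ [? ->]]|[]]].
- by move=> [? ->]; split=> //; left.
- by move=> [_ [[]|[_ [? ->]]]].
- by move=> [? ->]; split=> //; right.
Qed.

Lemma pt_eqE r r' i : codes_pt r i -> (pt_code_eq r r' <-> codes_pt r' i).
Proof.
move=> Hi; have Hr : pt_code r by apply/pt_codeE; exists i.
case: i Hi => [i|a] [Hf E0]; rewrite /pt_code_eq /= -E0; split.
- by move=> [_ [[_ [? ->]]|[]]].
- by move=> [? ->]; split=> //; left.
- by move=> [_ [[]|[_ [? ->]]]].
- by move=> [? ->]; split=> //; right.
Qed.

Lemma base_codeE r i v : codes_ob r i -> (base_code r v <-> zval (base' i) = v).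
Proof.
move=> Hi; have Hr : ob_code r by apply/ob_codeE; exists i.
case: i Hi => [i|a] [Hf E0]; rewrite /base_code E0 /=; split.
- by move=> [_ [[_ <-]|[]]].
- by move=> <-; split=> //; left.
- by move=> [_ [[]|[_ <-]]].
- by move=> <-; split=> //; right.
Qed.

Lemma over_codeE r q ro : codes_pt r q -> (over_code r ro <-> codes_ob ro (over' q)).
Proof.
move=> Hi; have Hr : pt_code r by apply/pt_codeE; exists q.
case: q Hi => [q|x] [Hf E0]; rewrite /over_code E0 /= ?tval_pover; split.
- by move=> [_ [[_ [? ->]]|[]]].
- by move=> [? ->]; split=> //; left.
- by move=> [_ [[]|[_ [? <-]]]].
- by move=> [? ->]; split=> //; right.
Qed.

Lemma valid_codeE r i w : codes_ob r i -> (valid_code r w <-> valid i w).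
Proof.
move=> Hi; have Hr : ob_code r by apply/ob_codeE; exists i.
case: i Hi => [i|a] [Hf E0]; rewrite /valid_code E0 /=; split.
- by move=> [_ [[]|[]]].
- by move=> Hv; split=> //; left.
- by move=> [_ [[]|[]]].
- by move=> Hv; split=> //; right.
Qed.

Lemma wit_codeE r i w x rq q : codes_ob r i -> codes_pt rq q ->
  (wit_code r w x rq <-> wit i w x q).
Proof.
move=> Hi Hq; rewrite /wit_code (base_codeE _ Hi) (over_codeE _ Hq).
case: i Hi => [i|a] Hi /=.
- have Ho : codes_ob r (over' q) <-> over' q = inl i.
    by split=> [Ho|->] //; exact: codes_ob_fun Ho Hi.
  rewrite Ho; case: Hi => [Hf Ei]; split.
  + move=> [Hb [Hov [[_ Hc]|[]]]] //; case: q Hq Hov {Ho} => // q [_ Eq] [Eo]; exists q.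
    by rewrite -Eq; do !split=> //; apply: zval_inj; exact: esym Hb.
  + move=> [q0 [Eq [Hx [Hov Hc]]]]; subst q; rewrite /= Hov; split; first by rewrite /pv Hx.
    by split=> //; left; split=> //; case: Hq => _ ->.
- have Ho : codes_ob r (over' q) <-> over' q = inr a.
    by split=> [Ho|->] //; exact: codes_ob_fun Ho Hi.
  rewrite Ho; case: Hi => [Hf Ei]; split.
  + move=> [Hb [Hov [[] //|[_ [y [Hy Hy']]]]]]; case: q Hq Hov {Ho} => // x' [_ Eq] [Eo]; exists x'.
    split=> //; split; first by apply: zval_inj; exact: esym Hb.
    by split=> //; exists y; rewrite -Eq.
  + move=> [x' [Eq [Hx [Hov [y Hc]]]]]; subst q; rewrite /= Hov; split; first by rewrite /pv Hx.
    by split=> //; right; split=> //; exists y; case: Hq => _ ->.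
Qed.

Lemma wit_code_pt r w x q : wit_code r w x q -> exists q', codes_pt q q'.
Proof. by move=> [_ [[Hq _] _]]; apply/pt_codeE. Qed.

Lemma mor_codeE r : mor_code r <-> exists m, codes_mor r m.
Proof.
split=> [[Hv [Hv' [v [Hb Hb']]]]|[m [H1 [H2 [H3 [H4 H5]]]]]].
- have /ob_codeE [i Hi] := proj1 Hv; have /ob_codeE [j Hj] := proj1 Hv'.
  move/(valid_codeE _ Hi): Hv => Hv; move/(valid_codeE _ Hj): Hv' => Hv'.
  move/(base_codeE _ Hi): Hb => Hb; move/(base_codeE _ Hj): Hb' => Hb'.
  have [|||m [M1 [M2 M3]]] := phi_mor torsor_F' (i := i) (j := j)
      (h := wit i (fst (snd r))) (h' := wit j (snd (snd r))).
  + by apply: zval_inj; rewrite Hb Hb'.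
  + by apply/idents'E; exists (fst (snd r)).
  + by apply/idents'E; exists (snd (snd r)).
  by exists m; rewrite /codes_mor M1 M2.
- split; first by apply/(valid_codeE _ H1).
  split; first by apply/(valid_codeE _ H2).
  exists (zval (base' (src' m))); split; first exact/(base_codeE _ H1).
  apply/(base_codeE _ H2); congr zval; exact: esym (proj1 (proj2_sig m)).
Qed.

Lemma act_codeE r m q q' rq rq' : codes_mor r m -> codes_pt rq q -> codes_pt rq' q' ->
  (act_code r rq rq' <-> act' m q q').
Proof.
move=> [H1 [H2 [_ [_ H3]]]] Hq Hq'; rewrite H3 /act_code.
by split=> -[x [Hx Hx']]; exists x; split; [apply/(wit_codeE _ _ H1 Hq)|apply/(wit_codeE _ _ H2 Hq')|
  apply/(wit_codeE _ _ H1 Hq)|apply/(wit_codeE _ _ H2 Hq')].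
Qed.

Lemma mor_eqE r r' m : codes_mor r m -> (mor_eq r r' <-> codes_mor r' m).
Proof.
move=> Hm; have Hr : mor_code r by apply/mor_codeE; exists m.
have act_pt r1 q q' : act_code r1 q q' -> (exists q0, codes_pt q q0) /\ exists q0, codes_pt q' q0.
  by move=> [x [/wit_code_pt Hq /wit_code_pt Hq']].
have [H1 [H2 _]] := Hm; split.
- move=> [_ [/mor_codeE [n Hn] [/(ob_eqE _ H1) Hs [/(ob_eqE _ H2) Ht Ha]]]].
  have [N1 [N2 _]] := Hn.
  suff -> : m = n by [].
  apply: mor'_ext; [exact: codes_ob_fun Hs N1|exact: codes_ob_fun Ht N2|].
  move=> q q'; have [rq Hq] := codes_pt_ex q; have [rq' Hq'] := codes_pt_ex q'.
  by rewrite -(act_codeE Hm Hq Hq') Ha (act_codeE Hn Hq Hq').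
- move=> Hm'; have [N1 [N2 _]] := Hm'.
  split=> //; split; first by apply/mor_codeE; exists m.
  split; first exact/(ob_eqE _ H1).
  split; first exact/(ob_eqE _ H2).
  move=> q q'; split=> Ha; have [[q0 Hq] [q0' Hq']] := act_pt _ _ _ Ha; move: Ha;
    by rewrite (act_codeE Hm Hq Hq') (act_codeE Hm' Hq Hq').
Qed.

Ltac zd_use H := apply: (zd_comp H); pm_tac.

Lemma zmem_zdM : zd M (fun v : VA => zmem (z := A) v).
Proof. by apply: zd_old; case: (zmem_def A) => phi Hphi; exists phi. Qed.

Lemma acts_zdM : zd M (fun t : (OT * OT * env U K) * ((OT * Y) * (OT * Y)) =>
  acts (fst t) (fst (snd t)) (snd (snd t))).
Proof.
have cPt := Compat_prod cOb (Compat_old X RY).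
exact: (zd_up (Compat_prod (Compat_prod (Compat_prod cOb cOb) (Compat_old X (Rep_env U K)))
  (Compat_prod cPt cPt)) acts_zd).
Qed.

Lemma isold_zd : zd M isold.
Proof. by rewrite /isold; zd_step. Qed.

Lemma ob_code_zd : zd M ob_code.
Proof.
rewrite /ob_code; apply: zd_or; apply: zd_and.
- zd_use isold_zd.
- zd_use is_ob_zdM.
- by apply: zd_not; zd_use isold_zd.
- zd_use zmem_zdM.
Qed.

Lemma pt_code_zd : zd M pt_code.
Proof.
by rewrite /pt_code; apply: zd_or; [apply: zd_not; zd_use isold_zd|zd_use is_pt_zdM].
Qed.

Lemma ob_eq_zd : zd M (fun t : RO * RO => ob_eq (fst t) (snd t)).
Proof.
rewrite /ob_eq; apply: zd_and; first by zd_use ob_code_zd.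
apply: zd_or; apply: zd_and; try apply: zd_and; try by zd_step.
all: try apply: zd_not; zd_use isold_zd.
Qed.

Lemma pt_eq_zd : zd M (fun t : RP * RP => pt_code_eq (fst t) (snd t)).
Proof.
rewrite /pt_code_eq; apply: zd_and; first by zd_use pt_code_zd.
apply: zd_or; apply: zd_and; try apply: zd_and; try by zd_step.
all: try apply: zd_not; zd_use isold_zd.
Qed.

Lemma base_code_zd : zd M (fun t : RO * VA => base_code (fst t) (snd t)).
Proof.
rewrite /base_code; apply: zd_and; first by zd_use ob_code_zd.
apply: zd_or; apply: zd_and; try by zd_step.
all: try apply: zd_not; zd_use isold_zd.
Qed.

Lemma over_code_zd : zd M (fun t : RP * RO => over_code (fst t) (snd t)).
Proof.
rewrite /over_code; apply: zd_and; first by zd_use pt_code_zd.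
apply: zd_or; apply: zd_and; try apply: zd_and; try by zd_step.
all: try by [apply: (zd2 (P := fun x v => pv p x = v) (zd_pv Xcover)); pm_tac].
all: try apply: zd_not; zd_use isold_zd.
Qed.

Lemma valid_code_zd : zd M (fun t : RO * (H * H) => valid_code (fst t) (snd t)).
Proof.
rewrite /valid_code; apply: zd_and; first by zd_use ob_code_zd.
apply: zd_or; apply: zd_and.
- zd_use isold_zd.
- by apply: (zd2 (P := ident) ident_zdM); pm_tac.
- by apply: zd_not; zd_use isold_zd.
- zd_use Th_zd.
Qed.

Lemma wit_code_zd : zd M (fun t : (RO * (H * H)) * (newsort X * RP) =>
  wit_code (fst (fst t)) (snd (fst t)) (fst (snd t)) (snd (snd t))).
Proof.
rewrite /wit_code; apply: zd_and.
  apply: (zd_iff_ext (P := fun t : (RO * (H * H)) * (newsort X * RP) =>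
    exists v, pv p (fst (snd t)) = v /\ base_code (fst (fst t)) v)).
    by move=> t; split=> [[v [-> ]]|Hb] //; exists (pv p (fst (snd t))).
  zd_step; apply: zd_and; first by apply: (zd2 (P := fun x v => pv p x = v) (zd_pv Xcover)); pm_tac.
  by apply: (zd2 (P := base_code) base_code_zd); pm_tac.
apply: zd_and; first by apply: (zd2 (P := over_code) over_code_zd); pm_tac.
apply: zd_or; apply: zd_and.
- zd_use isold_zd.
- by apply: (zd3 (P := chi) chi_zd); pm_tac.
- by apply: zd_not; zd_use isold_zd.
- by zd_step; apply: zd_and; apply: (zd3 (P := chi) chi_zd); pm_tac.
Qed.

Lemma mor_code_zd : zd M mor_code.
Proof.
rewrite /mor_code; apply: zd_and; first by apply: (zd2 (P := valid_code) valid_code_zd); pm_tac.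
apply: zd_and; first by apply: (zd2 (P := valid_code) valid_code_zd); pm_tac.
by zd_step; apply: zd_and; apply: (zd2 (P := base_code) base_code_zd); pm_tac.
Qed.

Lemma act_code_zd : zd M (fun t : RM * (RP * RP) => act_code (fst t) (fst (snd t)) (snd (snd t))).
Proof.
rewrite /act_code; zd_step; apply: zd_and.
  by apply: (zd_comp (f := fun t : RM * (RP * RP) * newsort X =>
    ((fst (fst (fst (fst t))), fst (snd (fst (fst t)))), (snd t, fst (snd (fst t))))) wit_code_zd); pm_tac.
by apply: (zd_comp (f := fun t : RM * (RP * RP) * newsort X =>
  ((snd (fst (fst (fst t))), snd (snd (fst (fst t)))), (snd t, snd (snd (fst t))))) wit_code_zd); pm_tac.
Qed.

Lemma mor_eq_zd : zd M (fun t : RM * RM => mor_eq (fst t) (snd t)).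
Proof.
rewrite /mor_eq; apply: zd_and; first by zd_use mor_code_zd.
apply: zd_and; first by zd_use mor_code_zd.
do 2 (apply: zd_and; first by apply: (zd2 (P := ob_eq) ob_eq_zd); pm_tac).
zd_step; zd_step; apply: zd_iff.
- by apply: (zd_comp (f := fun t : (RM * RM) * RP * RP => (fst (fst (fst t)), (snd (fst t), snd t))) act_code_zd); pm_tac.
- by apply: (zd_comp (f := fun t : (RM * RM) * RP * RP => (snd (fst (fst t)), (snd (fst t), snd t))) act_code_zd); pm_tac.
Qed.

Lemma codes_ob_zd : zd M (fun t : RO * RO => exists i, codes_ob (fst t) i /\ codes_ob (snd t) i).
Proof.
apply: zd_iff_ext ob_eq_zd => -[r r'] /=; split=> [He|[i [Hi /(ob_eqE _ Hi)]]] //.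
by have /ob_codeE [i Hi] := proj1 He; exists i; split=> //; apply/(ob_eqE _ Hi).
Qed.

Lemma codes_pt_zd : zd M (fun t : RP * RP => exists i, codes_pt (fst t) i /\ codes_pt (snd t) i).
Proof.
apply: zd_iff_ext pt_eq_zd => -[r r'] /=; split=> [He|[i [Hi /(pt_eqE _ Hi)]]] //.
by have /pt_codeE [i Hi] := proj1 He; exists i; split=> //; apply/(pt_eqE _ Hi).
Qed.

Lemma codes_mor_zd : zd M (fun t : RM * RM => exists i, codes_mor (fst t) i /\ codes_mor (snd t) i).
Proof.
apply: zd_iff_ext mor_eq_zd => -[r r'] /=; split=> [He|[i [Hi /(mor_eqE _ Hi)]]] //.
by have /mor_codeE [i Hi] := proj1 He; exists i; split=> //; apply/(mor_eqE _ Hi).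
Qed.

Notation Meq := (expand (eq_expansion M)).
Notation cup R := (Rep_old (eq_expansion M) R).

Lemma coded_base : coded (Rep_old X (Rep_env U (zctx A))) (cup (Rep_old X (Rep_env U (zctx A))))
  (fun v a => v = zval a) (fun a : A => to_Ueq X (zval a)).
Proof.
apply: (coded_val (v := fun a : A => zval a)).
apply: zd_iff_ext zmem_zdM => v; split=> [Hv|[a ->]]; last exact: (proj2_sig a).
by exists (exist _ v Hv).
Qed.

Lemma coded_zset (T : Type) (RU : Rep U T) (P : T -> Prop) (HP : zd U P) (RM : Rep M T)
    (HC : Compat (X := X) RU RM) :
  coded RM (cup (Rep_old X RU)) (fun r (z : zset_of HP) => r = tval z) (fun z => to_Ueq X (zval z)).
Proof.
have -> : (fun z : zset_of HP => to_Ueq X (zval z)) = (fun z => @renc _ Meq _ (cup (Rep_old X RU)) (tval z)).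
  by apply: functional_extensionality => z; rewrite zval_tval.
have [H1 H2] : coded (Rep_old X RU) (cup (Rep_old X RU)) (fun r (z : zset_of HP) => r = tval z)
    (fun z => @renc _ Meq _ (cup (Rep_old X RU)) (tval z)).
  apply: coded_val; apply: zd_old; apply: (zd_iff_ext _ HP) => t; split=> [Ht|[z ->]]; last exact: tvalP.
  by have [z Hz] := zset_mk HP Ht; exists z.
split=> //; apply: (zd_comp (RY := Rep_prod (cup (Rep_old X RU)) (cup (Rep_old X RU))) (f := fun t => (fst t, snd t)) H2).
apply: (pm_pair (RY := cup (Rep_old X RU)) (RZ := cup (Rep_old X RU))).
  apply: (pm_comp (RY := cup RM) (RZ := cup (Rep_old X RU)) (g := fun y => y)).
    by apply: (pm_fst (RY := cup RM) (RZ := cup (Rep_old X RU))); exact: pm_id.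
  by apply: pm_old; exact: (proj2 HC).
by apply: (pm_snd (RY := cup RM) (RZ := cup (Rep_old X RU))); exact: pm_id.
Qed.

Lemma zset_graph (T : Type) (RU : Rep U T) (P : T -> Prop) (HP : zd U P) (RM : Rep M T)
    (HC : Compat (X := X) RU RM) (T2 R2 E2 : Type) (RR2 : Rep M R2) (RE2 : Rep Meq E2)
    (d2 : R2 -> T2 -> Prop) (k2 : T2 -> env Meq (rctx Meq E2)) (g : zset_of HP -> T2)
    (B : T * R2 -> Prop) : coded RR2 RE2 d2 k2 -> zd M B ->
  (forall r1 r2 z t2, r1 = tval z -> d2 r2 t2 -> (B (r1, r2) <-> g z = t2)) ->
  zero_definable (image (fun z : zset_of HP => env_app (to_Ueq X (zval z)) (k2 (g z)))).
Proof. by move=> C2 HB H0; exact: (coded_graph (coded_zset HP HC) C2 HB H0). Qed.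

(** * The extended family in the imaginary sorts *)

Section Coding.
Variables (ZO ZP ZM : zset Meq).
Variables (kO : ob' -> ZO) (uO : ZO -> ob') (kP : pt' -> ZP) (uP : ZP -> pt') (kM : mor' -> ZM) (uM : ZM -> mor').
Hypotheses (kOK : cancel kO uO) (uOK : cancel uO kO) (kPK : cancel kP uP) (uPK : cancel uP kP).
Hypotheses (kMK : cancel kM uM) (uMK : cancel uM kM).
Hypothesis cO : coded _ (Rep_env Meq (zctx ZO)) codes_ob (fun i => zval (kO i)).
Hypothesis cP : coded _ (Rep_env Meq (zctx ZP)) codes_pt (fun q => zval (kP q)).
Hypothesis cM : coded _ (Rep_env Meq (zctx ZM)) codes_mor (fun m => zval (kM m)).

Lemma F'_base : zero_definable (image (fun i : ob' => env_app (zval (kO i)) (to_Ueq X (zval (base' i))))).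
Proof.
apply: (coded_graph cO coded_base base_code_zd) => r1 r2 i a Hi -> /=.
by rewrite (base_codeE _ Hi); split=> [/zval_inj|->].
Qed.

Lemma F'_ends : zero_definable (image (fun m : mor' =>
  env_app (zval (kM m)) (env_app (zval (kO (src' m))) (zval (kO (tgt' m)))))).
Proof.
apply: (coded_graph2 cM cO cO (B := fun t : RM * (RO * RO) =>
  ob_eq (fst (fst (fst t))) (fst (snd t)) /\ ob_eq (snd (fst (fst t))) (snd (snd t)))).
  by apply: zd_and; apply: (zd2 (P := ob_eq) ob_eq_zd); pm_tac.
move=> r1 r2 r3 m i j [H1 [H2 _]] Hi Hj /=; rewrite (ob_eqE _ H1) (ob_eqE _ H2).
by split=> [[Hs Ht]|[-> ->]] //; split; [exact: codes_ob_fun Hs Hi|exact: codes_ob_fun Ht Hj].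
Qed.

Lemma F'_over : zero_definable (image (fun q : pt' => env_app (zval (kP q)) (zval (kO (over' q))))).
Proof.
apply: (coded_graph cP cO over_code_zd) => r1 r2 q i Hq Hi /=.
by rewrite (over_codeE _ Hq); split=> [Ho|->] //; exact: codes_ob_fun Ho Hi.
Qed.

Lemma F'_act : zero_definable (fun z => exists (m : mor') (q q' : pt'), act' m q q' /\
  z = env_app (zval (kM m)) (env_app (zval (kP q)) (zval (kP q')))).
Proof.
apply: (coded_rel3 cM cP cP act_code_zd) => r1 r2 r3 m q q' Hm Hq Hq' /=; exact: act_codeE.
Qed.

Definition FG' : groupoid_family (M := Ueq X) (fun a : A => to_Ueq X (zval a)) :=
  torsor_groupoid torsor_F' kOK uOK kMK uMK kPK uPK F'_base F'_ends F'_over F'_act.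

(** * The inclusion of the family in [U] as a full subfamily *)

Lemma imor_ex (m : FM) : exists m' : mor', src' m' = inl (msrc m) /\ tgt' m' = inl (mtgt m) /\
  forall q q', act' m' q q' <-> exists q0 q0', q = inl q0 /\ q' = inl q0' /\ mact m q0 q0'.
Proof.
have [Hb [h [h' [Hh [Hh' E0]]]]] := mor_phi torsor_F m.
have [||m' [H1 [H2 H3]]] := phi_mor torsor_F' (i := inl (msrc m)) (j := inl (mtgt m))
  (h := fun x q => exists q0, q = inl q0 /\ h x q0) (h' := fun x q => exists q0, q = inl q0 /\ h' x q0) Hb.
- by exists h.
- by exists h'.
exists m'; do 2 split=> //; move=> q q'; rewrite H3; split.
- by move=> [x [[q0 [-> Hx]] [q0' [-> Hx']]]]; exists q0, q0'; do 2 split=> //; apply/E0; exists x.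
- by move=> [q0 [q0' [-> [-> /E0 [x [Hx Hx']]]]]]; exists x; split; [exists q0|exists q0'].
Qed.

Definition imor (m : FM) : mor' := proj1_sig (constructive_indefinite_description _ (imor_ex m)).

Lemma src_imor m : src' (imor m) = inl (msrc m).
Proof. exact: (proj1 (proj2_sig (constructive_indefinite_description _ (imor_ex m)))). Qed.

Lemma tgt_imor m : tgt' (imor m) = inl (mtgt m).
Proof. exact: (proj1 (proj2 (proj2_sig (constructive_indefinite_description _ (imor_ex m))))). Qed.

Lemma act_imor m q q' : act' (imor m) (inl q) (inl q') <-> mact m q q'.
Proof.
rewrite (proj2 (proj2 (proj2_sig (constructive_indefinite_description _ (imor_ex m)))) _ _).
by split=> [[q0 [q0' [[->] [[->]]]]]|Ha]; last by exists q, q'.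
Qed.

Lemma act_old (m : mor') i j q q' : src' m = inl i -> tgt' m = inl j -> act' m q q' ->
  exists q0 q0', q = inl q0 /\ q' = inl q0' /\ pover q0 = i /\ pover q0' = j.
Proof.
move=> Hs Ht /(torsor_act_over torsor_F') [].
by rewrite Hs Ht; case: q => q //; case: q' => q' // [<-] [<-]; exists q, q'.
Qed.

(** Between old objects both relations hold only of old points, so agreement on these is enough. *)
Lemma imor_eq (m : FM) (m' : mor') : src' m' = inl (msrc m) -> tgt' m' = inl (mtgt m) ->
  (forall q q', act' m' (inl q) (inl q') <-> mact m q q') -> imor m = m'.
Proof.
move=> Hs Ht Ha; apply: mor'_ext; rewrite ?src_imor ?tgt_imor // => q q'.
split=> Hq.
- have [q0 [q0' [E1 [E2 _]]]] := act_old (src_imor m) (tgt_imor m) Hq.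
  by subst; apply/Ha/act_imor.
- have [q0 [q0' [E1 [E2 _]]]] := act_old Hs Ht Hq.
  by subst; apply/act_imor/Ha.
Qed.

(** A morphism between old objects is [h' h^-1] with both identifications coming from the old
    torsor, which therefore already contains it. *)
Lemma imor_full (m' : mor') i j : src' m' = inl i -> tgt' m' = inl j ->
  exists m, msrc m = i /\ mtgt m = j /\ imor m = m'.
Proof.
move=> Hs Ht; have [Hb [h [h' [Hh [Hh' E0]]]]] := mor_phi torsor_F' m'.
rewrite Hs Ht in Hb Hh Hh'; have [h0 [Hh0 E1]] := Hh; have [h0' [Hh0' E1']] := Hh'.
have [m [H1 [H2 H3]]] := phi_mor torsor_F Hb Hh0 Hh0'.
exists m; do 2 split=> //; apply: imor_eq; rewrite ?H1 ?H2 // => q q'; rewrite E0 H3.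
split=> -[x [Hx Hx']]; exists x; split.
- by have [q0 [[->]]] := proj1 (E1 _ _) Hx.
- by have [q0 [[->]]] := proj1 (E1' _ _) Hx'.
- by apply/E1; exists q.
- by apply/E1'; exists q'.
Qed.

Lemma iOb_zd : zero_definable (image (fun i : FO => env_app (to_Ueq X (zval i)) (zval (kO (inl i))))).
Proof.
apply: (zset_graph (HP := is_ob_zd) cOb (g := inl) cO (B := fun t : OT * RO => isold (fst (snd t)) /\ fst (snd (snd t)) = fst t)).
  by apply: zd_and; [zd_use isold_zd|zd_step].
move=> o r i j -> /= Hj; split=> [[Hf Eo]|Ej]; first by apply: codes_ob_fun Hj; split.
by move: Hj; rewrite -Ej.
Qed.

Lemma iPt_zd : zero_definable (image (fun q : FP => env_app (to_Ueq X (zval q)) (zval (kP (inl q))))).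
Proof.
apply: (zset_graph (HP := is_pt_zd) (Compat_prod cOb (Compat_old X RY)) (g := inl) cP (B := fun t : (OT * Y) * RP => isold (fst (snd t)) /\ fst (snd (snd t)) = fst t)).
  by apply: zd_and; [zd_use isold_zd|zd_step].
move=> o r i j -> /= Hj; split=> [[Hf Eo]|Ej]; first by apply: codes_pt_fun Hj; split.
by move: Hj; rewrite -Ej.
Qed.

Lemma newob_zd : zero_definable (image (fun a : A => env_app (to_Ueq X (zval a)) (zval (kO (inr a))))).
Proof.
apply: (coded_graph coded_base cO (g := inr) (B := fun t : VA * RO => ~ isold (fst (snd t)) /\ snd (snd (snd t)) = fst t)).
  by apply: zd_and; [apply: zd_not; zd_use isold_zd|zd_step].
move=> o r i j -> /= Hj; split=> [[Hf Eo]|Ej]; first by apply: codes_ob_fun Hj; split.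
by move: Hj; rewrite -Ej.
Qed.

Lemma coded_newsort : coded (Rep_new X) (cup (Rep_new X)) (fun r x => r = x)
  (fun x : newsort X => (x, tt) : env Meq [inl (inr tt) : sort (extend (eq_ext M))]).
Proof.
apply: (coded_val (v := fun x : newsort X => x)); apply: zd_iff_ext (zd_True (X := newsort X)) => x.
by split=> // _; exists x.
Qed.

Lemma newpt_zd : zero_definable (M := Meq) (G := inl (inr tt) :: zctx ZP)
  (image (fun s : newsort X => (s, zval (kP (inr s))))).
Proof.
apply: (coded_graph coded_newsort cP (g := inr) (B := fun t : newsort X * RP => ~ isold (fst (snd t)) /\ snd (snd (snd t)) = fst t)).
  by apply: zd_and; [apply: zd_not; zd_use isold_zd|zd_step].
move=> o r i j -> /= Hj; split=> [[Hf Eo]|Ej]; first by apply: codes_pt_fun Hj; split.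
by move: Hj; rewrite -Ej.
Qed.

(** Fixing the ends and the action on codes with the old flag is enough to pin down the image of an
    old morphism, because old objects have only old points. *)
Definition imor_code (t : (OT * OT * env U K) * RM) : Prop :=
  isold (fst (fst (fst (snd t)))) /\ fst (snd (fst (fst (snd t)))) = fst (fst (fst t)) /\
  isold (fst (snd (fst (snd t)))) /\ fst (snd (snd (fst (snd t)))) = snd (fst (fst t)) /\
  forall q q' : RP, isold (fst q) -> isold (fst q') ->
    (act_code (snd t) q q' <-> acts (fst t) (fst (snd q)) (fst (snd q'))).

Lemma imor_code_zd : zd M imor_code.
Proof.
rewrite /imor_code; apply: zd_and; first by zd_use isold_zd.
apply: zd_and; first by zd_step.
apply: zd_and; first by zd_use isold_zd.
apply: zd_and; first by zd_step.
zd_step; zd_step; apply: zd_imp; first by zd_use isold_zd.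
apply: zd_imp; first by zd_use isold_zd.
apply: zd_iff.
  by apply: (zd_comp (f := fun t : ((OT * OT * env U K) * RM) * RP * RP =>
    (snd (fst (fst t)), (snd (fst t), snd t))) act_code_zd); pm_tac.
by apply: (zd_comp (f := fun t : ((OT * OT * env U K) * RM) * RP * RP =>
  (fst (fst (fst t)), (fst (snd (snd (fst t))), fst (snd (snd t))))) acts_zdM); pm_tac.
Qed.

Lemma imor_codeE mo r m m' : mo = tval m -> codes_mor r m' -> (imor_code (mo, r) <-> imor m = m').
Proof.
move=> -> Hm'; have [K1 [K2 _]] := Hm'.
split=> [[F1 [E1 [F2 [E2 Ha]]]]|Em].
(* Any element of the new sort can fill the coordinate not in use. *)
- have x0 : newsort X := epsilon (ncar_inhabited X tt) (fun _ => True).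
  apply: imor_eq.
  + by apply: (codes_ob_fun K1); split=> //; exact: eq_trans E1 (esym (tval_msrc m)).
  + by apply: (codes_ob_fun K2); split=> //; exact: eq_trans E2 (esym (tval_mtgt m)).
  move=> q q'.
  have Hq (r0 : FP) : codes_pt ((c0, c0), (tval r0, x0)) (inl r0) by [].
  rewrite -(act_codeE Hm' (Hq q) (Hq q')) -actsE; exact: Ha.
- rewrite -Em in Hm' K1 K2; rewrite src_imor in K1; rewrite tgt_imor in K2.
  have [F1 E1] := K1; have [F2 E2] := K2.
  split; first exact: F1.
  split; first exact: eq_trans E1 (tval_msrc m).
  split; first exact: F2.
  split; first exact: eq_trans E2 (tval_mtgt m).
  move=> rq rq' Hf Hf'; split=> Ha.
  + have [x [/wit_code_pt [q Hq] /wit_code_pt [q' Hq']]] := Ha.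
    case: q Hq => [q|z] Hq; last by case: (proj1 Hq).
    case: q' Hq' => [q'|z] Hq'; last by case: (proj1 Hq').
    move/(act_codeE Hm' Hq Hq')/act_imor/actsE: Ha.
    by rewrite -(proj2 Hq) -(proj2 Hq').
  + have [q Eq] := zset_mk is_pt_zd (proj1 (proj2 Ha)).
    have [q' Eq'] := zset_mk is_pt_zd (proj1 (proj2 (proj2 Ha))).
    have Hq : codes_pt rq (inl q) by split=> //; exact: esym Eq.
    have Hq' : codes_pt rq' (inl q') by split=> //; exact: esym Eq'.
    by apply/(act_codeE Hm' Hq Hq')/act_imor/actsE; rewrite Eq Eq'.
Qed.

Lemma iMor_zd : zero_definable (image (fun m : FM => env_app (to_Ueq X (zval m)) (zval (kM (imor m))))).
Proof. exact: (zset_graph (HP := is_mor_zd) (Compat_prod (Compat_prod cOb cOb) (Compat_old X (Rep_env U K))) cM imor_code_zd imor_codeE). Qed.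

Definition maps : extension_maps FG FG' :=
  @ExtensionMaps L U N X A FG FG' (fun i : FO => kO (inl i)) (fun m : FM => kM (imor m))
    (fun q : FP => kP (inl q)) (fun a => kO (inr a)) (fun s => kP (inr s))
    iOb_zd iMor_zd iPt_zd newob_zd newpt_zd.

(** * Finite faithfulness, and the vertex groups at the new objects *)

Lemma auts_fix a : exists l, (forall x, In x l -> p x = a) /\ forall g g', auts g -> auts g' ->
  (forall x, In x l -> g x = g' x) -> forall x, p x = a -> g x = g' x.
Proof.
have [_ [b [Hb _]]] := shape a; have [l [Hl Hfix]] := fibre_fix Hb.
exists l; split=> // g g' [sigma [Hs Eg]] [tau [Ht Eg']] Hg x Hx.
have [k [Hk [K1 K2]]] := aut_over_inv Ht.
(* The composite of [sigma] with the inverse of [tau] fixes the list, hence the fibre. *)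
have E0 : k (inr tt) (sigma (inr tt) x) = x.
  by apply: (Hfix _ (aut_over_comp Hs Hk)) => // y Hy; rewrite -Eg Hg // Eg' K1.
by rewrite Eg Eg' -{2}E0 K2.
Qed.

Lemma FG_faithful : finitely_faithful FG.
Proof. exact: torsor_faithful auts_fix. Qed.

Lemma FG'_faithful : finitely_faithful FG'.
Proof. exact: torsor_faithful auts_fix. Qed.

Lemma maps_extension a : one_object_extension p maps a.
Proof.
have kO_inj : injective kO by exact: can_inj kOK.
have kP_inj : injective kP by exact: can_inj kPK.
split.
- by move=> i Hi; rewrite /= kOK.
- by move=> i j _ _ /kO_inj [].
- by rewrite /= kOK.
- by move=> i _ /kO_inj.
- move=> i'; rewrite /=; case E0 : (uO i') => [i|b] /= Hi.
    by right; exists i; split=> //; rewrite -E0 uOK.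
  by left; rewrite -Hi -E0 uOK.
- by move=> q _; rewrite /= kPK.
- by move=> q q' _ _ /kP_inj [].
- move=> i x' _ /kO_inj; case E0 : (uP x') => [q|x] //= [Eq].
  by exists q; split=> //; rewrite -E0 uPK.
- by move=> m _; rewrite /= !kMK src_imor tgt_imor.
- by move=> m q q' _ _ _; rewrite /= kMK !kPK; exact: act_imor.
- move=> m n _ _ /(can_inj kMK) Emn; apply: (mor_ext torsor_F).
  + by have := src_imor m; rewrite Emn src_imor => -[].
  + by have := tgt_imor m; rewrite Emn tgt_imor => -[].
  + by move=> q q'; rewrite -!act_imor Emn.
- move=> i j m' _ _ /kO_inj Hs /kO_inj Ht; have [m [H1 [H2 H3]]] := imor_full Hs Ht.
  by exists m; do 2 split=> //; rewrite /= H3 uMK.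
- by move=> s Hs; rewrite /= kPK /= Hs.
- by move=> s t _ _ /kP_inj [].
- move=> x' /kO_inj; case E0 : (uP x') => [q|x] //= [Ex].
  by exists x; split=> //; rewrite -E0 uPK.
Qed.

(** A loop at [S_a] is [h' h^-1] with [h] and [h'] restrictions of automorphisms, hence the
    restriction of the second composed with the inverse of the first. *)
Lemma vertex_aut (m : mor') a : src' m = inr a -> tgt' m = inr a -> exists tau, aut_over (X := X) tau /\
  forall q q', act' m q q' <-> exists x, p x = a /\ q = inr x /\ q' = inr (tau (inr tt) x).
Proof.
move=> Hs Ht; have [_ [h [h' [Hh [Hh' E0]]]]] := mor_phi torsor_F' m.
rewrite Hs in Hh; rewrite Ht in Hh'.
have [sigma [Ss E1]] := Hh; have [tau [St E2]] := Hh'.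
have [k [Hk [K1 K2]]] := aut_over_inv Ss.
exists (fun s x => tau s (k s x)); split; first exact: aut_over_comp.
move=> q q'; rewrite E0; split=> [[x [/E1 [Hx ->] /E2 [_ ->]]]|[x [Hx [-> ->]]]].
- by exists (sigma (inr tt) x); rewrite aut_p // K1.
- exists (k (inr tt) x); split; last by apply/E2; rewrite aut_p.
  by apply/E1; rewrite aut_p // K2.
Qed.

Lemma vertex_mor a tau : aut_over (X := X) tau -> exists m : mor', src' m = inr a /\ tgt' m = inr a /\
  forall q q', act' m q q' <-> exists x, p x = a /\ q = inr x /\ q' = inr (tau (inr tt) x).
Proof.
move=> Ht.
have [|||m [H1 [H2 H3]]] := phi_mor torsor_F' (i := inr a) (j := inr a)
  (h := fun x q => p x = a /\ q = inr x) (h' := fun x q => p x = a /\ q = inr (tau (inr tt) x)).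
- by [].
- by exists (fun s x => x); split; first exact: aut_over_id.
- by exists tau.
exists m; do 2 split=> //; move=> q q'; rewrite H3.
by split=> [[x [[Hx ->] [_ ->]]]|[x [Hx [-> ->]]]]; exists x.
Qed.

Lemma maps_action a : same_action p maps a.
Proof.
have fib_eq (x y : fibre p a) : proj1_sig x = proj1_sig y -> x = y.
  by move=> E0; apply: eq_sig_hprop => // z u v; exact: proof_irrelevance.
have aut_eq (g g' : aut_fibre p a) : (forall x, proj1_sig g x = proj1_sig g' x) -> g = g'.
  move=> E0; apply: eq_sig_hprop => [z u v|]; first exact: proof_irrelevance.
  exact: functional_extensionality.
have gaut_ends (m : gaut (newob maps a)) : src' (uM (proj1_sig m)) = inr a /\ tgt' (uM (proj1_sig m)) = inr a.
  by case: m => m [H1 H2] /=; split; apply: (can_inj kOK).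
(* [R m g] says that the loop [m] acts on [S_a] as [g] does. Each loop and each [g] has exactly one
   partner, which gives the bijection; compatibility with composition then follows from
   compatibility with the actions. *)
pose R (m : gaut (newob maps a)) (g : aut_fibre p a) : Prop :=
  forall q q', act' (uM (proj1_sig m)) q q' <->
    exists x : fibre p a, q = inr (proj1_sig x) /\ q' = inr (proj1_sig (proj1_sig g x)).
have [h Hh] : exists h, forall m, R m (h m).
  apply: dep_choice => m; have [H1 H2] := gaut_ends m; have [tau [Ht E0]] := vertex_aut H1 H2.
  have Hp (x : fibre p a) : p (tau (inr tt) (proj1_sig x)) = a by rewrite aut_p // (proj2_sig x).
  exists (exist _ (fun x => exist _ _ (Hp x)) (ex_intro _ tau (conj Ht (fun x => erefl)))).
  move=> q q'; rewrite E0; split=> [[x [Hx [-> ->]]]|[[x Hx] [-> ->]]]; last by exists x.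
  by exists (exist _ x Hx).
have R_inj m m' g : R m g -> R m' g -> m = m'.
  move=> E1 E2; apply: eq_sig_hprop => [z u v|]; first exact: proof_irrelevance.
  apply: (can_inj uMK); have [S1 T1] := gaut_ends m; have [S2 T2] := gaut_ends m'.
  by apply: mor'_ext; rewrite ?S1 ?S2 ?T1 ?T2 // => q q'; rewrite E1 E2.
have R_surj g : exists m, R m g.
  have [tau [Ht Hr]] := proj2_sig g; have [m [H1 [H2 E0]]] := vertex_mor a Ht.
  have Hm : src (kM m : Mor FG') = newob maps a /\ tgt (kM m : Mor FG') = newob maps a.
    by rewrite /= kMK H1 H2.
  exists (exist _ (kM m) Hm) => q q'; rewrite /= kMK E0; split.
    by move=> [x [Hx [-> ->]]]; exists (exist _ x Hx); rewrite (Hr (exist _ x Hx)).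
  by move=> [x [-> ->]]; exists (proj1_sig x); rewrite Hr; split; first exact: (proj2_sig x).
have hE m (x y : fibre p a) : act' (uM (proj1_sig m)) (inr (proj1_sig x)) (inr (proj1_sig y)) <->
    proj1_sig (h m) x = y.
  rewrite Hh; split=> [[z [[Ez] [Ey]]]|<-]; last by exists x.
  by rewrite (fib_eq _ _ Ez); apply: fib_eq.
exists h; split; [|split].
- have [k Hk] := dep_choice R_surj; exists k.
    by move=> m; apply: (R_inj _ _ (h m)); [exact: Hk|exact: Hh].
  move=> g; apply: aut_eq => x; apply/hE; apply/Hk; by exists x.
- move=> m n r Hr x.
  have := proj1 (Hr (kP (inr (proj1_sig x))) (kP (inr (proj1_sig (proj1_sig (h r) x))))).
  rewrite /= !kPK => -[|y]; first exact/hE.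
  move=> [H1 H2]; have [z [_ Ey]] := proj1 (Hh m _ _) H1.
  rewrite Ey in H1 H2; move/hE: H1 => ->.
  by symmetry; apply/hE.
- by move=> m x y; rewrite /= !kPK; exact: hE.
Qed.

End Coding.

Lemma families_exist : exists (F : groupoid_family (M := U) (zval (X := A)))
    (F' : groupoid_family (M := Ueq X) (fun a : A => to_Ueq X (zval a))),
  finitely_faithful F /\ finitely_faithful F' /\
  exists E0 : extension_maps F F', forall a : A, one_object_extension p E0 a /\ same_action p E0 a.
Proof.
have [ZO [kO [uO [kOK [uOK cO]]]]] := eq_code codes_ob_fun codes_ob_ex codes_ob_zd.
have [ZP [kP [uP [kPK [uPK cP]]]]] := eq_code codes_pt_fun codes_pt_ex codes_pt_zd.
have [ZM [kM [uM [kMK [uMK cM]]]]] := eq_code codes_mor_fun codes_mor_ex codes_mor_zd.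
exists FG, (FG' kOK uOK kPK uPK kMK uMK cO cP cM); split; first exact: FG_faithful.
split; first exact: FG'_faithful.
exists (maps kOK uOK kPK uPK kMK uMK cO cP cM) => a; split; [exact: maps_extension|exact: maps_action].
Qed.

End Families.

Theorem theorem5p5 (L : lang) (T : theory L)
    (Tcomplete : complete T) (Tei : elim_imaginaries T)
    (U : structure L) (UT : models T U) (Umonster : monster U)
    (A : zset U) (N : lang_ext L unit) (X : expansion U N) (p : newsort X -> A)
    (Xcover : one_analysable_cover p) (Xindep : independent_fibres p) :
  exists (F : groupoid_family (M := U) (zval (X := A)))
         (F' : groupoid_family (M := Ueq X) (fun a : A => to_Ueq X (zval a))),
    finitely_faithful F /\ finitely_faithful F' /\
    exists E : extension_maps F F',
      forall a : A, one_object_extension p E a /\ same_action p E a.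
Proof.
have HU := proj2 Umonster; have HX := proj1 Xcover; have Hfg := proj1 (proj2 Xcover).
have [H [Y [C [RH [RY [RC [chi [kappa [chi_zd [kappa_zd shape]]]]]]]]]] := uniform_shape HU Xcover Xindep.
have [Th [Th_zd ThE]] := zd_conj_at Xcover Xindep chi_zd.
(* At parameters [z] and [z'] the trace of [Q] is the graph of [f_z' f_z^-1]. A uniform definition
   of these graphs in [U] is what elimination of imaginaries can code. *)
pose Q (t : (env U (zctx A) * H * H) * (Y * Y)) : Prop := exists x, pv p x = fst (fst (fst t)) /\
  chi x (fst (snd t)) (snd (fst (fst t))) /\ chi x (snd (snd t)) (snd (fst t)).
have HQ : zd (expand X) Q.
  rewrite /Q; zd_step; apply: zd_and; first by apply: (zd2 (P := fun x v => pv p x = v) (zd_pv Xcover)); pm_tac.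
  by apply: zd_and; apply: (zd3 (P := chi) chi_zd); pm_tac.
have [E [RE [Psi [Psi_zd HPsi]]]] := uniform_trace HU HX Hfg (Compat_prod (Compat_old X RY) (Compat_old X RY)) HQ.
have [K [cod [cod_zd codP]]] := elim_code Tei UT Psi_zd.
have [s0 [c0 [c1 c01]]] := two_elements HU.
apply: (families_exist Xcover Xindep chi_zd kappa_zd shape Th_zd ThE Psi_zd _ cod_zd codP c01).
by move=> v z z'; have [e He] := HPsi (v, z, z'); exists e => y y'; exact: (He (y, y')).
Qed.
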